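(* Let $n\ge 1$, $\hbar>0$, and let $\theta=(\theta^{ij})$ be a constant real antisymmetric $n\times n$ matrix. Let $f=f(x,p)$ be a real distribution function on $\mathbb{R}^n\times\mathbb{R}^n$ satisfying $$\int d^nx\,d^np\,f(x,p)=1\qquad\text{and}\qquad f*f=\kappa f$$ for some constant $\kappa$. Let $G$ be the Hermitian kernel defined by $G(x-\frac{\hbar}{2}w,\,x+\frac{\hbar}{2}w)=\int d^np\,e^{-iw\cdot p}f(x,p)$, which is square integrable with $\int d^nx\,d^nl\,|G(x,l)|^2=\kappa(2\pi\hbar)^n$. Then $G$ has only one distinct eigenvalue, $1/(\kappa(2\pi\hbar)^n)$; its multiplicity $m$ is finite (so the kernel is degenerate), and $$\kappa=\frac{1}{m\,(2\pi\hbar)^n},\qquad m\in\{1,2,3,\dots\}.$$ Moreover, if $m=1$ (pure state), then $f*f=(2\pi\hbar)^{-n}f$, and there is a square integrable function $\phi:\mathbb{R}^n\to\mathbb{C}$ with $\int d^nx\,|\phi(x)|^2=1$ such that $$G(x-\tfrac{\hbar}{2}w,\,x+\tfrac{\hbar}{2}w)=\phi(x-\tfrac{\hbar}{2}w)*_\theta\overline{\phi}(x+\tfrac{\hbar}{2}w),$$ $$f(x,p)=\frac{1}{(2\pi)^n}\int d^n w\;e^{ip\cdot w}\;\phi(x-\tfrac{\hbar}{2}w)*_\theta\overline{\phi}(x+\tfrac{\hbar}{2}w).$$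
   Context: No particular function class is fixed for $f$: it is a function for which the Fourier representations, star products and integrals written here are meaningful. Notation: $k\cdot x=\sum_i k_i x^i$, $\theta(k,k')=\sum_{i,j}\theta^{ij}k_ik'_j$, overline is complex conjugation. For $A$ on $\mathbb{R}^{2n}$, $\tilde A(k,l)=\int d^nx\,d^np\, e^{-ik\cdot x-il\cdot p}A(x,p)$; for $u$ on $\mathbb{R}^n$, $\tilde u(k)=\int d^nx\, e^{-ik\cdot x}u(x)$. Star products: $$(A*C)(x,p)=\frac{1}{(2\pi)^{4n}}\int \tilde A(k,l)\tilde C(k',l')\,e^{-\frac{i\hbar}{2}(k\cdot l'-k'\cdot l)}e^{-\frac i2\theta(k,k')}e^{i(k+k')\cdot x+i(l+l')\cdot p}\,d^nk\,d^nl\,d^nk'\,d^nl',$$ and, for functions of $x$ only, $$(u*_\theta v)(x)=\frac{1}{(2\pi)^{2n}}\int\tilde u(k)\tilde v(k')\,e^{-\frac i2\theta(k,k')}e^{i(k+k')\cdot x}\,d^nk\,d^nk'.$$ In expressions such as $\phi(x-\frac\hbar2w)*_\theta\overline\phi(x+\frac\hbar2w)$ or $G(x,l+x)*_\theta u(l+x)$, the product $*_\theta$ is taken in the variable $x$, with $w$ or $l$ held fixed. Eigenvalues of the kernel are understood in the integral-equation sense: $\mu$ is an eigenvalue of $G$ with eigenfunction $u$ if $u(x)=\mu\int d^nl\,G(x,l+x)*_\theta u(l+x)$; the expansion of the kernel in orthonormal eigenfunctions is $G(x,l+x)=\sum_i \mu_i^{-1}\phi_i(x)*_\theta\overline{\phi_i}(l+x)$.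 Hermitian means $\overline{G(x,l)}=G(l,x)$. The integer $m$ is interpreted as the number of mixed, equally probable and noninterfering states. *)

(* Defs.v *)
From HB Require Import structures.
From mathcomp Require Import all_boot all_order all_algebra.
From mathcomp Require Import all_classical all_reals all_analysis.
From mathcomp Require Import complex.

Set Implicit Arguments.
Unset Strict Implicit.
Unset Printing Implicit Defensive.

Import Order.TTheory GRing.Theory Num.Theory.
Import numFieldNormedType.Exports.

Local Open Scope classical_set_scope.
Local Open Scope ring_scope.
Local Open Scope complex_scope.

(* R^n is 'rV[R]_n, with the product sigma-algebra, i.e. the one generated by
   the coordinates (as the library does for n.-tuple T). *)
Definition measure_rV_display : measure_display. Proof. exact. Qed.

Section measurable_rV.
Variables (R : realType) (n : nat).

Definition rV_coord (i : 'I_n) (x : 'rV[R]_n) : R := x ord0 i.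

Let rV_set0 : g_sigma_preimage rV_coord set0.
Proof. exact: sigma_algebra0. Qed.

Let rV_setC A : g_sigma_preimage rV_coord A -> g_sigma_preimage rV_coord (~` A).
Proof. exact: sigma_algebraC. Qed.

Let rV_bigcup (F : (set 'rV[R]_n)^nat) :
  (forall i, g_sigma_preimage rV_coord (F i)) ->
  g_sigma_preimage rV_coord (\bigcup_i (F i)).
Proof. exact: sigma_algebra_bigcup. Qed.

HB.instance Definition _ := @isMeasurable.Build measure_rV_display
  'rV[R]_n (g_sigma_preimage rV_coord) rV_set0 rV_setC rV_bigcup.

Lemma measurable_rV_coord (i : 'I_n) : measurable_fun [set: 'rV[R]_n] (rV_coord i).
Proof.
move=> _ Y mY; rewrite setTI; apply: sub_sigma_algebra => /=.
rewrite -bigcup_seq/=; exists i => /=; first by rewrite mem_index_enum.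
by exists Y => //; rewrite setTI.
Qed.

Lemma measurable_fun_rVP d (T : measurableType d) (f : T -> 'rV[R]_n) :
  (forall i, measurable_fun [set: T] (fun t => f t ord0 i)) ->
  measurable_fun [set: T] f.
Proof.
move=> mf _ A mA; rewrite setTI; move: A mA.
suff: g_sigma_preimage rV_coord `<=` [set A | measurable (f @^-1` A)] by [].
apply: smallest_sub.
  split => /=.
  - by rewrite preimage_set0.
  - by move=> A mA; rewrite setTD preimage_setC; exact: measurableC.
  - by move=> F mF; rewrite preimage_bigcup; exact: bigcup_measurable.
rewrite -bigcup_seq => A [i _ [B mB <-]] /=.
rewrite setTI; have := mf i measurableT B mB; by rewrite setTI.
Qed.
End measurable_rV.

Lemma sigma_finite_product_measure1 d1 d2 (T1 : measurableType d1)
    (T2 : measurableType d2) (R : realType)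
    (m1 : {sigma_finite_measure set T1 -> \bar R})
    (m2 : {sigma_finite_measure set T2 -> \bar R}) :
  sigma_finite setT (m1 \x m2)%E.
Proof.
have /sigma_finiteP[F [TF ndF Foo]] := sigma_finiteT m1.
have /sigma_finiteP[G [TG ndG Goo]] := sigma_finiteT m2.
exists (fun n => F n `*` G n).
  rewrite -setXTT TF TG predeqE => -[x y]; split.
    move=> [/= [n _ Fnx] [k _ Gky]]; exists (maxn n k) => //; split.
    - by move: x Fnx; exact/subsetPset/ndF/leq_maxl.
    - by move: y Gky; exact/subsetPset/ndG/leq_maxr.
  by move=> [n _ []/= ? ?]; split; exists n.
move=> k; have [? ?] := Foo k; have [? ?] := Goo k.
split; first exact: measurableX.
by rewrite product_measure1E// lte_mul_pinfty// ge0_fin_numE.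
Qed.

Section lebesgue_rV.
Variable R : realType.

Definition rV_cons n (z : R * 'rV[R]_n) : 'rV[R]_n.+1 :=
  \row_i oapp (z.2 ord0) z.1 (unlift ord0 i).

Definition rV_uncons n (x : 'rV[R]_n.+1) : R * 'rV[R]_n :=
  (x ord0 ord0, \row_i x ord0 (lift ord0 i)).

Lemma rV_cons0 n (z : R * 'rV[R]_n) : rV_cons z ord0 ord0 = z.1.
Proof. by rewrite mxE unlift_none. Qed.

Lemma rV_consS n (z : R * 'rV[R]_n) i :
  rV_cons z ord0 (lift ord0 i) = z.2 ord0 i.
Proof. by rewrite mxE liftK. Qed.

Lemma rV_consK n : cancel (@rV_cons n) (@rV_uncons n).
Proof.
move=> [a v]; rewrite /rV_uncons rV_cons0; congr pair.
by apply/rowP => i; rewrite mxE rV_consS.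
Qed.

Lemma rV_unconsK n : cancel (@rV_uncons n) (@rV_cons n).
Proof.
move=> x; apply/rowP => j.
by case: (unliftP ord0 j) => [i ->|->]; rewrite ?rV_cons0// rV_consS mxE.
Qed.

Lemma measurable_rV_cons n : measurable_fun setT (@rV_cons n).
Proof.
apply: measurable_fun_rVP => j; case: (unliftP ord0 j) => [i ->|->].
  under eq_fun do rewrite rV_consS.
  exact: (measurableT_comp (measurable_rV_coord i) measurable_snd).
by under eq_fun do rewrite rV_cons0; exact: measurable_fst.
Qed.

Lemma measurable_rV_uncons n : measurable_fun setT (@rV_uncons n).
Proof.
apply/measurable_fun_pairP; split.
  exact: (@measurable_rV_coord R n.+1 ord0).
apply: measurable_fun_rVP => i.
apply: (eq_measurable_fun (rV_coord (lift ord0 i))) => [z _|].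
  by rewrite /= mxE.
exact: measurable_rV_coord.
Qed.

Section lebesgue_rVS.
Variables (n : nat) (mu : {sigma_finite_measure set 'rV[R]_n -> \bar R}).

Definition lebesgue_rVS : set 'rV[R]_n.+1 -> \bar R :=
  pushforward (lebesgue_measure \x mu)%E (@rV_cons n).

Let lebesgue_rVS0 : lebesgue_rVS set0 = 0%E.
Proof. by rewrite /lebesgue_rVS /pushforward preimage_set0 measure0. Qed.

Let lebesgue_rVS_ge0 A : (0 <= lebesgue_rVS A)%E.
Proof. by rewrite /lebesgue_rVS /pushforward measure_ge0. Qed.

Let lebesgue_rVS_sigma_additive : semi_sigma_additive lebesgue_rVS.
Proof.
apply: measure_semi_sigma_additive; exact: measurable_rV_cons.
Qed.

HB.instance Definition _ := isMeasure.Build _ _ _ lebesgue_rVS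
  lebesgue_rVS0 lebesgue_rVS_ge0 lebesgue_rVS_sigma_additive.

Let lebesgue_rVS_sigma_finite : sigma_finite setT lebesgue_rVS.
Proof.
have [F TF Foo] := sigma_finite_product_measure1 (@lebesgue_measure R) mu.
exists (fun k => @rV_uncons n @^-1` F k).
  by rewrite -preimage_bigcup -TF preimage_setT.
move=> k; have [mF Fk] := Foo k; split.
  by rewrite -[X in measurable X]setTI; exact: measurable_rV_uncons.
rewrite /lebesgue_rVS /pushforward -comp_preimage.
by rewrite (_ : _ \o _ = id) ?preimage_id//; apply/funext/rV_consK.
Qed.

HB.instance Definition _ := Measure_isSigmaFinite.Build _ _ _ lebesgue_rVS
  lebesgue_rVS_sigma_finite.

End lebesgue_rVS.

(* Lebesgue measure on R^n: the point mass for n = 0, the image of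
   lebesgue_measure \x (Lebesgue measure on R^n) under R * R^n = R^n.+1. *)
Fixpoint lebesgue_rV n : {sigma_finite_measure set 'rV[R]_n -> \bar R} :=
  if n is n'.+1 then lebesgue_rVS (lebesgue_rV n') else \d_(0 : 'rV[R]_0).

End lebesgue_rV.

Section lebesgue_rV2.
Variables (R : realType) (n : nat).

(* Lebesgue measure on the phase space R^n * R^n.  A separate constant because
   the canonical sigma-finite structure found for m1 \x m2 is the one for
   subprobabilities. *)
Definition lebesgue_rV2 : set ('rV[R]_n * 'rV[R]_n) -> \bar R :=
  (lebesgue_rV R n \x lebesgue_rV R n)%E.

HB.instance Definition _ := Measure.on lebesgue_rV2.

HB.instance Definition _ := Measure_isSigmaFinite.Build _ _ _ lebesgue_rV2
  (sigma_finite_product_measure1 (lebesgue_rV R n) (lebesgue_rV R n)).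

End lebesgue_rV2.
Arguments lebesgue_rV2 : clear implicits.

Section complex_integral.
Context d (T : measurableType d) (R : realType).
Variables (mu : {measure set T -> \bar R}) (F : T -> R[i]).

Definition cintegral : R[i] :=
  (\int[mu]_x complex.Re (F x)) +i* (\int[mu]_x complex.Im (F x)).

Definition cintegrable : Prop :=
  mu.-integrable setT (fun x => (complex.Re (F x))%:E) /\
  mu.-integrable setT (fun x => (complex.Im (F x))%:E).

End complex_integral.

(* e^(it) for real t *)
Definition expi (R : realType) (t : R) : R[i] := cos t +i* sin t.

Section star_products.
Variables (R : realType) (n : nat).
Local Notation V := 'rV[R]_n.
Local Notation mu := (lebesgue_rV R n).
Local Notation mu2 := (lebesgue_rV2 R n).

Definition dot (k x : V) : R := \sum_(i < n) k ord0 i * x ord0 i.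

Definition form (theta : 'M[R]_n) (k k' : V) : R :=
  \sum_(i < n) \sum_(j < n) theta i j * k ord0 i * k' ord0 j.

Definition fourier (u : V -> R[i]) (k : V) : R[i] :=
  cintegral mu (fun x => expi (- dot k x) * u x).

Definition fourier2 (A : V -> V -> R[i]) (k l : V) : R[i] :=
  cintegral mu2 (fun z => expi (- dot k z.1 - dot l z.2) * A z.1 z.2).

(* A * C on phase space; the integration variable is ((k, l), (k', l')). *)
Definition star (hbar : R) (theta : 'M[R]_n) (A C : V -> V -> R[i]) (x p : V) :
    R[i] :=
  (((2 * pi) ^+ (4 * n))^-1)%:C *
  cintegral (mu2 \x mu2)%E (fun z =>
    let: ((k, l), (k', l')) := z in
    fourier2 A k l * fourier2 C k' l'
    * expi (- (hbar / 2 * (dot k l' - dot k' l)))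
    * expi (- (form theta k k' / 2))
    * expi (dot (k + k') x + dot (l + l') p)).

Definition star_theta (theta : 'M[R]_n) (u v : V -> R[i]) (x : V) : R[i] :=
  (((2 * pi) ^+ (2 * n))^-1)%:C *
  cintegral mu2 (fun z =>
    fourier u z.1 * fourier v z.2
    * expi (- (form theta z.1 z.2 / 2))
    * expi (dot (z.1 + z.2) x)).

(* The functions of x with which star_theta can be formed: u must be integrable
   for its Fourier transform to be defined, and its Fourier transform must be
   integrable for the integral over (k, k') to converge absolutely.  Such a u
   agrees almost everywhere with a bounded continuous function, and is square
   integrable. *)
Definition fourier_integrable (u : V -> R[i]) : Prop :=
  cintegrable mu u /\ cintegrable mu (fourier u).

Definition square_integrable (u : V -> R[i]) : Prop :=
  cintegrable mu (fun x => `|u x| ^+ 2).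

(* u(x) = lam * \int d^nl G(x, l + x) *_theta u(l + x), u != 0; the eigenvalue
   multiplies the integral, as usual for integral equations. *)
Definition eigenfunction (theta : 'M[R]_n) (G : V -> V -> R[i]) (lam : R[i])
    (u : V -> R[i]) : Prop :=
  [/\ fourier_integrable u, exists x, u x != 0 &
      forall x, u x = lam * cintegral mu (fun l =>
        star_theta theta (fun y => G y (l + y)) (fun y => u (l + y)) x)].

Definition eigenvalue_of (theta : 'M[R]_n) (G : V -> V -> R[i]) (lam : R[i]) :
    Prop :=
  exists u, eigenfunction theta G lam u.

Definition orthonormal m (phi : 'I_m -> V -> R[i]) : Prop :=
  forall i j, cintegral mu (fun x => phi i x * (phi j x)^*%C) = (i == j)%:R.

(* phi is an orthonormal basis of the eigenspace of lam; when one exists, the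
   multiplicity of lam is its length m. *)
Definition eigenbasis (theta : 'M[R]_n) (G : V -> V -> R[i]) (lam : R[i]) m
    (phi : 'I_m -> V -> R[i]) : Prop :=
  [/\ orthonormal phi, forall i, eigenfunction theta G lam (phi i) &
      forall u, eigenfunction theta G lam u ->
        exists c : 'I_m -> R[i], forall x, u x = \sum_(i < m) c i * phi i x].

End star_products.

(* Main.v *)
Require Import Defs.
From mathcomp Require Import all_boot all_order all_algebra.
From mathcomp Require Import all_classical all_reals all_analysis.
From mathcomp Require Import measurable_realfun complex ring lra.

(* Let [alpha] be the Fourier transform of [f] on phase space, its momentum argument divided by
   hbar.  The integral operator of the theorem is the Weyl quantization
   T u = (2 pi)^-n \int alpha(z) W_z u dz of f, where the Weyl operators
   W_(k,l) u(x) = e^(i k.l/2 + i k.x) u(x + l - k theta/2) compose projectively with the cocycle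
   of the star product.  Hence f * f = kappa f says that lam T is idempotent for
   1/lam = kappa (2 pi hbar)^n, which makes lam the only eigenvalue; T is symmetric because f is
   real.  For an orthonormal family phi_1, ..., phi_r of eigenfunctions let A be the symbol of
   sum_i <., phi_i> phi_i.  Plancherel's formula and the normalization of G give
   \int |lam alpha - A|^2 = (2 pi)^n (lam - r), so r <= lam.  For a maximal family lam T is the
   projection onto its span, so lam alpha = A almost everywhere and r = lam: this quantizes
   kappa, and inverting the Fourier transforms gives the expansion of G, first almost everywhere
   and then, by continuity of both sides, everywhere. *)

Set Implicit Arguments.
Unset Strict Implicit.
Unset Printing Implicit Defensive.

Import Order.TTheory GRing.Theory Num.Theory.
Import numFieldNormedType.Exports.

Local Open Scope classical_set_scope.
Local Open Scope ring_scope.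
Local Open Scope complex_scope.

Local Notation Re := complex.Re.
Local Notation Im := complex.Im.
Local Notation form := Defs.form.


(** * Complex-valued integrals *)

(** For a projection P = lam T the rank equals the squared Hilbert-Schmidt norm, which in terms of
    symbols is lam^2 (2 pi)^-n \int |alpha|^2. The normalization of G makes this lam, and that is
    where the integer comes from. The inequality r <= lam is the nonnegativity of the squared norm
    of P minus a projection of rank r, so the bound that makes a maximal family exist and the
    identity that quantizes kappa come from one and the same integral.

    The obstacle is the gap between almost everywhere and everywhere: Fubini and Fourier inversion
    give identities off null sets, while the conclusions hold at points. It is met by the class
    [regular] of functions equal at every point to an absolutely convergent Fourier integral. Weyl
    operators and T preserve this class, every eigenfunction belongs to it since the star product
    sees u only through its Fourier transform, and a member that vanishes almost everywhere
    vanishes. The equation f * f = kappa f puts each f(x, .) in the class as well. Passing from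
    equal operators to equal symbols uses a nowhere vanishing regular function, against which
    integral kernels are tested. *)

Section complex_numbers.
Variable R : realType.
Implicit Types (z w : R[i]) (s t : R).

(** The norm of [R[i]] takes values in [R[i]]; this equivalent norm is real and can be integrated as
    it stands. The price is the constant 2 in [cabs_expi], which recurs in later bounds. *)
Definition cabs z : R := `|Re z| + `|Im z|.

Lemma complex_eqP z w : Re z = Re w -> Im z = Im w -> z = w.
Proof. by case: z w => [a b] [c d] /= -> ->. Qed.

Lemma ReD z w : Re (z + w) = Re z + Re w. Proof. by case: z w => ? ? []. Qed.
Lemma ImD z w : Im (z + w) = Im z + Im w. Proof. by case: z w => ? ? []. Qed.
Lemma ReN z : Re (- z) = - Re z. Proof. by case: z. Qed.
Lemma ImN z : Im (- z) = - Im z. Proof. by case: z. Qed.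
Lemma ReM z w : Re (z * w) = Re z * Re w - Im z * Im w.
Proof. by case: z w => ? ? []. Qed.
Lemma ImM z w : Im (z * w) = Re z * Im w + Im z * Re w.
Proof. by case: z w => ? ? [] /= *; rewrite addrC. Qed.
Lemma Re_conjc z : Re z^*%C = Re z. Proof. by case: z. Qed.
Lemma Im_conjc z : Im z^*%C = - Im z. Proof. by case: z. Qed.
Definition ReImE := (ReD, ImD, ReN, ImN, ReM, ImM, Re_conjc, Im_conjc).

Lemma conjcD z w : (z + w)^*%C = z^*%C + w^*%C.
Proof. by apply: complex_eqP; rewrite !ReImE// opprD. Qed.
Lemma conjcM z w : (z * w)^*%C = z^*%C * w^*%C.
Proof. by apply: complex_eqP; rewrite !ReImE; ring. Qed.
Lemma conjcN z : (- z)^*%C = - z^*%C.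
Proof. by apply: complex_eqP; rewrite !ReImE. Qed.
Lemma conjc_sum I (r : seq I) (P : pred I) (F : I -> R[i]) :
  (\sum_(i <- r | P i) F i)^*%C = \sum_(i <- r | P i) (F i)^*%C.
Proof.
apply: (big_morph _ conjcD); by apply: complex_eqP; rewrite /= ?oppr0.
Qed.

Lemma cabs_ge0 z : 0 <= cabs z. Proof. by rewrite addr_ge0. Qed.
Lemma cabsD z w : cabs (z + w) <= cabs z + cabs w.
Proof. by rewrite /cabs ReD ImD addrACA lerD// ler_normD. Qed.
Lemma cabs_conjc z : cabs z^*%C = cabs z.
Proof. by rewrite /cabs !ReImE normrN. Qed.
Lemma cabsM z w : cabs (z * w) <= cabs z * cabs w.
Proof.
rewrite /cabs ReM ImM mulrDl !mulrDr -!normrM.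
have := ler_normB (Re z * Re w) (Im z * Im w).
have := ler_normD (Re z * Im w) (Im z * Re w).
lra.
Qed.
Lemma cabs_eq0 z : cabs z = 0 -> z = 0.
Proof.
move=> /eqP; rewrite paddr_eq0// !normr_eq0 => /andP[/eqP ? /eqP ?].
exact: complex_eqP.
Qed.
Lemma expi0 : expi 0 = 1 :> R[i].
Proof. by rewrite /expi cos0 sin0. Qed.
Lemma expiD s t : expi (s + t) = expi s * expi t.
Proof.
apply: complex_eqP; rewrite ReImE /= ?cosD ?sinD//.
by rewrite addrC; congr (_ + _); rewrite mulrC.
Qed.
Lemma expiN t : expi (- t) = (expi t)^*%C.
Proof. by rewrite /expi cosN sinN. Qed.
Lemma conj_expi t : (expi t)^*%C = expi (- t).
Proof. by rewrite expiN. Qed.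
Lemma cabs_expi t : cabs (expi t) <= 2.
Proof.
have := cos_max t; have := sin_max t.
by rewrite /cabs /=; lra.
Qed.

Lemma cabs_expiM t z : cabs (expi t * z) <= 2 * cabs z.
Proof. by rewrite (le_trans (cabsM _ _))// ler_wpM2r ?cabs_ge0 ?cabs_expi. Qed.

End complex_numbers.

Section complex_measurable.
Context d (T : measurableType d) (R : realType).
Implicit Types F H : T -> R[i].

Definition cmeas F :=
  measurable_fun setT (fun x => Re (F x)) /\
  measurable_fun setT (fun x => Im (F x)).

Lemma cmeas_cst (c : R[i]) : cmeas (fun _ => c).
Proof. by split; exact: measurable_cst. Qed.

Lemma cmeasD F H : cmeas F -> cmeas H -> cmeas (fun x => F x + H x).
Proof.
move=> [F1 F2] [H1 H2]; split.
  by under eq_fun do rewrite ReD; exact: measurable_funD.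
by under eq_fun do rewrite ImD; exact: measurable_funD.
Qed.

Lemma cmeasN F : cmeas F -> cmeas (fun x => - F x).
Proof.
move=> [F1 F2]; split.
  by under eq_fun do rewrite ReN; exact: measurable_funN.
by under eq_fun do rewrite ImN; exact: measurable_funN.
Qed.

Lemma cmeasM F H : cmeas F -> cmeas H -> cmeas (fun x => F x * H x).
Proof.
move=> [F1 F2] [H1 H2]; split.
  by under eq_fun do rewrite ReM; apply: measurable_funB; exact: measurable_funM.
by under eq_fun do rewrite ImM; apply: measurable_funD; exact: measurable_funM.
Qed.

Lemma cmeas_conj F : cmeas F -> cmeas (fun x => (F x)^*%C).
Proof.
move=> [F1 F2]; split; first by under eq_fun do rewrite Re_conjc.
by under eq_fun do rewrite Im_conjc; exact: measurable_funN.
Qed.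

Lemma cmeas_real (f : T -> R) : measurable_fun setT f -> cmeas (fun x => (f x)%:C).
Proof. by move=> mf; split => //=; exact: measurable_cst. Qed.

Lemma cmeas_expi (f : T -> R) : measurable_fun setT f -> cmeas (fun x => expi (f x)).
Proof.
move=> mf; split => /=.
  apply: (measurableT_comp (f := cos) _ mf).
  by apply: continuous_measurable_fun; exact: continuous_cos.
apply: (measurableT_comp (f := sin) _ mf).
by apply: continuous_measurable_fun; exact: continuous_sin.
Qed.

Lemma cmeas_sum I (r : seq I) (F : I -> T -> R[i]) :
  (forall i, cmeas (F i)) -> cmeas (fun x => \sum_(i <- r) F i x).
Proof.
move=> mF; elim: r => [|i r IH].
  by under eq_fun do rewrite big_nil; exact: cmeas_cst.
by under eq_fun do rewrite big_cons; exact: cmeasD.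
Qed.

Lemma measurable_cabs F : cmeas F -> measurable_fun setT (fun x => cabs (F x)).
Proof.
move=> [F1 F2]; rewrite /cabs; apply: measurable_funD.
  exact: (measurableT_comp (@normr_measurable R setT) F1).
exact: (measurableT_comp (@normr_measurable R setT) F2).
Qed.

Lemma measurable_cabsE F : cmeas F -> measurable_fun setT (fun x => (cabs (F x))%:E).
Proof. by move=> mF; apply/measurable_EFinP; exact: measurable_cabs. Qed.

End complex_measurable.

Lemma cmeas_comp d1 d2 (T1 : measurableType d1) (T2 : measurableType d2)
    (R : realType) (F : T2 -> R[i]) (Phi : T1 -> T2) :
  measurable_fun setT Phi -> cmeas F -> cmeas (fun x => F (Phi x)).
Proof.
by move=> mPhi [F1 F2]; split;
  [exact: (measurableT_comp F1 mPhi)|exact: (measurableT_comp F2 mPhi)].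
Qed.

Section complex_integrable.
Context d (T : measurableType d) (R : realType).
Variable mu : {measure set T -> \bar R}.
Implicit Types F H : T -> R[i].

Lemma cintegrable_cmeas F : cintegrable mu F -> cmeas F.
Proof. by move=> [/measurable_int/measurable_EFinP ? /measurable_int/measurable_EFinP ?]. Qed.

Lemma cintegrableP F : cintegrable mu F <->
  cmeas F /\ mu.-integrable setT (fun x => (cabs (F x))%:E).
Proof.
split=> [iF|[mF iF]].
  split; first exact: cintegrable_cmeas iF.
  case: iF => [i1 i2].
  rewrite (_ : (fun _ => _) = (fun x => (`|Re (F x)|%:E + `|Im (F x)|%:E)%E))//.
  by apply: integrableD => //; exact: (integrable_norm (f := fun x => _ (F x))).
case: mF => m1 m2; split; apply: (le_integrable _ _ _ iF) => //.
- exact/measurable_EFinP.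
- by move=> x _; rewrite lee_fin [leRHS]ger0_norm ?cabs_ge0// lerDl.
- exact/measurable_EFinP.
- by move=> x _; rewrite lee_fin [leRHS]ger0_norm ?cabs_ge0// lerDr.
Qed.

Lemma cintegrable_le F (g : T -> R) : cmeas F ->
  mu.-integrable setT (fun x => (g x)%:E) -> (forall x, cabs (F x) <= g x) ->
  cintegrable mu F.
Proof.
move=> mF ig Fg; apply/cintegrableP; split=> //.
apply: (le_integrable _ _ _ ig) => //; first exact: measurable_cabsE.
move=> x _; rewrite lee_fin ger0_norm ?cabs_ge0// ger0_norm//.
exact: le_trans (cabs_ge0 _) (Fg x).
Qed.

Lemma integrable_cabs F : cintegrable mu F ->
  mu.-integrable setT (fun x => (cabs (F x))%:E).
Proof. by case/cintegrableP. Qed.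

Lemma cintegrable_dom F H (C : R) : cmeas F -> cintegrable mu H ->
  (forall x, cabs (F x) <= C * cabs (H x)) -> cintegrable mu F.
Proof.
move=> mF iH FH; apply: (cintegrable_le mF _ FH).
under eq_fun do rewrite EFinM.
by apply: integrableZl => //; exact: integrable_cabs.
Qed.

Lemma cintegrableD F H : cintegrable mu F -> cintegrable mu H ->
  cintegrable mu (fun x => F x + H x).
Proof.
move=> [F1 F2] [H1 H2]; split.
  under eq_fun do rewrite ReD EFinD; exact: integrableD.
under eq_fun do rewrite ImD EFinD; exact: integrableD.
Qed.

Lemma cintegrable_bmul F H (C : R) : cmeas F -> (forall x, cabs (F x) <= C) ->
  cintegrable mu H -> cintegrable mu (fun x => F x * H x).
Proof.
move=> mF FC iH; apply: (cintegrable_dom _ iH).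
  by apply: cmeasM => //; exact: cintegrable_cmeas iH.
move=> x; rewrite (le_trans (cabsM _ _))// ler_wpM2r ?cabs_ge0//; exact: FC.
Qed.

Lemma cintegrableZ (c : R[i]) F : cintegrable mu F -> cintegrable mu (fun x => c * F x).
Proof. by apply: (@cintegrable_bmul _ _ (cabs c)) => //; exact: cmeas_cst. Qed.

Lemma cintegrable_expi (f : T -> R) F : measurable_fun setT f ->
  cintegrable mu F -> cintegrable mu (fun x => expi (f x) * F x).
Proof.
move=> mf; apply: (@cintegrable_bmul _ _ 2); first exact: cmeas_expi.
by move=> x; exact: cabs_expi.
Qed.

Lemma cintegrableN F : cintegrable mu F -> cintegrable mu (fun x => - F x).
Proof.
by move=> /(cintegrableZ (-1)); under eq_fun do rewrite mulN1r.
Qed.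

Lemma cintegrable_conj F : cintegrable mu F -> cintegrable mu (fun x => (F x)^*%C).
Proof.
move=> iF; apply: (@cintegrable_dom _ F 1) => //.
  by apply: cmeas_conj; exact: cintegrable_cmeas iF.
by move=> x; rewrite cabs_conjc mul1r.
Qed.

Lemma cintegrable0 : cintegrable mu (fun _ => 0 : R[i]).
Proof. by split => /=; exact: integrable0. Qed.

Lemma cintegrable_sum I (r : seq I) (F : I -> T -> R[i]) :
  (forall i, cintegrable mu (F i)) -> cintegrable mu (fun x => \sum_(i <- r) F i x).
Proof.
move=> iF; elim: r => [|i r IH].
  by under eq_fun do rewrite big_nil; exact: cintegrable0.
by under eq_fun do rewrite big_cons; exact: cintegrableD.
Qed.

Lemma integrable_EFinZl (c : R) (f : T -> R) :
  mu.-integrable setT (fun x => (f x)%:E) ->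
  mu.-integrable setT (fun x => (c * f x)%:E).
Proof. by move=> fi; under eq_fun do rewrite EFinM; exact: integrableZl. Qed.

Lemma cintegralD F H : cintegrable mu F -> cintegrable mu H ->
  cintegral mu (fun x => F x + H x) = cintegral mu F + cintegral mu H.
Proof.
move=> [F1 F2] [H1 H2]; apply: complex_eqP; rewrite ReImE /=.
  by rewrite -RintegralD//; apply: eq_Rintegral => x _; rewrite ReD.
by rewrite -RintegralD//; apply: eq_Rintegral => x _; rewrite ImD.
Qed.

Lemma cintegralZ (c : R[i]) F : cintegrable mu F ->
  cintegral mu (fun x => c * F x) = c * cintegral mu F.
Proof.
move=> [F1 F2]; apply: complex_eqP; rewrite ?ReM ?ImM /cintegral /=.
  rewrite -(RintegralZl (Re c) _ F1)// -(RintegralZl (Im c) _ F2)//.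
  rewrite -RintegralB//; try exact: integrable_EFinZl.
  by apply: eq_Rintegral => x _; rewrite ReM.
rewrite -(RintegralZl (Re c) _ F2)// -(RintegralZl (Im c) _ F1)//.
rewrite -RintegralD//; try exact: integrable_EFinZl.
by apply: eq_Rintegral => x _; rewrite ImM.
Qed.

Lemma cintegralZr (c : R[i]) F : cintegrable mu F ->
  cintegral mu (fun x => F x * c) = cintegral mu F * c.
Proof. by move=> iF; under eq_fun do rewrite mulrC; rewrite cintegralZ// mulrC. Qed.

Lemma cintegralN F : cintegrable mu F ->
  cintegral mu (fun x => - F x) = - cintegral mu F.
Proof.
by move=> iF; under eq_fun do rewrite -mulN1r; rewrite cintegralZ// mulN1r.
Qed.

Lemma cintegralB F H : cintegrable mu F -> cintegrable mu H ->
  cintegral mu (fun x => F x - H x) = cintegral mu F - cintegral mu H.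
Proof. by move=> iF iH; rewrite cintegralD ?cintegralN//; exact: cintegrableN. Qed.

Lemma cintegral_conj F : cintegrable mu F ->
  cintegral mu (fun x => (F x)^*%C) = (cintegral mu F)^*%C.
Proof.
move=> [F1 F2]; apply: complex_eqP; rewrite ReImE /=.
  by apply: eq_Rintegral => x _; rewrite Re_conjc.
rewrite -mulN1r -RintegralZl//.
by apply: eq_Rintegral => x _; rewrite Im_conjc mulN1r.
Qed.

Lemma cintegral0 : cintegral mu (fun _ => 0 : R[i]) = 0.
Proof.
by apply: complex_eqP => /=; rewrite /Rintegral integral0.
Qed.

Lemma cintegral_sum I (r : seq I) (F : I -> T -> R[i]) :
  (forall i, cintegrable mu (F i)) ->
  cintegral mu (fun x => \sum_(i <- r) F i x) = \sum_(i <- r) cintegral mu (F i).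
Proof.
move=> iF; elim: r => [|i r IH].
  by rewrite big_nil; under eq_fun do rewrite big_nil; exact: cintegral0.
rewrite big_cons -IH -cintegralD//; last exact: cintegrable_sum.
by under eq_fun do rewrite big_cons.
Qed.

Lemma ae_eq_cintegral F H : cmeas F -> cmeas H -> {ae mu, forall x, F x = H x} ->
  cintegral mu F = cintegral mu H.
Proof.
move=> [F1 F2] [H1 H2] FH; apply: complex_eqP => /=.
  rewrite /Rintegral; congr fine; apply: ae_eq_integral => //.
  - exact/measurable_EFinP.
  - exact/measurable_EFinP.
  - by apply: filterS FH => x -> _.
rewrite /Rintegral; congr fine; apply: ae_eq_integral => //.
- exact/measurable_EFinP.
- exact/measurable_EFinP.
- by apply: filterS FH => x -> _.
Qed.

Lemma ae_cintegrable F H : cmeas H -> {ae mu, forall x, F x = H x} ->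
  cintegrable mu F -> cintegrable mu H.
Proof.
move=> [H1 H2] FH [/integrableP[F1 F1'] /integrableP[F2 F2']]; split.
  apply/integrableP; split; first exact/measurable_EFinP.
  rewrite (@ae_eq_integral _ _ _ mu setT (fun x => `|(Re (F x))%:E|%E))//.
  - by apply: measurableT_comp => //; exact/measurable_EFinP.
  - exact: measurableT_comp.
  - by apply: filterS FH => x -> _.
apply/integrableP; split; first exact/measurable_EFinP.
rewrite (@ae_eq_integral _ _ _ mu setT (fun x => `|(Im (F x))%:E|%E))//.
- by apply: measurableT_comp => //; exact/measurable_EFinP.
- exact: measurableT_comp.
- by apply: filterS FH => x -> _.
Qed.

Lemma integral_cabs0 F : cmeas F ->
  (\int[mu]_x (cabs (F x))%:E = 0)%E <-> {ae mu, forall x, F x = 0}.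
Proof.
move=> mF; have := ae_eq_integral_abs mu measurableT (measurable_cabsE mF).
under eq_integral do rewrite gee0_abs ?lee_fin ?cabs_ge0//.
move=> ->; split; apply: filterS => x.
  by move=> /(_ I) [] /cabs_eq0.
by move=> -> _; rewrite /cabs /= normr0 addr0.
Qed.

Lemma cabs_cintegral F : cintegrable mu F ->
  cabs (cintegral mu F) <= \int[mu]_x cabs (F x).
Proof.
move=> [F1 F2]; rewrite /cabs /= RintegralD//; try exact: integrable_norm.
by rewrite lerD// le_normr_Rintegral.
Qed.

End complex_integrable.

(** * Measure-preserving maps and Fubini's theorem *)

Section measure_preserving.
Context d1 d2 (T1 : measurableType d1) (T2 : measurableType d2) (R : realType).
Variables (m1 : {measure set T1 -> \bar R}) (m2 : {measure set T2 -> \bar R}).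
Variable Phi : T1 -> T2.

(** A change of variables as an equality of measures of preimages, a form that composes and takes
    products. Translations, reflections, swaps and shears are instances; scalings are too once the
    source measure carries the Jacobian through [mscale]. *)
Definition mpres := measurable_fun setT Phi /\
  forall A, measurable A -> m1 (Phi @^-1` A) = m2 A.

Let push (mP : mpres) : {measure set T2 -> \bar R} :=
  measure_function_pushforward__canonical__measure_function_Measure m1 mP.1.

Hypothesis mP : mpres.

Lemma mpres_measurable : measurable_fun setT Phi.
Proof. exact: mP.1. Qed.

Lemma ge0_integral_mpres (f : T2 -> \bar R) : measurable_fun setT f ->
  (forall y, (0 <= f y)%E) -> (\int[m2]_y f y = \int[m1]_x f (Phi x))%E.
Proof.
move=> mf f0; rewrite (eq_measure_integral (push mP)).
  by rewrite (ge0_integral_pushforward mP.1)//= preimage_setT.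
by move=> A mA _; apply/esym; exact: mP.2.
Qed.

Lemma integrable_mpres (f : T2 -> \bar R) : measurable_fun setT f ->
  m2.-integrable setT f <-> m1.-integrable setT (f \o Phi).
Proof.
have mPhi := mP.1.
move=> mf; have ma : measurable_fun setT (abse \o f) by exact: measurableT_comp.
have a0 y : (0 <= (abse \o f) y)%E by exact: abse_ge0.
split=> /integrableP[_ fi]; apply/integrableP; split=> //.
- exact: measurableT_comp.
- by rewrite -(ge0_integral_mpres ma).
- by rewrite (ge0_integral_mpres ma).
Qed.

Lemma integral_mpres (f : T2 -> \bar R) : m2.-integrable setT f ->
  (\int[m2]_y f y = \int[m1]_x f (Phi x))%E.
Proof.
move=> fi; have mf := measurable_int _ fi.
have fi1 := (integrable_mpres mf).1 fi.
rewrite (eq_measure_integral (push mP)).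
  by rewrite (integral_pushforward mP.1)//= preimage_setT.
by move=> A mA _; apply/esym; exact: mP.2.
Qed.

Lemma cintegrable_mpres (F : T2 -> R[i]) : cmeas F ->
  cintegrable m2 F <-> cintegrable m1 (fun x => F (Phi x)).
Proof.
move=> [/measurable_EFinP F1 /measurable_EFinP F2]; split=> -[i1 i2]; split.
- exact: ((integrable_mpres F1).1 i1).
- exact: ((integrable_mpres F2).1 i2).
- exact: ((integrable_mpres F1).2 i1).
- exact: ((integrable_mpres F2).2 i2).
Qed.

Lemma cintegral_mpres (F : T2 -> R[i]) : cintegrable m2 F ->
  cintegral m2 F = cintegral m1 (fun x => F (Phi x)).
Proof.
move=> [i1 i2]; apply: complex_eqP; rewrite /= /Rintegral.
  by rewrite (integral_mpres i1).
by rewrite (integral_mpres i2).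
Qed.

Lemma ae_mpres (P : T2 -> Prop) : {ae m2, forall y, P y} -> {ae m1, forall x, P (Phi x)}.
Proof.
move=> [N [mN N0 PN]]; exists (Phi @^-1` N); split.
- by rewrite -[X in measurable X]setTI; exact: mP.1.
- by rewrite mP.2.
- by move=> x /= Px; apply: PN.
Qed.

End measure_preserving.

Lemma mpres_comp d1 d2 d3 (T1 : measurableType d1) (T2 : measurableType d2)
    (T3 : measurableType d3) (R : realType) (m1 : {measure set T1 -> \bar R})
    (m2 : {measure set T2 -> \bar R}) (m3 : {measure set T3 -> \bar R})
    (Phi : T1 -> T2) (Psi : T2 -> T3) :
  mpres m1 m2 Phi -> mpres m2 m3 Psi -> mpres m1 m3 (Psi \o Phi).
Proof.
move=> [mf ef] [mg eg]; split; first exact: measurableT_comp.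
move=> A mA; rewrite comp_preimage ef ?eg//.
by rewrite -[X in measurable X]setTI; exact: mg.
Qed.

Lemma mpres_rect d1 d2 d3 (T1 : measurableType d1) (T2 : measurableType d2)
    (T3 : measurableType d3) (R : realType) (m : {measure set T1 -> \bar R})
    (m2 : {sigma_finite_measure set T2 -> \bar R})
    (m3 : {sigma_finite_measure set T3 -> \bar R}) (Phi : T1 -> T2 * T3) :
  measurable_fun setT Phi ->
  (forall A B, measurable A -> measurable B ->
    m (Phi @^-1` (A `*` B)) = m2 A * m3 B)%E ->
  mpres m (m2 \x m3)%E Phi.
Proof.
move=> mPhi rect; split=> // A mA.
apply/esym; exact: (@product_measure_unique _ _ _ _ _ m2 m3
  (measure_function_pushforward__canonical__measure_function_Measure m mPhi)).
Qed.

Section product_mpres.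
Context d1 d2 d3 d4 (T1 : measurableType d1) (T2 : measurableType d2)
  (T3 : measurableType d3) (T4 : measurableType d4) (R : realType).

Lemma mpres_prod (m1 : {sigma_finite_measure set T1 -> \bar R})
    (m2 : {sigma_finite_measure set T2 -> \bar R})
    (m3 : {sigma_finite_measure set T3 -> \bar R})
    (m4 : {sigma_finite_measure set T4 -> \bar R}) (Phi : T1 -> T2) (Psi : T3 -> T4) :
  mpres m1 m2 Phi -> mpres m3 m4 Psi ->
  mpres (m1 \x m3)%E (m2 \x m4)%E (fun z => (Phi z.1, Psi z.2)).
Proof.
move=> [mf ef] [mg eg].
apply: mpres_rect.
  apply/measurable_fun_pairP; split.
    exact: (measurableT_comp mf measurable_fst).
  exact: (measurableT_comp mg measurable_snd).
move=> A B mA mB; rewrite -ef// -eg// -product_measure1E//.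
  by rewrite -[X in measurable X]setTI; exact: mf.
by rewrite -[X in measurable X]setTI; exact: mg.
Qed.

(** The product measure integrates the measures of sections, and a shear acts on the section over x
    through [Psi (x, .)] alone, which preserves its measure. *)
Lemma mpres_shear (m1 : {sigma_finite_measure set T1 -> \bar R})
    (m2 : {sigma_finite_measure set T2 -> \bar R})
    (m3 : {sigma_finite_measure set T3 -> \bar R}) (Psi : T1 * T2 -> T3) :
  measurable_fun setT Psi -> (forall x, mpres m2 m3 (fun y => Psi (x, y))) ->
  mpres (m1 \x m2)%E (m1 \x m3)%E (fun z => (z.1, Psi z)).
Proof.
move=> mPsi mp; split; first exact: (measurable_fun_pair measurable_fst mPsi).
move=> A mA; rewrite /product_measure1; apply: eq_integral => x _ /=.
rewrite -(mp x).2; last exact: measurable_xsection.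
by congr (m2 _); apply/seteqP; split=> y; rewrite /xsection /= !inE.
Qed.

End product_mpres.

Lemma mpres_swap d1 d2 (T1 : measurableType d1) (T2 : measurableType d2)
    (R : realType) (m1 : {sigma_finite_measure set T1 -> \bar R})
    (m2 : {sigma_finite_measure set T2 -> \bar R}) :
  mpres (m1 \x m2)%E (m2 \x m1)%E (fun z => (z.2, z.1)).
Proof.
apply: mpres_rect.
  by apply/measurable_fun_pairP; split; [exact: measurable_snd|exact: measurable_fst].
move=> A B mA mB; rewrite muleC -product_measure1E//; congr (product_measure1 _ _ _).
by apply/seteqP; split=> -[x y] [].
Qed.

Section complex_fubini.
Context d1 d2 (T1 : measurableType d1) (T2 : measurableType d2) (R : realType).
Variables (m1 : {sigma_finite_measure set T1 -> \bar R})
  (m2 : {sigma_finite_measure set T2 -> \bar R}).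
Implicit Types F : T1 * T2 -> R[i].
Local Notation m12 := (m1 \x m2)%E.

(** [Rintegral] is the finite part of the extended integral and reads 0 off an infinite value; the
    two agree where the slice is integrable, which is almost everywhere. *)
Let cslice (f : T1 * T2 -> R) : m12.-integrable setT (fun z => (f z)%:E) ->
  ae_eq m1 setT (fun x => \int[m2]_y (f (x, y))%:E)%E
    (fun x => (\int[m2]_y f (x, y))%:E).
Proof.
move=> fi; have := ae_integrable1 fi; apply: filterS => x xi _.
by rewrite /Rintegral fineK//; exact: integrable_fin_num.
Qed.

(** The slice integral is a difference of two Tonelli integrals, of the positive and the negative
    part, each measurable whether finite or not. Measurability thus covers the points where the
    slice fails to be integrable. *)
Let measurable_Rintegral_slice (f : T1 * T2 -> R) : measurable_fun setT f ->
  measurable_fun setT (fun x => \int[m2]_y f (x, y)).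
Proof.
move=> mf; apply: (measurableT_comp (f := fine)) => //.
have /measurable_EFinP mfE := mf.
have mp := measurable_fun_fubini_tonelli_F (m2 := m2) _
  (measurable_funepos mfE) (fun _ => funepos_ge0 _ _).
have mn := measurable_fun_fubini_tonelli_F (m2 := m2) _
  (measurable_funeneg mfE) (fun _ => funeneg_ge0 _ _).
apply: (eq_measurable_fun _ _ (emeasurable_funB mp mn)) => x _.
rewrite [RHS]integralE; congr (_ - _)%E; apply: eq_integral => y _.
  by rewrite !funeposE.
by rewrite !funenegE.
Qed.

Lemma cmeas_slice F : cmeas F -> cmeas (fun x => cintegral m2 (fun y => F (x, y))).
Proof.
move=> [F1 F2]; split; rewrite /cintegral /=.
  exact: (measurable_Rintegral_slice F1).
exact: (measurable_Rintegral_slice F2).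
Qed.

Lemma ae_cintegrable1 F : cintegrable m12 F ->
  {ae m1, forall x, cintegrable m2 (fun y => F (x, y))}.
Proof.
move=> [/ae_integrable1 i1 /ae_integrable1 i2].
by apply: filterS2 i1 i2 => x.
Qed.

Lemma cintegrable_slice F : cintegrable m12 F ->
  cintegrable m1 (fun x => cintegral m2 (fun y => F (x, y))).
Proof.
move=> iF; have mF := cmeas_slice (cintegrable_cmeas iF).
case: mF => F1 F2.
case: iF => i1 i2; split.
  have := integrable_fubini_F i1.
  move/integrableP => [n1 n2]; apply/integrableP; split; first exact/measurable_EFinP.
  rewrite (@ae_eq_integral _ _ _ m1 setT
      (fun x => `|\int[m2]_y (Re (F (x, y)))%:E|%E))//.
  - by apply: measurableT_comp => //; exact/measurable_EFinP.
  - exact: measurableT_comp.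
  - by apply: filterS (cslice i1) => x h _; rewrite (h I).
have := integrable_fubini_F i2.
move/integrableP => [n1 n2]; apply/integrableP; split; first exact/measurable_EFinP.
rewrite (@ae_eq_integral _ _ _ m1 setT
    (fun x => `|\int[m2]_y (Im (F (x, y)))%:E|%E))//.
- by apply: measurableT_comp => //; exact/measurable_EFinP.
- exact: measurableT_comp.
- by apply: filterS (cslice i2) => x h _; rewrite (h I).
Qed.

Let Rintegral_fubini (f : T1 * T2 -> R) : m12.-integrable setT (fun z => (f z)%:E) ->
  \int[m12]_z f z = \int[m1]_x \int[m2]_y f (x, y).
Proof.
move=> fi; rewrite /Rintegral -(integral12_prod_meas1 fi); congr fine.
apply: ae_eq_integral => //.
- exact: measurable_fubini_F fi.
- by apply/measurable_EFinP/measurable_Rintegral_slice/measurable_EFinP; exact: measurable_int fi.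
- exact: cslice.
Qed.

Lemma cintegral_fubini F : cintegrable m12 F ->
  cintegral m12 F = cintegral m1 (fun x => cintegral m2 (fun y => F (x, y))).
Proof.
move=> [i1 i2]; apply: complex_eqP => /=.
  exact: Rintegral_fubini i1.
exact: Rintegral_fubini i2.
Qed.

Lemma cmeas_tensor (g : T1 -> R[i]) (h : T2 -> R[i]) : cmeas g -> cmeas h ->
  cmeas (fun z : T1 * T2 => g z.1 * h z.2).
Proof.
move=> mg mh; apply: cmeasM.
  exact: (cmeas_comp measurable_fst mg).
exact: (cmeas_comp measurable_snd mh).
Qed.

Lemma cintegrable_fubiniP F : cmeas F -> 
  (\int[m1]_x \int[m2]_y (cabs (F (x, y)))%:E < +oo)%E -> cintegrable m12 F.
Proof.
move=> mF fin; apply/cintegrableP; split=> //.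
apply/(integrable12ltyP _ _ (measurable_cabsE mF)).
under eq_integral do under eq_integral do rewrite gee0_abs ?lee_fin ?cabs_ge0//.
exact: fin.
Qed.

Lemma cintegrable_tensor (g : T1 -> R[i]) (h : T2 -> R[i]) :
  cintegrable m1 g -> cintegrable m2 h ->
  cintegrable m12 (fun z => g z.1 * h z.2).
Proof.
move=> ig ih; have mg := cintegrable_cmeas ig; have mh := cintegrable_cmeas ih.
apply: cintegrable_fubiniP; first exact: cmeas_tensor.
have /integrableP[_] := integrable_cabs ig.
have /integrableP[_] := integrable_cabs ih.
under eq_integral do rewrite gee0_abs ?lee_fin ?cabs_ge0//.
move=> hfin; under eq_integral do rewrite gee0_abs ?lee_fin ?cabs_ge0//.
move=> gfin.
have hfn : (\int[m2]_x (cabs (h x))%:E)%E \is a fin_num.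
  by rewrite ge0_fin_numE//; apply: integral_ge0 => x _; rewrite lee_fin cabs_ge0.
apply: (@le_lt_trans _ _ (\int[m1]_x ((cabs (g x))%:E * \int[m2]_y (cabs (h y))%:E))%E).
  apply: ge0_le_integral => //.
  - by move=> x _; apply: integral_ge0 => y _; rewrite lee_fin cabs_ge0.
  - apply: (measurable_fun_fubini_tonelli_F (fun z => (cabs (g z.1 * h z.2))%:E)) => //.
    + by apply: measurable_cabsE; exact: cmeas_tensor.
    + by move=> x; rewrite lee_fin cabs_ge0.
  - by apply: emeasurable_funM => //; exact: measurable_cabsE.
  - move=> x _; rewrite -ge0_integralZl//.
    + apply: ge0_le_integral => //.
      * by move=> y _; rewrite lee_fin cabs_ge0.
      * by apply: measurable_cabsE => /=; apply: cmeasM => //; exact: cmeas_cst.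
      * by apply: emeasurable_funM => //; exact: measurable_cabsE.
      * by move=> y _; rewrite -EFinM lee_fin cabsM.
    + exact: measurable_cabsE.
    + by move=> y _; rewrite lee_fin cabs_ge0.
    + by rewrite lee_fin cabs_ge0.
rewrite ge0_integralZr//.
- by rewrite lte_mul_pinfty// ?integral_ge0// ?ge0_fin_numE// ?integral_ge0// => x _; rewrite lee_fin cabs_ge0.
- exact: measurable_cabsE.
- by move=> x _; rewrite lee_fin cabs_ge0.
- by apply: integral_ge0 => y _; rewrite lee_fin cabs_ge0.
Qed.

(** Vanishing almost everywhere means that [cabs F] has integral 0, and Tonelli splits this into
    iterated integrals of nonnegative functions. An identity between two functions is passed to this
    lemma as the vanishing of their difference. *)
Lemma ae_prodP F : cmeas F ->
  {ae m12, forall z, F z = 0} <->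
  {ae m1, forall x, {ae m2, forall y, F (x, y) = 0}}.
Proof.
move=> mF.
have mFx x : cmeas (fun y => F (x, y)) by exact: (cmeas_comp (pair1_measurable x) mF).
rewrite -integral_cabs0//.
rewrite (fubini_tonelli1 (fun z => (cabs (F z))%:E)); last 2 first.
- exact: measurable_cabsE.
- by move=> z; rewrite lee_fin cabs_ge0.
have mI : measurable_fun setT (fun x => \int[m2]_y (cabs (F (x, y)))%:E)%E.
  apply: (measurable_fun_fubini_tonelli_F (fun z => (cabs (F z))%:E)) => //.
    exact: measurable_cabsE.
  by move=> z; rewrite lee_fin cabs_ge0.
have := ae_eq_integral_abs m1 measurableT mI.
have I0 x : (0 <= \int[m2]_y (cabs (F (x, y)))%:E)%E.
  by apply: integral_ge0 => y _; rewrite lee_fin cabs_ge0.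
under eq_integral do rewrite (gee0_abs (I0 _)).
rewrite /fubini_F => ->; split; apply: filterS => x.
  by move=> /(_ I) h; apply/integral_cabs0.
by move=> h _; apply/integral_cabs0.
Qed.

End complex_fubini.

Section complex_fubini_sym.
Context d1 d2 (T1 : measurableType d1) (T2 : measurableType d2) (R : realType).
Variables (m1 : {sigma_finite_measure set T1 -> \bar R})
  (m2 : {sigma_finite_measure set T2 -> \bar R}).
Implicit Types F : T1 * T2 -> R[i].

Lemma cintegrable_swap F : cintegrable (m1 \x m2)%E F ->
  cintegrable (m2 \x m1)%E (fun z => F (z.2, z.1)).
Proof.
move=> iF; apply/(cintegrable_mpres (mpres_swap m2 m1)) => //.
exact: cintegrable_cmeas iF.
Qed.

Lemma cintegral_swap F : cintegrable (m1 \x m2)%E F ->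
  cintegral m1 (fun x => cintegral m2 (fun y => F (x, y))) =
  cintegral m2 (fun y => cintegral m1 (fun x => F (x, y))).
Proof.
move=> iF; rewrite -cintegral_fubini//.
rewrite (cintegral_mpres (mpres_swap m2 m1) iF) cintegral_fubini//.
exact: cintegrable_swap.
Qed.

Lemma ae_swap F : cmeas F ->
  {ae m1, forall x, {ae m2, forall y, F (x, y) = 0}} ->
  {ae m2, forall y, {ae m1, forall x, F (x, y) = 0}}.
Proof.
move=> mF /(ae_prodP _ _ mF) h.
apply/(ae_prodP m2 m1 (F := fun z => F (z.2, z.1))).
  exact: cmeas_comp (mpres_measurable (mpres_swap m2 m1)) mF.
exact: (ae_mpres (mpres_swap m2 m1) h).
Qed.

End complex_fubini_sym.

(** * Dominated convergence for complex integrals *)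

Section complex_convergence.
Context d (T : measurableType d) (R : realType).
Variable mu : {measure set T -> \bar R}.

Definition ccvg (u : nat -> R[i]) (l : R[i]) :=
  (fun n => Re (u n)) @ \oo --> Re l /\ (fun n => Im (u n)) @ \oo --> Im l.

Lemma ccvg_unique u l l' : ccvg u l -> ccvg u l' -> l = l'.
Proof.
move=> [r1 i1] [r2 i2]; apply: complex_eqP.
  exact: (cvg_unique _ r1 r2).
exact: (cvg_unique _ i1 i2).
Qed.

Lemma cintegral_ccvg (F_ : nat -> T -> R[i]) F H (C : R) :
  (forall n, cmeas (F_ n)) -> cmeas F -> cintegrable mu H ->
  {ae mu, forall x, ccvg (F_ ^~ x) (F x)} ->
  (forall n x, cabs (F_ n x) <= C * cabs (H x)) ->
  ccvg (fun n => cintegral mu (F_ n)) (cintegral mu F).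
Proof.
move=> mF_ mF iH FF FH.
(* [p] stands for [Re] or [Im], both dominated by [cabs]. *)
have key (p : R[i] -> R) : (forall z, `|p z| <= cabs z) ->
    (forall n, measurable_fun setT (fun x => p (F_ n x))) ->
    measurable_fun setT (fun x => p (F x)) ->
    {ae mu, forall x, (fun n => p (F_ n x)) @ \oo --> p (F x)} ->
    (fun n => \int[mu]_x p (F_ n x)) @ \oo --> \int[mu]_x p (F x).
  move=> pcabs m_ m cv.
  have [] := @dominated_convergence _ _ _ mu setT measurableT
    (fun n x => (p (F_ n x))%:E) (fun x => (p (F x))%:E) (fun x => (C * cabs (H x))%:E).
  - by move=> n; exact/measurable_EFinP.
  - exact/measurable_EFinP.
  - by apply: filterS cv => x cvx _; apply: cvg_EFin => //; exact: nearW.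
  - exact: integrable_EFinZl (integrable_cabs iH).
  - by apply: aeW => x n _; rewrite lee_fin (le_trans (pcabs _)).
  move=> iF _ h; apply: fine_cvg; rewrite fineK; last exact: integrable_fin_num.
  by apply: cvg_trans h.
split; rewrite /cintegral /=.
  apply: (key (@complex.Re R)).
  - by move=> z; rewrite lerDl.
  - by move=> n; have [] := mF_ n.
  - by case: mF.
  - by apply: filterS FF => x [].
apply: (key (@complex.Im R)).
- by move=> z; rewrite lerDr.
- by move=> n; have [] := mF_ n.
- by case: mF.
- by apply: filterS FF => x [].
Qed.

End complex_convergence.

(** * Measurability and bilinear forms on R^n *)

Section rV_measurable.
Context d (T : measurableType d) (R : realType) (n : nat).
Implicit Types f g : T -> 'rV[R]_n.

Lemma measurable_coord f i : measurable_fun setT f ->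
  measurable_fun setT (fun t => f t ord0 i).
Proof. by move=> mf; exact: (measurableT_comp (measurable_rV_coord i) mf). Qed.

Lemma measurable_rVD f g : measurable_fun setT f -> measurable_fun setT g ->
  measurable_fun setT (fun t => f t + g t).
Proof.
move=> mf mg; apply: measurable_fun_rVP => i; under eq_fun do rewrite mxE.
by apply: measurable_funD; exact: measurable_coord.
Qed.

Lemma measurable_rVN f : measurable_fun setT f ->
  measurable_fun setT (fun t => - f t).
Proof.
move=> mf; apply: measurable_fun_rVP => i; under eq_fun do rewrite mxE.
by apply: measurable_funN; exact: measurable_coord.
Qed.

Lemma measurable_rVZ (c : R) f : measurable_fun setT f ->
  measurable_fun setT (fun t => c *: f t).
Proof.
move=> mf; apply: measurable_fun_rVP => i; under eq_fun do rewrite mxE.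
by apply: measurable_funM => //; exact: measurable_coord.
Qed.

Lemma measurable_mulmxr (M : 'M[R]_n) f : measurable_fun setT f ->
  measurable_fun setT (fun t => f t *m M).
Proof.
move=> mf; apply: measurable_fun_rVP => i; under eq_fun do rewrite mxE.
apply: measurable_sum => j.
by apply: measurable_funM => //; exact: measurable_coord.
Qed.

Lemma measurable_dot f g : measurable_fun setT f -> measurable_fun setT g ->
  measurable_fun setT (fun t => dot (f t) (g t)).
Proof.
move=> mf mg; apply: measurable_sum => i.
by apply: measurable_funM; exact: measurable_coord.
Qed.

End rV_measurable.

Section dot_algebra.
Variables (R : realType) (n : nat).
Implicit Types (k x y : 'rV[R]_n) (M : 'M[R]_n).

Lemma dotC k x : dot k x = dot x k.
Proof. by apply: eq_bigr => i _; rewrite mulrC. Qed.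
Lemma dotDl k x y : dot (k + x) y = dot k y + dot x y.
Proof. by rewrite /dot -big_split /=; apply: eq_bigr => i _; rewrite mxE mulrDl. Qed.
Lemma dotDr k x y : dot y (k + x) = dot y k + dot y x.
Proof. by rewrite dotC dotDl !(dotC y). Qed.
Lemma dotNl k x : dot (- k) x = - dot k x.
Proof. by rewrite /dot -sumrN; apply: eq_bigr => i _; rewrite mxE mulNr. Qed.
Lemma dotNr k x : dot k (- x) = - dot k x.
Proof. by rewrite dotC dotNl dotC. Qed.
Lemma dotZl (c : R) k x : dot (c *: k) x = c * dot k x.
Proof. by rewrite /dot mulr_sumr; apply: eq_bigr => i _; rewrite mxE mulrA. Qed.
Lemma dotZr (c : R) k x : dot k (c *: x) = c * dot k x.
Proof. by rewrite dotC dotZl dotC. Qed.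
Lemma dot0l x : dot 0 x = 0.
Proof. by rewrite /dot big1// => i _; rewrite mxE mul0r. Qed.
Lemma dot0r x : dot x 0 = 0. Proof. by rewrite dotC dot0l. Qed.

Lemma dot_mulmx M k x : dot (k *m M) x = form M k x.
Proof.
rewrite /dot /form exchange_big /=; apply: eq_bigr => j _.
by rewrite mxE mulr_suml; apply: eq_bigr => i _; rewrite (mulrC (k _ _)).
Qed.

Lemma formT M k x : form (trmx M) k x = form M x k.
Proof.
rewrite /form exchange_big /=; apply: eq_bigr => i _; apply: eq_bigr => j _.
by rewrite mxE -!mulrA (mulrC (k _ _)).
Qed.

Lemma formN M k x : form (- M) k x = - form M k x.
Proof.
rewrite /form -sumrN; apply: eq_bigr => i _; rewrite -sumrN; apply: eq_bigr => j _.
by rewrite mxE !mulNr.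
Qed.

Lemma dot_mulmxC M k x : trmx M = - M -> dot (x *m M) k = - dot (k *m M) x.
Proof. by move=> aM; rewrite !dot_mulmx -formT aM formN. Qed.

Lemma dot_mulmx0 M k : trmx M = - M -> dot (k *m M) k = 0.
Proof.
move=> aM; have /eqP := dot_mulmxC k k aM.
by rewrite -addr_eq0 -mulr2n mulrn_eq0 => /eqP.
Qed.

End dot_algebra.

Lemma dot_cons (R : realType) n (a b : R) (v w : 'rV[R]_n) :
  dot (rV_cons (a, v)) (rV_cons (b, w)) = a * b + dot v w.
Proof.
rewrite /dot big_ord_recl !rV_cons0; congr (_ + _).
by apply: eq_bigr => i _; rewrite !rV_consS.
Qed.

(** * Lebesgue measure on R^n under translation, reflection and scaling *)

Section lebesgue_rV_maps.
Variable R : realType.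
Notation mu := (lebesgue_rV R).
Notation leb := (@lebesgue_measure R).

Lemma mpres_rV_cons n : mpres (leb \x mu n)%E (mu n.+1) (@rV_cons R n).
Proof. by split=> //; exact: measurable_rV_cons. Qed.

Lemma mpres_rV_uncons n : mpres (mu n.+1) (leb \x mu n)%E (@rV_uncons R n).
Proof.
split; first exact: measurable_rV_uncons.
move=> A mA; rewrite /= /lebesgue_rVS /pushforward -comp_preimage.
by rewrite (_ : _ \o _ = id) ?preimage_id//; apply/funext/rV_consK.
Qed.

Lemma mpres_id d (T : measurableType d) (m : {measure set T -> \bar R}) :
  mpres m m id.
Proof. by split. Qed.

Lemma mpres_lebesgueD (a : R) : mpres leb leb (fun x => x + a).
Proof.
have mf : measurable_fun [set: R] (fun x : R => x + a) by apply: measurable_funD.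
split=> // A mA.
suff : pushforward leb ((fun x => x + a) : _ -> measurableTypeR R) A = leb A by [].
apply/esym/lebesgue_measure_unique => //= _ [[x y] _ <-]; rewrite /pushforward.
rewrite (_ : _ @^-1` _ = `]x - a, y - a]%classic); last first.
  by apply/seteqP; split=> z; rewrite /= !in_itv /= ltrBlDr lerBrDr.
by rewrite !lebesgue_measure_itv /= !lte_fin ltrD2r; case: ifP => // _;
  congr (_%:E); ring.
Qed.

Lemma mpres_lebesgueN : mpres leb leb (fun x => - x).
Proof.
split=> [|A mA]; last exact: lebesgue_measureN.
exact: (measurable_funN (@measurable_id _ R setT)).
Qed.

Lemma mpres_rVS n (phi : R -> R) (psi : 'rV[R]_n -> 'rV[R]_n) :
  mpres leb leb phi -> mpres (mu n) (mu n) psi ->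
  mpres (mu n.+1) (mu n.+1)
    (fun x => rV_cons (phi (x ord0 ord0), psi (rV_uncons x).2)).
Proof.
move=> mphi mpsi.
exact: (mpres_comp (mpres_comp (mpres_rV_uncons n) (mpres_prod mphi mpsi))
  (mpres_rV_cons n)).
Qed.

Lemma rV0_eq (x y : 'rV[R]_0) : x = y.
Proof. by apply/rowP => -[]. Qed.

Lemma mpres_rVD n (a : 'rV[R]_n) : mpres (mu n) (mu n) (fun x => x + a).
Proof.
elim: n a => [|n IH] a.
  rewrite (_ : (fun _ => _) = id); first exact: mpres_id.
  by apply/funext => x; exact: rV0_eq.
have := mpres_rVS (mpres_lebesgueD (a ord0 ord0)) (IH (rV_uncons a).2).
rewrite (_ : (fun x => rV_cons _) = (fun x => x + a))//.
apply/funext => x; apply/rowP => j.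
by case: (unliftP ord0 j) => [i ->|->]; rewrite ?rV_cons0 ?rV_consS !mxE.
Qed.

Lemma mpres_rVN n : mpres (mu n) (mu n) (fun x => - x).
Proof.
elim: n => [|n IH].
  rewrite (_ : (fun _ => _) = id); first exact: mpres_id.
  by apply/funext => x; exact: rV0_eq.
have := mpres_rVS mpres_lebesgueN IH.
rewrite (_ : (fun x => rV_cons _) = (fun x => - x))//.
apply/funext => x; apply/rowP => j.
by case: (unliftP ord0 j) => [i ->|->]; rewrite ?rV_cons0 ?rV_consS !mxE.
Qed.

(** The factor stands on the side of the preimage so that the identity reads as measure preservation
    from [mscale] by h^n. On the line it holds on half-open intervals, hence everywhere by
    uniqueness; the induction compares the scaled image with the product measure on rectangles. *)
Lemma lebesgue_rV_scale n (h : R) (A : set 'rV[R]_n) : 0 < h -> measurable A ->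
  ((h ^+ n)%:E * mu n ((fun x => (h *: x)%R) @^-1` A) = mu n A)%E.
Proof.
move=> h0.
have leb1 (B : set R) : measurable B ->
    ((h)%:E * leb ((fun x => (h * x)%R) @^-1` B) = leb B)%E.
  have mf : measurable_fun [set: R] (fun x : R => h * x) by apply: measurable_funM.
  move=> mB; pose phi : measurableTypeR R -> measurableTypeR R := fun x => h * x.
  have mphi : measurable_fun setT phi by exact: mf.
  pose p := measure_function_pushforward__canonical__measure_function_Measure leb mphi.
  suff : mscale (NngNum (ltW h0)) p B = leb B by [].
  apply/esym/lebesgue_measure_unique => //= _ [[x y] _ <-].
  rewrite /mscale /= /phi /pushforward.
  rewrite (_ : (fun z => h * z) @^-1` _ = `]x / h, y / h]%classic); last first.
    by apply/seteqP; split=> z; rewrite /= !in_itv /= ltr_pdivrMr// ler_pdivlMr// mulrC.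
  rewrite !lebesgue_measure_itv /= !lte_fin (ltr_pM2r (_ : 0 < h^-1)) ?invr_gt0//; case: ifP => // _.
    by rewrite -!EFinD -EFinM; congr (_%:E); field; rewrite gt_eqF.
  by rewrite mule0.
elim: n A => [|n IH] A mA.
  rewrite expr0 mul1e (_ : _ @^-1` _ = A)//.
  by apply/seteqP; split=> x /=; rewrite (rV0_eq (h *: x) x).
pose T := (measurableTypeR R * 'rV[R]_n)%type.
pose f (z : T) : T := (h * z.1, h *: z.2).
have mf : measurable_fun [set: T] f.
  apply: measurable_fun_pair.
    by apply: measurable_funM => //; exact: measurable_fst.
  by apply: measurable_rVZ; exact: measurable_snd.
pose p := measure_function_pushforward__canonical__measure_function_Measure
  (leb \x mu n)%E mf.
have mh : (0 <= h ^+ n.+1)%R by rewrite exprn_ge0 ?ltW.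
pose m' := measure_function_mscale__canonical__measure_function_Measure (NngNum mh) p.
have := @product_measure_unique _ _ _ _ _ leb (mu n) m'.
have mcA : measurable (@rV_cons R n @^-1` A).
  by rewrite -[X in measurable X]setTI; exact: measurable_rV_cons.
move=> /(_ _ _ mcA) /= E.
rewrite /lebesgue_rVS /pushforward E.
  rewrite /mscale /= /pushforward; congr (_ * product_measure1 _ _ _)%E.
  apply/seteqP; split=> -[x y]; rewrite /= /f /=;
    rewrite (_ : h *: rV_cons (x, y) = rV_cons (h * x, h *: y))//;
    apply/rowP => j; rewrite !mxE; case: (unliftP ord0 j) => //= i _; by rewrite mxE.
have mh1 : measurable_fun [set: R] (fun x : R => h * x) by apply: measurable_funM.
move=> B C mB mC; rewrite /mscale /= /pushforward.
rewrite (_ : f @^-1` _ = ((fun x => h * x) @^-1` B) `*`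
   ((fun x => h *: x) @^-1` C))//.
rewrite product_measure1E.
- by rewrite exprS EFinM muleACA leb1// IH.
- by rewrite -[X in measurable X]setTI; exact: mh1.
- by rewrite -[X in measurable X]setTI; exact: (measurable_rVZ h (@measurable_id _ _ setT)).
Qed.

End lebesgue_rV_maps.

(** * Fourier inversion *)

Section exponential_integrals.
Variable R : realType.
Local Notation leb := (@lebesgue_measure R).
Implicit Types (c e t x : R).

Lemma is_derive_lin c x : is_derive x (1 : R) (fun y : R => c * y) c.
Proof.
have := @is_deriveZ R R^o R^o id c x 1 1 (is_derive_id _ _).
by rewrite /GRing.scale /= mulr1.
Qed.

Lemma is_derive_compl (f : R -> R) (df : R) c x :
  is_derive (c * x) (1 : R) f df -> is_derive x (1 : R) (fun y => f (c * y)) (df * c).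
Proof.
by move=> dfx; exact: (@is_derive1_comp R f (fun y => c * y) x df c dfx (is_derive_lin c x)).
Qed.

Lemma is_derive_expRl c x : is_derive x (1 : R) (fun y => expR (c * y)) (expR (c * x) * c).
Proof. exact: is_derive_compl. Qed.
Lemma is_derive_cosl c x : is_derive x (1 : R) (fun y => cos (c * y)) (- sin (c * x) * c).
Proof. exact: is_derive_compl. Qed.
Lemma is_derive_sinl c x : is_derive x (1 : R) (fun y => sin (c * y)) (cos (c * x) * c).
Proof. exact: is_derive_compl. Qed.

Lemma continuous_expRl c : continuous (fun y : R => expR (c * y)).
Proof.
move=> x; apply: differentiable_continuous; apply/derivable1_diffP.
by have [] := is_derive_expRl c x.
Qed.

Lemma cvg_expRNl e (g : R -> R) (C : R) : 0 < e -> (forall x, `|g x| <= C) ->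
  expR (- e * x) * g x @[x --> +oo] --> 0.
Proof.
move=> e0 gC; apply: norm_cvg0.
have C0 : 0 <= C by apply: le_trans (gC 0).
apply: (@squeeze_cvgr _ _ _ _ (fun=> 0) (fun x => C * expR (- (e * x)))).
- apply: nearW => x; rewrite normr_ge0 normrM ger0_norm ?expR_ge0// mulNr mulrC.
  by rewrite ler_wpM2r ?expR_ge0.
- exact: cvg_cst.
- rewrite -[X in _ --> X](mulr0 C); apply: cvgM; first exact: cvg_cst.
  apply: (cvg_comp (fun x => e * x) (fun x => expR (- x))); last exact: cvgr_expR.
  by apply: gt0_cvgMry => //; exact: cvg_id.
Qed.

Lemma integral_expRN e : 0 < e ->
  (\int[leb]_(x in `[0%R, +oo[) (expR (- e * x)%R)%:E = (e^-1)%:E)%E.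
Proof.
move=> e0; have en0 : e != 0 by rewrite gt_eqF.
pose F x := expR (- e * x) * (- e^-1).
have dF x : is_derive x (1 : R) F (expR (- e * x)).
  have := is_deriveM (is_derive_expRl (- e) x) (is_derive_cst (- e^-1) x 1).
  move=> h; apply: (is_derive_eq h); rewrite /GRing.scale /=; field.
  exact: en0.
rewrite (@ge0_continuous_FTC2y _ _ F _ 0).
- by rewrite /F mulr0 expR0 mul1r -EFinB sub0r opprK.
- by move=> x _; exact: expR_ge0.
- by apply: continuous_subspaceT; exact: continuous_expRl.
- by apply: (@cvg_expRNl e (fun=> - e^-1) `|- e^-1|).
- by move=> x _; have [] := dF x.
- apply: cvg_at_right_filter; apply: differentiable_continuous; apply/derivable1_diffP.
  by have [] := dF 0.
- by move=> x _; rewrite derive1E; have [] := dF x.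
Qed.

(** Adding 1 to the cosine makes the integrand nonnegative, as the fundamental theorem on the
    half-line requires here; [poisson_kernel] subtracts the pure exponential again. *)
Lemma integral_expRN_cos e t : 0 < e ->
  (\int[leb]_(x in `[0%R, +oo[) (expR (- e * x) * (1 + cos (t * x)))%R%:E =
   (e^-1 + e / (e ^+ 2 + t ^+ 2))%:E)%E.
Proof.
move=> e0; have en0 : e != 0 by rewrite gt_eqF.
have D0 : e ^+ 2 + t ^+ 2 != 0 by rewrite gt_eqF// ltr_pwDl ?exprn_gt0// sqr_ge0.
set D := e ^+ 2 + t ^+ 2 in D0 *.
(* Two integrations by parts give e^(-ex) (t sin(tx) - e cos(tx)) / D as a primitive of e^(-ex)
   cos(tx); the constant accounts for the summand 1. *)
pose g x := t / D * sin (t * x) + (- (e / D)) * cos (t * x) + (- e^-1).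
pose F x := expR (- e * x) * g x.
have dg x : is_derive x (1 : R) g (t / D * (cos (t * x) * t) + (- (e / D)) * (- sin (t * x) * t)).
  have h1 := is_deriveM (is_derive_cst (t / D) x (1 : R)) (is_derive_sinl t x).
  have h2 := is_deriveM (is_derive_cst (- (e / D)) x (1 : R)) (is_derive_cosl t x).
  have := is_deriveD (is_deriveD h1 h2) (is_derive_cst (- e^-1) x (1 : R)).
  by move=> h; apply: (is_derive_eq h); rewrite /GRing.scale /= /cst; ring.
have dF x : is_derive x (1 : R) F (expR (- e * x) * (1 + cos (t * x))).
  have := is_deriveM (is_derive_expRl (- e) x) (dg x).
  move=> h; apply: (is_derive_eq h); rewrite /GRing.scale /= /g.
  move: D0; rewrite /D => D0; field.
  by rewrite en0.
have cF x : {for x, continuous F}.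
  by apply: differentiable_continuous; apply/derivable1_diffP; have [] := dF x.
rewrite (@ge0_continuous_FTC2y _ _ F _ 0).
- rewrite /F /g !mulr0 expR0 sin0 cos0 -EFinB; congr (_%:E).
  by field; rewrite D0.
- by move=> x _; rewrite mulr_ge0 ?expR_ge0// -lerBlDl sub0r cos_geN1.
- apply: continuous_subspaceT => x; apply: cvgM; first exact: continuous_expRl.
  apply: cvgD; first exact: cvg_cst.
  apply: differentiable_continuous; apply/derivable1_diffP.
  by have [] := is_derive_cosl t x.
- apply: (@cvg_expRNl e g (`|t / D| + `|e / D| + `|e^-1|)) => // x; rewrite /g.
  rewrite (le_trans (ler_normD _ _))// normrN lerD2r.
  rewrite (le_trans (ler_normD _ _))//; apply: lerD.
    by rewrite normrM ler_piMr// sin_max.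
  by rewrite normrM normrN ler_piMr// cos_max.
- by move=> x _; have [] := dF x.
- by apply: cvg_at_right_filter; exact: cF.
- by move=> x _; rewrite derive1E; have [] := dF x.
Qed.

End exponential_integrals.

Section fourier_transform.
Context d (T : measurableType d) (R : realType).
Variable mu : {measure set T -> \bar R}.
Variable p : T -> T -> R.
Implicit Types u v : T -> R[i].

(** The pairing is a parameter: inversion is proved on the line, passes to products, and so reaches
    R^n by induction and phase space as a product of two copies. *)
Definition ft u k : R[i] := cintegral mu (fun x => expi (- p k x) * u x).
Definition ift v x : R[i] := cintegral mu (fun k => expi (p k x) * v k).

Definition measurable_pairing := measurable_fun setT (fun z : T * T => p z.1 z.2).

(* Both transforms are taken for the same measure; [C] is the constant, (2 pi)^n
   for Lebesgue measure on R^n. *)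
Definition fourier_inversion (C : R) := forall u,
  cintegrable mu u -> cintegrable mu (ft u) ->
  {ae mu, forall x, ift (ft u) x = C%:C * u x}.

End fourier_transform.

Section fourier_pairing.
Context d (T : measurableType d) (R : realType).
Variable mu : {sigma_finite_measure set T -> \bar R}.
Variable p : T -> T -> R.
Implicit Types u v : T -> R[i].
Local Notation ft := (ft mu p).
Local Notation ift := (ift mu p).

Hypothesis mp : measurable_pairing p.
Hypothesis pC : forall x y, p x y = p y x.

Lemma measurable_pairingl x : measurable_fun setT (p x).
Proof. exact: (measurable_fun_pair2 x mp). Qed.

Lemma measurable_pairingr x : measurable_fun setT (p^~ x).
Proof. exact: (measurable_fun_pair1 x mp). Qed.

Lemma cintegrable_ft u k : cintegrable mu u ->
  cintegrable mu (fun x => expi (- p k x) * u x).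
Proof. by move=> iu; apply: cintegrable_expi => //; exact/measurable_funN/measurable_pairingl. Qed.

Lemma cintegrable_ift v x : cintegrable mu v ->
  cintegrable mu (fun k => expi (p k x) * v k).
Proof. by move=> iv; apply: cintegrable_expi => //; exact/measurable_pairingr. Qed.

Lemma cmeas_ft u : cmeas u -> cmeas (ft u).
Proof.
move=> mu_; apply: (@cmeas_slice _ _ _ _ _ mu (fun z => expi (- p z.1 z.2) * u z.2)).
apply: cmeasM; first by apply: cmeas_expi; exact: measurable_funN.
exact: (cmeas_comp measurable_snd mu_).
Qed.

Lemma cmeas_ift v : cmeas v -> cmeas (ift v).
Proof.
move=> mv; apply: (@cmeas_slice _ _ _ _ _ mu (fun z => expi (p z.2 z.1) * v z.2)).
apply: cmeasM; last exact: (cmeas_comp measurable_snd mv).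
by apply: cmeas_expi; under eq_fun do rewrite pC; exact: mp.
Qed.

Lemma cabs_cintegral_expi (g : T -> R) u : measurable_fun setT g -> cintegrable mu u ->
  cabs (cintegral mu (fun x => expi (g x) * u x)) <= 2 * \int[mu]_x cabs (u x).
Proof.
move=> mg iu; have ie := cintegrable_expi mg iu.
rewrite (le_trans (cabs_cintegral ie))// -RintegralZl//; last exact: integrable_cabs.
apply: le_Rintegral => //; first exact: integrable_cabs.
  exact/integrable_EFinZl/integrable_cabs.
by move=> x _; exact: cabs_expiM.
Qed.

Lemma cabs_ft u k : cintegrable mu u -> cabs (ft u k) <= 2 * \int[mu]_x cabs (u x).
Proof. by move=> iu; apply: cabs_cintegral_expi => //; exact/measurable_funN/measurable_pairingl. Qed.

Lemma cabs_ift v x : cintegrable mu v -> cabs (ift v x) <= 2 * \int[mu]_k cabs (v k).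
Proof. by move=> iv; apply: cabs_cintegral_expi => //; exact/measurable_pairingr. Qed.

(** The multiplication formula: either side is the double integral of expi(- p k x) u(x) v(k),
    absolutely convergent because both functions are integrable. *)
Lemma ftM u v : cintegrable mu u -> cintegrable mu v ->
  cintegral mu (fun k => ft u k * v k) = cintegral mu (fun x => u x * ft v x).
Proof.
move=> iu iv.
have iuv : cintegrable (mu \x mu)%E (fun z => expi (- p z.1 z.2) * (v z.1 * u z.2)).
  by apply: cintegrable_expi; [exact: measurable_funN|exact: cintegrable_tensor].
transitivity (cintegral mu (fun k => cintegral mu (fun x =>
    expi (- p k x) * (v k * u x)))).
  congr cintegral; apply/funext => k; rewrite mulrC /ft -cintegralZ.
    by congr cintegral; apply/funext => x; ring.
  exact: cintegrable_ft.
rewrite (cintegral_swap iuv) /=; congr cintegral; apply/funext => x.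
rewrite /ft -cintegralZ; last exact: cintegrable_ft.
by congr cintegral; apply/funext => k; rewrite (pC k); ring.
Qed.

Lemma iftM u v : cintegrable mu u -> cintegrable mu v ->
  cintegral mu (fun k => ift u k * v k) = cintegral mu (fun x => u x * ift v x).
Proof.
move=> iu iv.
have iuv : cintegrable (mu \x mu)%E (fun z => expi (p z.1 z.2) * (v z.1 * u z.2)).
  by apply: cintegrable_expi; [exact: mp|exact: cintegrable_tensor].
transitivity (cintegral mu (fun k => cintegral mu (fun x =>
    expi (p k x) * (v k * u x)))).
  congr cintegral; apply/funext => k; rewrite mulrC /ift -cintegralZ.
    by congr cintegral; apply/funext => x; rewrite (pC k); ring.
  exact: cintegrable_ift.
rewrite (cintegral_swap iuv) /=; congr cintegral; apply/funext => x.
rewrite /ift -cintegralZ; last exact: cintegrable_ift.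
by congr cintegral; apply/funext => k; ring.
Qed.

Lemma ft_conj u k : cintegrable mu u -> ft (fun x => (u x)^*%C) k = (ift u k)^*%C.
Proof.
move=> iu; rewrite /ift -cintegral_conj; last exact: cintegrable_ift.
by congr cintegral; apply/funext => x; rewrite conjcM conj_expi pC.
Qed.

Lemma ift_conj u k : cintegrable mu u -> ift (fun x => (u x)^*%C) k = (ft u k)^*%C.
Proof.
move=> iu; rewrite /ft -cintegral_conj; last exact: cintegrable_ft.
by congr cintegral; apply/funext => x; rewrite conjcM conj_expi opprK pC.
Qed.

Lemma ftZ (c : R[i]) u k : cintegrable mu u -> ft (fun x => c * u x) k = c * ft u k.
Proof.
move=> iu; rewrite /ft -cintegralZ; last exact: cintegrable_ft.
by congr cintegral; apply/funext => x; ring.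
Qed.

Lemma ft_sum I (r : seq I) (u : I -> T -> R[i]) k : (forall i, cintegrable mu (u i)) ->
  ft (fun x => \sum_(i <- r) u i x) k = \sum_(i <- r) ft (u i) k.
Proof.
move=> iu; rewrite /ft -cintegral_sum; last by move=> i; exact: cintegrable_ft.
by congr cintegral; apply/funext => x; rewrite mulr_sumr.
Qed.

Lemma iftZ (c : R[i]) u k : cintegrable mu u -> ift (fun x => c * u x) k = c * ift u k.
Proof.
move=> iu; rewrite /ift -cintegralZ; last exact: cintegrable_ift.
by congr cintegral; apply/funext => x; ring.
Qed.

Lemma ift_sum I (r : seq I) (u : I -> T -> R[i]) k : (forall i, cintegrable mu (u i)) ->
  ift (fun x => \sum_(i <- r) u i x) k = \sum_(i <- r) ift (u i) k.
Proof.
move=> iu; rewrite /ift -cintegral_sum; last by move=> i; exact: cintegrable_ift.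
by congr cintegral; apply/funext => x; rewrite mulr_sumr.
Qed.

Lemma ae_eq_ft u v k : cmeas u -> cmeas v -> {ae mu, forall x, u x = v x} ->
  ft u k = ft v k.
Proof.
move=> mu_ mv uv.
have me : cmeas (fun x => expi (- p k x)).
  by apply: cmeas_expi; exact/measurable_funN/measurable_pairingl.
apply: ae_eq_cintegral; [exact: cmeasM|exact: cmeasM|].
by apply: filterS uv => x ->.
Qed.

Lemma ae_eq_ift u v k : cmeas u -> cmeas v -> {ae mu, forall x, u x = v x} ->
  ift u k = ift v k.
Proof.
move=> mu_ mv uv.
have me : cmeas (fun x => expi (p x k)) by apply: cmeas_expi; exact: measurable_pairingr.
apply: ae_eq_cintegral; [exact: cmeasM|exact: cmeasM|].
by apply: filterS uv => x ->.
Qed.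

(** A transform that vanishes almost everywhere is in particular integrable, so inversion applies
    and returns C u = 0. *)
Lemma ft_inj (C : R) u : C != 0 -> fourier_inversion mu p C -> cintegrable mu u ->
  {ae mu, forall k, ft u k = 0} -> {ae mu, forall x, u x = 0}.
Proof.
move=> C0 inv iu fu0.
have mfu : cmeas (ft u) by apply: cmeas_ft; exact: cintegrable_cmeas iu.
have m0 : cmeas (fun _ : T => 0 : R[i]) by exact: cmeas_cst.
have ifu : cintegrable mu (ft u).
  apply: (ae_cintegrable mfu _ (cintegrable0 mu)).
  by apply: filterS fu0 => k ->.
apply: filterS (inv _ iu ifu) => x.
rewrite (ae_eq_ift x mfu m0 fu0) /ift.
under eq_fun do rewrite mulr0.
rewrite cintegral0 => /esym/eqP; rewrite mulf_eq0 => /orP[/eqP/(congr1 (@complex.Re R))/= C0'|/eqP//].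
by rewrite C0' eqxx in C0.
Qed.

(** Conjugation exchanges [ft] and [ift], so inversion for the conjugate of v is inversion in the
    opposite order. *)
Lemma ft_ift (C : R) v : fourier_inversion mu p C ->
  cintegrable mu v -> cintegrable mu (ift v) ->
  {ae mu, forall k, ft (ift v) k = C%:C * v k}.
Proof.
move=> inv iv iI; pose w x := (v x)^*%C.
have iw : cintegrable mu w by exact: cintegrable_conj.
have ftw : ft w = fun k => (ift v k)^*%C by apply/funext => k; exact: ft_conj.
have ifw : cintegrable mu (ft w) by rewrite ftw; exact: cintegrable_conj.
apply: filterS (inv _ iw ifw) => k.
rewrite ftw ift_conj// => /(congr1 (fun z => z^*%C)).
rewrite conjcK conjcM /w conjcK => ->; congr (_ * _).
by apply: complex_eqP => //=; rewrite oppr0.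
Qed.

Lemma ift_inj (C : R) v : C != 0 -> fourier_inversion mu p C -> cintegrable mu v ->
  {ae mu, forall x, ift v x = 0} -> {ae mu, forall k, v k = 0}.
Proof.
move=> C0 inv iv v0; have m0 : cmeas (fun _ : T => 0 : R[i]) by exact: cmeas_cst.
have mI : cmeas (ift v) by apply: cmeas_ift; exact: cintegrable_cmeas iv.
have iI : cintegrable mu (ift v).
  by apply: (ae_cintegrable mI _ (cintegrable0 mu)); apply: filterS v0 => x ->.
apply: filterS (ft_ift inv iv iI) => k.
rewrite (ae_eq_ft k mI m0 v0) /ft.
under eq_fun do rewrite mulr0.
rewrite cintegral0 => /esym/eqP; rewrite mulf_eq0 => /orP[/eqP/(congr1 (@complex.Re R))/= C0'|/eqP//].
by rewrite C0' eqxx in C0.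
Qed.

End fourier_pairing.

(** * The Poisson kernel as the transform of Abel's factor *)

Section poisson_kernel.
Variable R : realType.
Local Notation leb := (@lebesgue_measure R).
Implicit Types (e t : R).

(** Abel's convergence factor: it makes the frequency integral absolutely convergent and tends to 1
    as e tends to 0. *)
Definition pk e (k : R) : R := expR (- e * `|k|).

Lemma continuous_pk e : continuous (pk e).
Proof.
move=> x; apply: (continuous_comp (f := fun k : R => `|k|) (g := fun y => expR (- e * y))).
  exact: norm_continuous.
exact: continuous_expRl.
Qed.

Lemma measurable_pk e : measurable_fun setT (pk e).
Proof. by apply: continuous_measurable_fun; exact: continuous_pk. Qed.

Lemma pk_ge0 e k : 0 <= pk e k. Proof. exact: expR_ge0. Qed.

Lemma pk_le1 e k : 0 <= e -> pk e k <= 1.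
Proof. by move=> e0; rewrite /pk -expR0 ler_expR mulNr oppr_le0 mulr_ge0. Qed.

Let pos_itv : [set x : R | 0 <= x] = `[0, +oo[%classic.
Proof. by apply/seteqP; split=> x; rewrite /= in_itv /= andbT. Qed.

Lemma integral_pk e : 0 < e -> (\int[leb]_k (pk e k)%:E = (2 * e^-1)%:E)%E.
Proof.
move=> e0; rewrite ge0_symfun_integralT//.
- rewrite pos_itv EFinM -(integral_expRN e0); congr (_ * _)%E.
  apply: eq_integral => x; rewrite inE /= in_itv /= andbT => x0.
  by rewrite /pk ger0_norm.
- exact: pk_ge0.
- exact: continuous_pk.
- by move=> x; rewrite /pk /= normrN.
Qed.

Lemma integral_pk_cos e t : 0 < e ->
  (\int[leb]_k (pk e k * (1 + cos (t * k)))%R%:E =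
   (2 * (e^-1 + e / (e ^+ 2 + t ^+ 2)))%:E)%E.
Proof.
move=> e0; rewrite ge0_symfun_integralT//.
- rewrite pos_itv EFinM -(integral_expRN_cos t e0); congr (_ * _)%E.
  apply: eq_integral => x; rewrite inE /= in_itv /= andbT => x0.
  by rewrite /pk ger0_norm.
- by move=> x; rewrite mulr_ge0 ?pk_ge0// -lerBlDl sub0r cos_geN1.
- move=> x; apply: cvgM; first exact: continuous_pk.
  apply: cvgD; first exact: cvg_cst.
  apply: differentiable_continuous; apply/derivable1_diffP.
  by have [] := is_derive_cosl t x.
- by move=> x; rewrite /pk /= normrN mulrN cosN.
Qed.

Lemma integrable_pk e : 0 < e -> leb.-integrable setT (fun k => (pk e k)%:E).
Proof.
move=> e0; apply/integrableP; split.
  by apply/measurable_EFinP; exact: measurable_pk.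
under eq_integral do rewrite gee0_abs ?lee_fin ?pk_ge0//.
by rewrite integral_pk// ltry.
Qed.

Lemma cintegrable_pk e : 0 < e -> cintegrable leb (fun k => (pk e k)%:C).
Proof. by move=> e0; split; [exact: integrable_pk|exact: integrable0]. Qed.

Lemma poisson_kernel e t : 0 < e ->
  cintegral leb (fun k => expi (t * k) * (pk e k)%:C) =
  (2 * e / (e ^+ 2 + t ^+ 2))%:C.
Proof.
move=> e0.
have mt : measurable_fun [set: measurableTypeR R] (fun k : measurableTypeR R => t * k).
  by apply: measurable_funM => //; exact: measurable_id.
have [i1 i2] := cintegrable_expi mt (cintegrable_pk e0).
have Epk := integral_pk e0; have Ecos := integral_pk_cos t e0.
apply: complex_eqP => /=.
  have -> : \int[leb]_k Re (expi (t * k) * (pk e k)%:C) =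
      \int[leb]_k (pk e k * (1 + cos (t * k)) - pk e k).
    by apply: eq_Rintegral => k _; rewrite /=; ring.
  rewrite RintegralB//; last exact: integrable_pk.
    by rewrite /Rintegral Epk Ecos /=; ring.
  apply/integrableP; split.
    apply/measurable_EFinP; apply: measurable_funM; first exact: measurable_pk.
    apply: measurable_funD => //; apply: (measurableT_comp (f := cos) _ mt).
    by apply: continuous_measurable_fun; exact: continuous_cos.
  under eq_integral do rewrite gee0_abs ?lee_fin ?mulr_ge0 ?pk_ge0// -?lerBlDl ?sub0r ?cos_geN1//.
  by rewrite Ecos ltry.
(* The imaginary part is odd, so reflection makes its integral equal to its own negative. *)
pose f (k : R) := Im (expi (t * k) * (pk e k)%:C).
have fN k : f (- k) = - f k.
  by rewrite /f /= /pk normrN mulrN cosN sinN; ring.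
have E : \int[leb]_k f k = - \int[leb]_k f k.
  rewrite {1}/Rintegral (integral_mpres (mpres_lebesgueN R) i2) -mulN1r -RintegralZl//.
  by congr fine; apply: eq_integral => k _; rewrite -/(f (- k)) fN mulN1r.
by move/eqP: E; rewrite -addr_eq0 -mulr2n mulrn_eq0 => /eqP.
Qed.

End poisson_kernel.

(** * Fourier inversion on the line *)

Section inversion_line.
Variable R : realType.
Local Notation leb := (@lebesgue_measure R).
Local Notation TR := (measurableTypeR R).

Lemma ccvg_realM (r : nat -> R) (l : R) (z : R[i]) : r @ \oo --> l ->
  ccvg (fun n => (r n)%:C * z) (l%:C * z).
Proof.
move=> rl; split.
  rewrite (_ : (fun n => _) = (fun n => r n * Re z)); last first.
    by apply/funext => n; rewrite ReM /= mul0r subr0.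
  by rewrite ReM /= mul0r subr0; apply: cvgM => //; exact: cvg_cst.
rewrite (_ : (fun n => _) = (fun n => r n * Im z)); last first.
  by apply/funext => n; rewrite ImM /= mul0r addr0.
by rewrite ImM /= mul0r addr0; apply: cvgM => //; exact: cvg_cst.
Qed.

Lemma ae_lebesgue_neq (a : R) : {ae leb, forall x, x != a}.
Proof.
exists [set a]; split; [exact: measurable_set1|exact: lebesgue_measure_set1|].
by move=> x /= /negP; rewrite negbK => /eqP.
Qed.

Lemma integral_cauchy (e a b y : R) : 0 < e -> a < b ->
  (\int[leb]_(x in `[a, b]) (2 * e / (e ^+ 2 + (x - y) ^+ 2))%:E =
  (2 * atan ((b - y) / e) - 2 * atan ((a - y) / e))%:E)%E.
Proof.
move=> e0 ab; have en0 : e != 0 by rewrite gt_eqF.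
pose F x := 2 * atan (e^-1 * x - e^-1 * y).
have dF x : is_derive x (1 : R) F (2 * e / (e ^+ 2 + (x - y) ^+ 2)).
  have h1 : is_derive x (1 : R) (fun x => e^-1 * x - e^-1 * y) e^-1.
    have h := is_deriveD (is_derive_lin e^-1 x) (is_derive_cst (- (e^-1 * y)) x (1 : R)).
    by apply: (is_derive_eq h); rewrite addr0.
  have h2 := @is_derive1_comp R atan _ x _ _ (is_derive1_atan _) h1.
  have h3 := is_deriveM (is_derive_cst (2 : R) x (1 : R)) h2.
  apply: (is_derive_eq h3); rewrite /GRing.scale /= /cst mulr0 addr0.
  have d1 : 1 + (e^-1 * x - e^-1 * y) ^+ 2 != 0.
    by rewrite gt_eqF// ltr_pwDl ?ltr01 ?sqr_ge0.
  have d2 : e ^+ 2 + (x - y) ^+ 2 != 0.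
    by rewrite gt_eqF// ltr_pwDl ?exprn_gt0 ?sqr_ge0.
  have -> : 1 + (e^-1 * x - e^-1 * y) ^+ 2 = (e ^+ 2 + (x - y) ^+ 2) / e ^+ 2.
    by field.
  by field; rewrite en0 d2.
have cF x : {for x, continuous F}.
  by apply: differentiable_continuous; apply/derivable1_diffP; have [] := dF x.
rewrite (@continuous_FTC2 _ _ F)//.
- by rewrite -EFinB /F; congr (_%:E); congr (_ * atan _ - _ * atan _); field.
- apply: continuous_subspaceT => x; apply: cvgM; first exact: cvg_cst.
  apply: cvgV; first by rewrite gt_eqF// ltr_pwDl ?exprn_gt0 ?sqr_ge0.
  apply: cvgD; first exact: cvg_cst.
  apply: (continuous_comp (f := fun x => x - y) (g := fun z => z ^+ 2)).
    by apply: cvgB; [exact: cvg_id|exact: cvg_cst].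
  exact: exprn_continuous.
- split.
  + by move=> x _; have [] := dF x.
  + by apply: cvg_at_right_filter; exact: cF.
  + by apply: cvg_at_left_filter; exact: cF.
- by move=> x _; rewrite derive1E; have [] := dF x.
Qed.

Definition line_pairing : TR -> TR -> R := fun k x => k * x.

Lemma measurable_line_pairing : measurable_pairing line_pairing.
Proof. by apply: measurable_funM; [exact: measurable_fst|exact: measurable_snd]. Qed.

Lemma line_pairingC x y : line_pairing x y = line_pairing y x.
Proof. exact: mulrC. Qed.

Let mp := measurable_line_pairing.
Let pC := line_pairingC.
Local Notation ft := (ft leb line_pairing).
Local Notation ift := (ift leb line_pairing).

Definition citv (a b : R) (x : TR) : R[i] := (\1_`[a, b] x)%:C.

Lemma cintegrable_citv a b : cintegrable leb (citv a b).
Proof.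
split; last exact: integrable0.
by apply: (integrable_indic_itv a b true false).
Qed.

Lemma cintegral_citvM a b (f : TR -> R) :
  cintegral leb (fun x => citv a b x * (f x)%:C) = (\int[leb]_(x in `[a, b]) f x)%:C.
Proof.
apply: complex_eqP; rewrite /cintegral /=.
  rewrite [RHS]Rintegral_mkcond; apply: eq_Rintegral => x _.
  rewrite patchE mul0r subr0 indicE; case: ifPn => _ /=; first by rewrite mul1r.
  by rewrite mul0r.
transitivity (\int[leb]_(x in setT) (0 : R)); last by rewrite /Rintegral integral0.
by apply: eq_Rintegral => x _; rewrite mulr0 mul0r addr0.
Qed.

(** The indicator of [a, b] smoothed by the Poisson kernel of width e, in closed form. *)
Definition atan_window (e a b y : R) : R :=
  2 * atan ((b - y) / e) - 2 * atan ((a - y) / e).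

Lemma ft_pk_ift_citv e a b y : 0 < e -> a < b ->
  ft (fun k => (pk e k)%:C * ift (citv a b) k) y = (atan_window e a b y)%:C.
Proof.
move=> e0 ab; have ipk := cintegrable_pk e0; have ic := cintegrable_citv a b.
rewrite /atan_window; have := integral_cauchy y e0 ab.
move=> /(congr1 (@fine R)); rewrite /= => <-.
rewrite -[X in _ = X%:C]/(\int[leb]_(x in `[a, b]) (2 * e / (e ^+ 2 + (x - y) ^+ 2))).
rewrite -cintegral_citvM.
have mE : measurable_fun setT (fun z : TR * TR => z.2 * z.1 - y * z.1).
  apply: measurable_funB; first exact: (measurable_funM measurable_snd measurable_fst).
  exact: (measurable_funM (measurable_cst y) measurable_fst).
have iF : cintegrable (leb \x leb)%E (fun z : TR * TR =>
    expi (z.2 * z.1 - y * z.1) * ((pk e z.1)%:C * citv a b z.2)).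
  by apply: cintegrable_expi => //; exact: (cintegrable_tensor ipk ic).
transitivity (cintegral leb (fun k : TR => cintegral leb (fun x : TR =>
    expi (x * k - y * k) * ((pk e k)%:C * citv a b x)))).
  congr cintegral; apply/funext => k.
  rewrite mulrA /ift -cintegralZ; last exact: cintegrable_ift.
  by congr cintegral; apply/funext => x; rewrite expiD /line_pairing; ring.
rewrite (cintegral_swap iF) /=; congr cintegral; apply/funext => x.
rewrite -poisson_kernel// -cintegralZ.
  by congr cintegral; apply/funext => k; rewrite -mulrBl; ring.
by apply: cintegrable_expi => //; apply: measurable_funM => //; exact: measurable_id.
Qed.

Lemma atan_window_bound e a b y : `|atan_window e a b y| <= 2 * pi.
Proof.
have := atan_gtNpi2 ((b - y) / e); have := atan_ltpi2 ((b - y) / e).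
have := atan_gtNpi2 ((a - y) / e); have := atan_ltpi2 ((a - y) / e).
rewrite /atan_window => *; rewrite ler_norml; apply/andP; split; lra.
Qed.

Lemma measurable_atan_window e a b : measurable_fun [set: R] (atan_window e a b).
Proof.
have ma (c : R) : measurable_fun [set: R] (fun y => 2 * atan ((c - y) / e)).
  apply: continuous_measurable_fun => y; apply: cvgM; first exact: cvg_cst.
  apply: (continuous_comp (f := fun y => (c - y) / e) (g := atan)).
    apply: cvgM; last exact: cvg_cst.
    by apply: cvgB; [exact: cvg_cst|exact: cvg_id].
  exact: continuous_atan.
exact: (measurable_funB (ma b) (ma a)).
Qed.

Lemma cvg_atan_gt0 (t : R) : 0 < t -> (fun n : nat => atan (t / n.+1%:R^-1)) @ \oo --> pi / 2.
Proof.
move=> t0; apply: (cvg_comp (fun n : nat => t / n.+1%:R^-1) atan); last exact: cvgy_atan.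
under eq_fun do rewrite invrK.
have h : (fun n : nat => n.+1%:R : R) @ \oo --> +oo.
  by have := @cvgr_idn R; rewrite -cvg_shiftS.
apply: (cvg_comp _ (fun r : R => t * r) h).
by apply: (@gt0_cvgMry _ _ _ t id); [|exact: cvg_id].
Qed.

Lemma cvg_atan_lt0 (t : R) : t < 0 -> (fun n : nat => atan (t / n.+1%:R^-1)) @ \oo --> - (pi / 2).
Proof.
move=> t0; have t0' : 0 < - t by rewrite oppr_gt0.
rewrite (_ : (fun n => _) = (fun n : nat => - atan (- t / n.+1%:R^-1))).
  exact: cvgN (cvg_atan_gt0 t0').
by apply/funext => n; rewrite mulNr atanN opprK.
Qed.

(** Each arctangent tends to plus or minus pi/2 according to the sign of its argument. At an
    endpoint the limit would be pi, half the jump; the two endpoints form a null set. *)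
Lemma cvg_atan_window a b y : a < b -> y != a -> y != b ->
  (fun n : nat => atan_window n.+1%:R^-1 a b y) @ \oo --> 2 * pi * \1_`[a, b] y.
Proof.
move=> ab ya yb; rewrite /atan_window indicE.
have [lya|lay|eya] := ltgtP y a.
- have lyb := lt_trans lya ab.
  rewrite memNset; last by rewrite /= in_itv /= => /andP[]; rewrite leNgt lya.
  rewrite mulr0 -(subrr (2 * (pi / 2))).
  by apply: cvgB; apply: cvgM; try exact: cvg_cst; apply: cvg_atan_gt0; rewrite subr_gt0.
- have [lyb|lby|eyb] := ltgtP y b.
  + rewrite mem_set; last by rewrite /= in_itv /= !ltW.
    rewrite (_ : 2 * pi * true%:R = 2 * (pi / 2) - 2 * (- (pi / 2))); last by rewrite /=; field.
    apply: cvgB; apply: cvgM; try exact: cvg_cst.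
      by apply: cvg_atan_gt0; rewrite subr_gt0.
    by apply: cvg_atan_lt0; rewrite subr_lt0.
  + rewrite memNset; last by rewrite /= in_itv /= => /andP[_]; rewrite leNgt lby.
    rewrite mulr0 -(subrr (2 * - (pi / 2))).
    by apply: cvgB; apply: cvgM; try exact: cvg_cst; apply: cvg_atan_lt0; rewrite subr_lt0.
  + by rewrite eyb eqxx in yb.
- by rewrite eya eqxx in ya.
Qed.

(** The transform of an indicator decays too slowly to be integrable, so the multiplication formula
    does not apply to it directly. Abel's factor repairs this: the integrals [J n] tend to the left
    side because the factor tends to 1 and, rewritten as integrals of the smoothed indicator against
    u, to the right side. *)
Lemma cintegral_citv_ift_ft a b (u : TR -> R[i]) : a < b ->
  cintegrable leb u -> cintegrable leb (ft u) ->
  cintegral leb (fun x => citv a b x * ift (ft u) x) =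
  cintegral leb (fun x => citv a b x * ((2 * pi)%:C * u x)).
Proof.
move=> ab iu iv; have ic := cintegrable_citv a b.
have mI : cmeas (ift (citv a b)) by apply: cmeas_ift => //; exact: cintegrable_cmeas ic.
pose K := 2 * \int[leb]_x cabs (citv a b x).
have IK k : cabs (ift (citv a b) k) <= K by exact: cabs_ift.
have mpk e : cmeas (fun k : TR => (pk e k)%:C : R[i]).
  by apply: cmeas_real; exact: measurable_pk.
pose J n := cintegral leb (fun k => ft u k * ((pk n.+1%:R^-1 k)%:C * ift (citv a b) k)).
have e0 n : 0 < n.+1%:R^-1 :> R by [].
have lim1 : ccvg J (cintegral leb (fun k => ft u k * ift (citv a b) k)).
  apply: (@cintegral_ccvg _ _ _ _ _ _ (ft u) K) => //.
  - move=> n; apply: cmeasM; first exact: cintegrable_cmeas iv.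
    by apply: cmeasM.
  - by apply: cmeasM => //; exact: cintegrable_cmeas iv.
  - apply: aeW => k.
    rewrite (_ : (fun n => _) = (fun n => (pk n.+1%:R^-1 k)%:C * (ft u k * ift (citv a b) k))).
      have := @ccvg_realM (fun n => pk n.+1%:R^-1 k) 1 (ft u k * ift (citv a b) k).
      rewrite mul1r; apply.
      suff : (fun n => pk n.+1%:R^-1 k) @ \oo --> expR (- 0 * `|k|).
        by rewrite oppr0 mul0r expR0.
      apply: continuous_cvg; first exact: continuous_expR.
      apply: cvgM; last exact: cvg_cst.
      by apply: cvgN; exact: cvg_harmonic.
    by apply/funext => n; rewrite /=; ring.
  - move=> n k; rewrite mulrC (le_trans (cabsM _ _))// ler_wpM2r ?cabs_ge0//.
    rewrite (le_trans (cabsM _ _))// -[leRHS]mul1r ler_pM ?cabs_ge0//.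
    by rewrite /cabs /= normr0 addr0 ger0_norm ?pk_ge0// pk_le1.
have JE n : J n = cintegral leb (fun y => (atan_window n.+1%:R^-1 a b y)%:C * u y).
  rewrite /J (ftM mp pC)//.
    by congr cintegral; apply/funext => y; rewrite ft_pk_ift_citv// mulrC.
  rewrite (_ : (fun k => _) = (fun k => ift (citv a b) k * (pk n.+1%:R^-1 k)%:C)).
    by apply: (cintegrable_bmul mI IK); exact: cintegrable_pk.
  by apply/funext => k; rewrite mulrC.
have mu_ := cintegrable_cmeas iu.
have mc : cmeas (citv a b) by exact: cintegrable_cmeas ic.
have lim2 : ccvg J (cintegral leb (fun x => citv a b x * ((2 * pi)%:C * u x))).
  rewrite (_ : J = (fun n => cintegral leb (fun y => (atan_window n.+1%:R^-1 a b y)%:C * u y))).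
    apply: (@cintegral_ccvg _ _ _ _ _ _ u (2 * pi)) => //.
    - move=> n; apply: cmeasM => //; apply: cmeas_real; exact: measurable_atan_window.
    - by apply: cmeasM => //; apply: cmeasM => //; exact: cmeas_cst.
    - have FF := ae_filter_ringOfSetsType leb.
      apply: filterS2 (ae_lebesgue_neq a) (ae_lebesgue_neq b) => y ya yb.
      rewrite (_ : citv a b y * _ = (2 * pi * \1_`[a, b] y)%:C * u y).
        by apply: ccvg_realM; exact: cvg_atan_window.
      by rewrite /citv rmorphM /=; ring.
    - move=> n y; rewrite (le_trans (cabsM _ _))// ler_wpM2r ?cabs_ge0//.
      by rewrite /cabs /= normr0 addr0 atan_window_bound.
  exact/funext.
have := ccvg_unique lim1 lim2 => <-.
rewrite (_ : (fun x => _) = (fun x => ift (ft u) x * citv a b x)).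
  by rewrite (iftM mp pC).
by apply/funext => x; rewrite mulrC.
Qed.

End inversion_line.

(** Measurability by recursion on the expression. Sums and opposites are tried first as vectors,
    then as reals. *)
Ltac mtac :=
  first [assumption | lazymatch goal with
  | |- measurable_fun _ (fun z => fst (@?g z)) =>
      refine (measurableT_comp (f := fst) measurable_fst (g := g) _); mtac
  | |- measurable_fun _ (fun z => snd (@?g z)) =>
      refine (measurableT_comp (f := snd) measurable_snd (g := g) _); mtac
  | |- measurable_fun _ (fun z => (@?f z, @?g z)) => 
      refine (measurable_fun_pair (f := f) (g := g) _ _); mtac
  | |- measurable_fun _ (fun z => z) => exact: measurable_id
  | |- measurable_fun _ fst => exact: measurable_fst
  | |- measurable_fun _ snd => exact: measurable_snd
  | |- measurable_fun _ (fun z => dot (@?f z) (@?g z)) =>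
      refine (measurable_dot (f := f) (g := g) _ _); mtac
  | |- measurable_fun _ (fun z => @?f z *m ?M) =>
      refine (measurable_mulmxr M (f := f) _); mtac
  | |- measurable_fun _ (fun z => ?c *: @?f z) =>
      refine (measurable_rVZ c (f := f) _); mtac
  | |- measurable_fun _ (fun z => @?f z + @?g z) =>
      first [refine (measurable_rVD (f := f) (g := g) _ _)
            |refine (measurable_funD (f := f) (g := g) _ _)]; mtac
  | |- measurable_fun _ (fun z => - @?f z) =>
      first [refine (measurable_rVN (f := f) _)
            |refine (measurable_funN (f := f) _)]; mtac
  | |- measurable_fun _ (fun z => @?f z * @?g z) =>
      refine (measurable_funM (f := f) (g := g) _ _); mtac
  | |- measurable_fun _ (fun z => ?c) => exact: measurable_cst
  | |- _ => idtac
  end].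

Section inversion_line2.
Variable R : realType.
Local Notation leb := (@lebesgue_measure R).
Local Notation TR := (measurableTypeR R).

(** Lebesgue differentiation: the primitive of f cut off to [-N, N] is identically 0, and its
    derivative is the cut-off function almost everywhere. Countably many N cover the line. *)
Lemma ae_eq0_lebesgue_itv (f : R -> R) :
  (forall a b, leb.-integrable `[a, b] (EFin \o f)) ->
  (forall a b, a < b -> \int[leb]_(x in `[a, b]) f x = 0) ->
  {ae leb, forall x, f x = 0}.
Proof.
move=> fi f0.
have FF := ae_filter_ringOfSetsType leb.
have fN (N : nat) : {ae leb, forall x, (f \_ `[- N%:R, N%:R]) x = 0}.
  have iN : leb.-integrable setT (EFin \o (f \_ `[- N%:R, N%:R])).
    have := (fi (- N%:R) N%:R).
    by rewrite (integrable_mkcond _ _)// restrict_EFin.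
  have F0 : (fun x : R => \int[leb]_(t in `]-oo, x]) (f \_ `[- N%:R, N%:R]) t) = cst 0.
    apply/funext => x; rewrite -Rintegral_mkcondr.
    rewrite (_ : _ `&` _ = `[- N%:R, Num.min x N%:R]%classic); last first.
      apply/seteqP; split=> t; rewrite /= !in_itv /= le_min.
        by move=> [-> /andP[-> ->]].
      by move=> /and3P[-> -> ->].
    (* If min(x, N) <= -N, the interval of integration has at most one point. *)
    have [lt|ge] := ltP (- N%:R) (Num.min x N%:R); first exact: f0.
    rewrite /Rintegral null_set_integral//.
      by have /integrableP[] := fi (- N%:R) (Num.min x N%:R).
    apply: (@subset_measure0 _ _ _ leb _ [set - N%:R]) => //.
      move=> t; rewrite /= in_itv /= => /andP[t1 t2].
      by apply/eqP; rewrite eq_le t1 (le_trans t2 ge).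
    exact: lebesgue_measure_set1.
  have h1 (y : R) : leb.-integrable `]-oo, y] (EFin \o (f \_ `[- N%:R, N%:R])).
    exact: integrableS iN.
  have h2 : locally_integrable [set: R] (f \_ `[- N%:R, N%:R]).
    exact: integrable_locally.
  have := FTC1Ny h1 h2; rewrite /= F0; apply: filterS => x [_ <-].
  by rewrite derive1_cst.
have := ae_foralln fN; apply: filterS => x /(_ (Num.bound `|x|)).
have := archi_boundP (normr_ge0 x); set N := Num.bound _ => xN.
by rewrite patchE mem_set//= in_itv /= -ler_norml ltW.
Qed.

(** Both sides have the same integral over every bounded interval, where the iterated transform is
    integrable because it is bounded. *)
Lemma lebesgue_fourier_inversion : fourier_inversion leb (@line_pairing R) (2 * pi).
Proof.
move=> u iu iv.
have mp := @measurable_line_pairing R; have pC := @line_pairingC R.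
have FF := ae_filter_ringOfSetsType leb.
set v := ft leb (@line_pairing R) u in iv *.
set w := fun x => ift leb (@line_pairing R) v x - (2 * pi)%:C * u x.
have mv : cmeas (ift leb (@line_pairing R) v).
  by apply: cmeas_ift => //; exact: cintegrable_cmeas iv.
have bv x : cabs (ift leb (@line_pairing R) v x) <= 2 * \int[leb]_k cabs (v k).
  exact: cabs_ift.
have icv a b : cintegrable leb (fun x => citv a b x * ift leb (@line_pairing R) v x).
  under eq_fun do rewrite mulrC.
  by apply: (cintegrable_bmul mv bv); exact: cintegrable_citv.
have icu a b : cintegrable leb (fun x => citv a b x * ((2 * pi)%:C * u x)).
  apply: (@cintegrable_bmul _ _ _ _ _ _ 1).
  - by have [] := (cintegrableP leb (citv a b)).1 (cintegrable_citv a b).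
  - move=> x; rewrite /citv indicE /cabs /= normr0 addr0.
    by case: (_ \in _); rewrite ?normr1 ?normr0.
  - exact: cintegrableZ.
have iw a b : cintegrable leb (fun x => citv a b x * w x).
  under eq_fun do rewrite mulrBr.
  by apply: cintegrableD => //; exact: cintegrableN.
have w0 a b : a < b -> cintegral leb (fun x => citv a b x * w x) = 0.
  move=> ab; under eq_fun do rewrite mulrBr.
  by rewrite cintegralB// cintegral_citv_ift_ft// subrr.
have citvE a b (x : TR) z : Re (citv a b x * z) = ((fun=> Re z) \_ `[a, b]) x /\
    Im (citv a b x * z) = ((fun=> Im z) \_ `[a, b]) x.
  rewrite ReM ImM /citv indicE !patchE /= mul0r subr0 mul0r addr0.
  by case: (_ \in _); rewrite ?mul1r ?mul0r.
have h1 : {ae leb, forall x, Re (w x) = 0}.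
  apply: ae_eq0_lebesgue_itv => a b.
    have [i1 _] := iw a b; rewrite (integrable_mkcond _ _)// restrict_EFin.
    move: i1; under eq_fun do rewrite (citvE a b _ _).1.
    by [].
  move=> ab; have /(congr1 (@complex.Re R)) := w0 a b ab; rewrite /= => <-.
  by rewrite Rintegral_mkcond; apply: eq_Rintegral => x _; rewrite (citvE a b _ _).1.
have h2 : {ae leb, forall x, Im (w x) = 0}.
  apply: ae_eq0_lebesgue_itv => a b.
    have [_ i1] := iw a b; rewrite (integrable_mkcond _ _)// restrict_EFin.
    move: i1; under eq_fun do rewrite (citvE a b _ _).2.
    by [].
  move=> ab; have /(congr1 (@complex.Im R)) := w0 a b ab; rewrite /= => <-.
  by rewrite Rintegral_mkcond; apply: eq_Rintegral => x _; rewrite (citvE a b _ _).2.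
apply: filterS2 h1 h2 => x r0 i0; apply/eqP; rewrite -subr_eq0; apply/eqP.
exact: complex_eqP.
Qed.

End inversion_line2.

Section fubini_phase.
Context d1 d2 (T1 : measurableType d1) (T2 : measurableType d2) (R : realType).
Variables (m1 : {sigma_finite_measure set T1 -> \bar R})
  (m2 : {sigma_finite_measure set T2 -> \bar R}).
Variable F : T1 * T2 -> R[i].
Hypothesis iF : cintegrable (m1 \x m2)%E F.

(** The factor leaves the inner integral at points where the slice of F is integrable; these are
    almost all points, whence the comparison of the outer integrands off a null set. *)
Lemma cintegral_fubini_phase1 (P : T1 -> R[i]) : cmeas P ->
  cintegrable (m1 \x m2)%E (fun z => P z.1 * F z) ->
  cintegral (m1 \x m2)%E (fun z => P z.1 * F z) =
  cintegral m1 (fun x => P x * cintegral m2 (fun y => F (x, y))).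
Proof.
move=> mP iPF; rewrite cintegral_fubini//; apply: ae_eq_cintegral.
- exact: (cmeas_slice m2 (cintegrable_cmeas iPF)).
- by apply: cmeasM => //; apply: cmeas_slice; exact: cintegrable_cmeas iF.
- by apply: filterS (ae_cintegrable1 iF) => x ix; rewrite /= cintegralZ.
Qed.

Lemma cintegral_fubini_expi1 (g : T1 -> R) : measurable_fun setT g ->
  cintegral (m1 \x m2)%E (fun z => expi (g z.1) * F z) =
  cintegral m1 (fun x => expi (g x) * cintegral m2 (fun y => F (x, y))).
Proof.
move=> mg; apply: (cintegral_fubini_phase1 (P := fun x => expi (g x))).
  exact: cmeas_expi.
by apply: cintegrable_expi => //; exact: (measurableT_comp mg measurable_fst).
Qed.

End fubini_phase.

Lemma cintegral_fubini_expi2 d1 d2 (T1 : measurableType d1) (T2 : measurableType d2)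
    (R : realType) (m1 : {sigma_finite_measure set T1 -> \bar R})
    (m2 : {sigma_finite_measure set T2 -> \bar R}) (F : T1 * T2 -> R[i]) (g : T2 -> R) :
  cintegrable (m1 \x m2)%E F -> measurable_fun setT g ->
  cintegral (m1 \x m2)%E (fun z => expi (g z.2) * F z) =
  cintegral m2 (fun y => expi (g y) * cintegral m1 (fun x => F (x, y))).
Proof.
move=> iF mg; have iF' := cintegrable_swap iF.
rewrite -(cintegral_fubini_expi1 iF' mg).
rewrite (cintegral_mpres (mpres_swap m2 m1)).
  by congr cintegral; apply/funext.
by apply: cintegrable_expi => //; exact: (measurableT_comp mg measurable_snd).
Qed.

(** * Fourier inversion on a product *)

Section inversion_product.
Context d1 d2 (T1 : measurableType d1) (T2 : measurableType d2) (R : realType).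
Variables (m1 : {sigma_finite_measure set T1 -> \bar R})
  (m2 : {sigma_finite_measure set T2 -> \bar R}).
Variables (p1 : T1 -> T1 -> R) (p2 : T2 -> T2 -> R) (C1 C2 : R).

Definition pairing_prod (k x : T1 * T2) : R := p1 k.1 x.1 + p2 k.2 x.2.

Hypotheses (mp1 : measurable_pairing p1) (mp2 : measurable_pairing p2).
Hypotheses (p1C : forall x y, p1 x y = p1 y x) (p2C : forall x y, p2 x y = p2 y x).
Hypotheses (C10 : C1 != 0) (inv1 : fourier_inversion m1 p1 C1)
  (inv2 : fourier_inversion m2 p2 C2).

Lemma measurable_pairing_comp d (T : measurableType d) d' (T' : measurableType d')
    (p : T' -> T' -> R) (f g : T -> T') :
  measurable_pairing p -> measurable_fun setT f -> measurable_fun setT g ->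
  measurable_fun setT (fun z => p (f z) (g z)).
Proof.
by move=> mp mf mg; exact: (measurableT_comp mp (measurable_fun_pair mf mg)).
Qed.

Lemma measurable_pairing_prod : measurable_pairing pairing_prod.
Proof. by apply: measurable_funD; apply: measurable_pairing_comp => //; mtac. Qed.

Lemma pairing_prodC x y : pairing_prod x y = pairing_prod y x.
Proof. by rewrite /pairing_prod p1C p2C. Qed.

(** The point is the integrability of the transform of u(x, .), which inversion in the second factor
    requires and which integrability of the joint transform does not give by itself. It comes from
    inversion in the first factor: for almost every x that transform is a multiple of [H (., x)], a
    slice integral of v and therefore integrable. *)
Theorem fourier_inversion_prod :
  fourier_inversion (m1 \x m2)%E pairing_prod (C1 * C2).
Proof.
move=> u iu iv; set v := ft _ _ u in iv *.
have mu_ := cintegrable_cmeas iu; have mv := cintegrable_cmeas iv.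
(* [U] transforms u in the second variable only, [H] inverts v in the first; inversion in the first
   factor relates them by H = C1 U. *)
pose U (z : T2 * T1) := ft m2 p2 (fun y => u (z.2, y)) z.1.
pose H (z : T2 * T1) := ift m1 p1 (fun k => v (k, z.1)) z.2.
have mU : cmeas U.
  apply: (@cmeas_slice _ _ _ _ _ m2
    (fun z : (T2 * T1) * T2 => expi (- p2 z.1.1 z.2) * u (z.1.2, z.2))).
  apply: cmeasM; first apply: cmeas_expi.
    by apply: measurable_funN; apply: measurable_pairing_comp => //; mtac.
  by apply: (cmeas_comp _ mu_); mtac.
have mH : cmeas H.
  apply: (@cmeas_slice _ _ _ _ _ m1
    (fun z : (T2 * T1) * T1 => expi (p1 z.2 z.1.2) * v (z.2, z.1.1))).
  apply: cmeasM; first apply: cmeas_expi.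
    by apply: measurable_pairing_comp => //; mtac.
  by apply: (cmeas_comp _ mv); mtac.
have mpp := measurable_pairing_prod.
have vE k l : v (k, l) = ft m1 p1 (fun x => U (l, x)) k.
  rewrite /v /ft.
  rewrite (_ : (fun x => _) = (fun z => expi (- p1 k z.1) * (expi (- p2 l z.2) * u z))).
    rewrite (@cintegral_fubini_expi1 _ _ _ _ _ m1 m2
      (fun z => expi (- p2 l z.2) * u z) _ (fun x => - p1 k x))//.
      apply: cintegrable_expi => //; apply: measurable_funN.
      by apply: measurable_pairing_comp => //; mtac.
    by apply: measurable_funN; exact: (measurable_fun_pair2 k mp1).
  by apply/funext => z; rewrite mulrA -expiD /pairing_prod /= opprD.
have iU l : cintegrable m1 (fun x => U (l, x)).
  apply: (@cintegrable_slice _ _ _ _ _ _ _ (fun z => expi (- p2 l z.2) * u z)).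
  apply: cintegrable_expi => //; apply: measurable_funN.
  by apply: measurable_pairing_comp => //; mtac.
have iH x : cintegrable m2 (fun l => H (l, x)).
  apply: (@cintegrable_slice _ _ _ _ _ _ _ (fun z : T2 * T1 => expi (p1 z.2 x) * v (z.2, z.1))).
  apply: cintegrable_expi; last exact: cintegrable_swap iv.
  by apply: measurable_pairing_comp => //; mtac.
have HE x y : ift (m1 \x m2)%E pairing_prod v (x, y) = ift m2 p2 (fun l => H (l, x)) y.
  rewrite /ift.
  rewrite (_ : (fun k => _) = (fun z => expi (p2 z.2 y) * (expi (p1 z.1 x) * v z))).
    rewrite (@cintegral_fubini_expi2 _ _ _ _ _ m1 m2 (fun z => expi (p1 z.1 x) * v z) (p2^~ y))//.
      apply: cintegrable_expi => //.
      by apply: measurable_pairing_comp => //; mtac.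
    exact: (measurable_fun_pair1 y mp2).
  by apply/funext => z; rewrite mulrA -expiD /pairing_prod /= addrC.
have h1 : {ae m2, forall l, {ae m1, forall x, H (l, x) - C1%:C * U (l, x) = 0}}.
  apply: filterS (ae_cintegrable1 (cintegrable_swap iv)) => l ivl.
  have E : ft m1 p1 (fun x => U (l, x)) = (fun k => v (k, l)) by apply/funext => k; rewrite vE.
  have := inv1 (iU l); rewrite E => /(_ ivl); apply: filterS => x <-.
  by rewrite /H subrr.
(* Inversion in the second factor takes place at fixed x, so the two almost-everywhere quantifiers
   change order. *)
have h2 : {ae m1, forall x, {ae m2, forall l, H (l, x) - C1%:C * U (l, x) = 0}}.
  apply: (ae_swap (F := fun z => H z - C1%:C * U z)) h1.
  apply: cmeasD => //; apply: cmeasN; apply: cmeasM => //; exact: cmeas_cst.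
have C1C : C1%:C != 0 :> R[i].
  by apply/eqP => /(congr1 (@complex.Re R)) /= /eqP; rewrite (negbTE C10).
have mUx x : cmeas (fun l => U (l, x)) by apply: (cmeas_comp _ mU); mtac.
have mHx x : cmeas (fun l => H (l, x)) by apply: (cmeas_comp _ mH); mtac.
have mI : cmeas (ift (m1 \x m2)%E pairing_prod v).
  rewrite (_ : ift _ _ _ = (fun z => ift m2 p2 (fun l => H (l, z.1)) z.2)); last first.
    by apply/funext => -[x y]; exact: HE.
  apply: (@cmeas_slice _ _ _ _ _ m2
    (fun z : (T1 * T2) * T2 => expi (p2 z.2 z.1.2) * H (z.2, z.1.1))).
  apply: cmeasM; first apply: cmeas_expi.
    by apply: measurable_pairing_comp => //; mtac.
  by apply: (cmeas_comp _ mH); mtac.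
suff : {ae m1, forall x, {ae m2, forall y,
    ift (m1 \x m2)%E pairing_prod v (x, y) - (C1 * C2)%:C * u (x, y) = 0}}.
  move=> h3.
  have : {ae (m1 \x m2)%E, forall z, ift (m1 \x m2)%E pairing_prod v z - (C1 * C2)%:C * u z = 0}.
    apply/(ae_prodP _ _ (F := fun z => ift (m1 \x m2)%E pairing_prod v z - (C1 * C2)%:C * u z)) => //.
    by apply: cmeasD => //; apply: cmeasN; apply: cmeasM => //; exact: cmeas_cst.
  by apply: filterS => z /eqP; rewrite subr_eq0 => /eqP.
apply: filterS2 h2 (ae_cintegrable1 iu) => x hx iux.
have UE : {ae m2, forall l, ft m2 p2 (fun y => u (x, y)) l = C1%:C^-1 * H (l, x)}.
  apply: filterS hx => l /eqP; rewrite subr_eq0 => /eqP ->.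
  by rewrite mulrA mulVf// mul1r.
have mft : cmeas (ft m2 p2 (fun y => u (x, y))).
  by apply: cmeas_ft => //; exact: cintegrable_cmeas iux.
have ift' : cintegrable m2 (ft m2 p2 (fun y => u (x, y))).
  apply: (@ae_cintegrable _ _ _ _ (fun l => C1%:C^-1 * H (l, x))) => //.
    by apply: filterS UE => l ->.
  exact: cintegrableZ.
apply: filterS (inv2 iux ift') => y.
have mH' : cmeas (fun l => C1%:C^-1 * H (l, x)) := cmeasM (cmeas_cst T2 C1%:C^-1) (mHx x).
have E := ae_eq_ift mp2 y mft mH' UE.
rewrite HE E iftZ// => /(congr1 (fun z => C1%:C * z)).
rewrite mulrA divff// mul1r => ->.
by rewrite rmorphM mulrA subrr.
Qed.

End inversion_product.

(** * Fourier inversion on R^n and on phase space *)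

Section inversion_rV.
Variable R : realType.
Local Notation leb := (@lebesgue_measure R).

Lemma measurable_dot_pairing n : measurable_pairing (@dot R n).
Proof. by rewrite /measurable_pairing; mtac. Qed.

Lemma fourier_inversion_mpres d1 d2 (T1 : measurableType d1) (T2 : measurableType d2)
    (m1 : {measure set T1 -> \bar R})
    (m2 : {measure set T2 -> \bar R}) (p1 : T1 -> T1 -> R) (p2 : T2 -> T2 -> R)
    (C : R) (Phi : T1 -> T2) (Psi : T2 -> T1) :
  measurable_pairing p2 ->
  mpres m1 m2 Phi -> mpres m2 m1 Psi -> cancel Psi Phi ->
  (forall k x, p2 (Phi k) (Phi x) = p1 k x) ->
  fourier_inversion m1 p1 C -> fourier_inversion m2 p2 C.
Proof.
move=> mp2 mPhi mPsi PsiK pE inv u iu iv.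
have mu_ := cintegrable_cmeas iu; have mv := cintegrable_cmeas iv.
have iuP : cintegrable m1 (fun x => u (Phi x)) by apply/(cintegrable_mpres mPhi).
have ftE k : ft m1 p1 (fun x => u (Phi x)) k = ft m2 p2 u (Phi k).
  rewrite /ft (cintegral_mpres mPhi).
    by congr cintegral; apply/funext => x; rewrite pE.
  by apply: cintegrable_expi => //; apply: measurable_funN; exact: (measurable_fun_pair2 (Phi k) mp2).
have ivP : cintegrable m1 (ft m1 p1 (fun x => u (Phi x))).
  rewrite (_ : ft _ _ _ = (fun k => ft m2 p2 u (Phi k))); last by apply/funext => k.
  exact/(cintegrable_mpres mPhi).
have := ae_mpres mPsi (inv _ iuP ivP); apply: filterS => x.
rewrite PsiK => <-.
rewrite (_ : ft m1 _ _ = (fun k => ft m2 p2 u (Phi k))); last by apply/funext => k.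
rewrite /ift (cintegral_mpres mPhi).
  by congr cintegral; apply/funext => k; rewrite -{1}(PsiK x) pE.
by apply: cintegrable_expi => //; exact: (measurable_fun_pair1 x mp2).
Qed.

Theorem rV_fourier_inversion n :
  fourier_inversion (lebesgue_rV R n) (@dot R n) ((2 * pi) ^+ n).
Proof.
have pi0 : 2 * pi != 0 :> R by rewrite gt_eqF// mulr_gt0// pi_gt0.
elim: n => [|n IH].
  move=> u iu iv; apply: aeW => x.
  (* In dimension 0 the measure is the unit mass at the only point, and an integral is an
     evaluation. *)
  have e1 (g : 'rV[R]_0 -> R) (F : 'rV[R]_0 -> R[i]) :
      g = (fun=> 0) -> cintegral (lebesgue_rV R 0) (fun x => expi (g x) * F x) = F 0.
    move=> ->; rewrite (_ : (fun x => _) = (fun=> F 0)); last first.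
      by apply/funext => y; rewrite expi0 mul1r (rV0_eq y 0).
    rewrite /cintegral /Rintegral !integral_dirac// !diracE mem_set// !mul1e.
    by case: (F 0).
  rewrite expr0 mul1r /ift e1; last first.
    by apply/funext => k; rewrite (rV0_eq x 0) dot0r.
  rewrite /ft e1; last by apply/funext => k; rewrite (rV0_eq k 0) dot0r oppr0.
  by rewrite (rV0_eq x 0).
have mpd := @measurable_dot_pairing n.+1.
have pE (k x : measurableTypeR R * 'rV[R]_n) : dot (rV_cons k) (rV_cons x) =
    pairing_prod (@line_pairing R) (@dot R n) k x.
  by case: k => a v; case: x => b w; rewrite dot_cons.
apply: (@fourier_inversion_mpres _ _ _ _ (leb \x lebesgue_rV R n)%E (lebesgue_rV R n.+1)
  (pairing_prod (@line_pairing R) (@dot R n)) (@dot R n.+1) _ (@rV_cons R n)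
  (@rV_uncons R n) mpd (mpres_rV_cons R n) (mpres_rV_uncons R n) (@rV_unconsK R n) pE).
rewrite exprS; apply: fourier_inversion_prod => //.
- exact: measurable_line_pairing.
- exact: measurable_dot_pairing.
- exact: lebesgue_fourier_inversion.
Qed.

Definition dot2 n (k x : 'rV[R]_n * 'rV[R]_n) : R := dot k.1 x.1 + dot k.2 x.2.

Theorem rV2_fourier_inversion n :
  fourier_inversion (lebesgue_rV2 R n) (@dot2 n) ((2 * pi) ^+ (2 * n)).
Proof.
rewrite mul2n -addnn exprD.
apply: fourier_inversion_prod => //; try exact: measurable_dot_pairing.
- by rewrite gt_eqF// exprn_gt0// mulr_gt0// pi_gt0.
- exact: rV_fourier_inversion.
- exact: rV_fourier_inversion.
Qed.

End inversion_rV.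

(** * Functions equal to their Fourier integral *)

Section regular_functions.
Variables (R : realType) (n : nat).
Local Notation V := 'rV[R]_n.
Local Notation mu := (lebesgue_rV R n).
Implicit Types (u v : V -> R[i]) (x k q s : V).

Definition dotE := (@dotDl R n, @dotDr R n, @dotNl R n, @dotNr R n, @dotZl R n, @dotZr R n,
  @dot0l R n, @dot0r R n).

Let mp := @measurable_dot_pairing R n.
Let pC := @dotC R n.
Local Notation ift := (ift mu (@dot R n)).

Lemma fourierE u : fourier u = ft mu (@dot R n) u. Proof. by []. Qed.

Lemma cmeas_fourier u : cmeas u -> cmeas (fourier u).
Proof. by move=> mu_; rewrite fourierE; exact: (cmeas_ft _ mp). Qed.

Definition fconst : R[i] := (((2 * pi) ^+ n)^-1)%:C.

Lemma twopi_gt0 : 0 < 2 * pi :> R. Proof. by rewrite mulr_gt0// pi_gt0. Qed.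

Lemma twopin_neq0 : (2 * pi) ^+ n != 0 :> R.
Proof. by rewrite gt_eqF// exprn_gt0// twopi_gt0. Qed.

Lemma fconstK : fconst * ((2 * pi) ^+ n)%:C = 1.
Proof. by rewrite -rmorphM /= mulVf ?twopin_neq0. Qed.

Lemma fconst_neq0 : fconst != 0.
Proof.
by apply/eqP => /(congr1 (@complex.Re R)) /= /eqP; rewrite invr_eq0 (negbTE twopin_neq0).
Qed.

Lemma conj_fconst : fconst^*%C = fconst.
Proof. by apply: complex_eqP; rewrite ?Re_conjc ?Im_conjc //= oppr0. Qed.

Definition inv_fourier (v : V -> R[i]) x := fconst * ift v x.

(* [u] coincides everywhere, not just almost everywhere, with the absolutely
   convergent Fourier integral of its Fourier transform. *)
Definition regular u := fourier_integrable u /\ forall x, u x = inv_fourier (fourier u) x.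

Lemma ae_inv_fourier u : fourier_integrable u ->
  {ae mu, forall x, inv_fourier (fourier u) x = u x}.
Proof.
move=> [iu iv]; have := @rV_fourier_inversion R n _ iu iv; apply: filterS => x.
by rewrite /inv_fourier => ->; rewrite mulrA fconstK mul1r.
Qed.

Lemma fourier_ift v : cintegrable mu v -> cintegrable mu (ift v) ->
  {ae mu, forall k, fourier (ift v) k = ((2 * pi) ^+ n)%:C * v k}.
Proof.
exact: (ft_ift mp pC (@rV_fourier_inversion R n)).
Qed.

(** Inversion in the opposite order recovers v as the transform of u up to a null set, which the
    inversion integral ignores. A representation by any integrable v therefore suffices for
    regularity. *)
Lemma regular_inv_fourier v u : cintegrable mu v -> cintegrable mu u ->
  (forall x, u x = inv_fourier v x) ->
  regular u /\ {ae mu, forall k, fourier u k = v k}.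
Proof.
move=> iv iu uE.
have uE' : u = fun x => fconst * ift v x by apply/funext.
have iI : cintegrable mu (ift v).
  rewrite (_ : ift v = fun x => ((2 * pi) ^+ n)%:C * u x); first exact: cintegrableZ.
  by apply/funext => x; rewrite uE /inv_fourier mulrA (mulrC _ fconst) fconstK mul1r.
have fE : {ae mu, forall k, fourier u k = v k}.
  apply: filterS (fourier_ift iv iI) => k E.
  by rewrite uE' fourierE (ftZ mp)// -fourierE E mulrA fconstK mul1r.
have mv := cintegrable_cmeas iv.
have mf : cmeas (fourier u) by apply: cmeas_fourier; exact: cintegrable_cmeas iu.
split=> //; split; first split=> //.
  apply: (ae_cintegrable mf _ iv).
  by apply: filterS fE => k ->.
by move=> x; rewrite uE /inv_fourier (ae_eq_ift mp x mf mv fE).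
Qed.

Lemma regular_cintegrable u : regular u -> cintegrable mu u. Proof. by case=> -[]. Qed.
Lemma regular_fourier u : regular u -> cintegrable mu (fourier u). Proof. by case=> -[]. Qed.
Lemma regular_cmeas u : regular u -> cmeas u.
Proof. by move=> /regular_cintegrable/cintegrable_cmeas. Qed.

Lemma regular_bounded u : regular u -> exists B, forall x, cabs (u x) <= B.
Proof.
move=> [[iu iv] uE]; exists (cabs fconst * (2 * \int[mu]_k cabs (fourier u k))) => x.
rewrite uE (le_trans (cabsM _ _))// ler_wpM2l ?cabs_ge0//.
exact: cabs_ift.
Qed.

(** The Fourier transform ignores null sets, so here it is identically 0, and u is its Fourier
    integral at every point. *)
Lemma regular_eq0 u : regular u -> {ae mu, forall x, u x = 0} -> forall x, u x = 0.
Proof.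
move=> ru u0 x; have [_ ->] := ru; rewrite /inv_fourier.
have m0 : cmeas (fun _ : V => 0 : R[i]) by exact: cmeas_cst.
rewrite (_ : fourier u = fun=> 0).
  by rewrite /ift; under eq_fun do rewrite mulr0; rewrite cintegral0 mulr0.
apply/funext => k; rewrite fourierE (ae_eq_ft mp k _ m0 u0); last exact: regular_cmeas.
by rewrite /ft; under eq_fun do rewrite mulr0; rewrite cintegral0.
Qed.

Lemma regular_sum I (r : seq I) (c : I -> R[i]) (u : I -> V -> R[i]) :
  (forall i, regular (u i)) -> regular (fun x => \sum_(i <- r) c i * u i x).
Proof.
move=> ru.
have iu i : cintegrable mu (fun x => c i * u i x).
  by apply: cintegrableZ; exact: regular_cintegrable.
have fE : fourier (fun x => \sum_(i <- r) c i * u i x) =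
    fun k => \sum_(i <- r) c i * fourier (u i) k.
  apply/funext => k; rewrite fourierE (ft_sum mp)//; apply: eq_bigr => i _.
  by rewrite (ftZ mp)//; exact: regular_cintegrable.
split; first split.
- exact: cintegrable_sum.
- by rewrite fE; apply: cintegrable_sum => i; apply: cintegrableZ; exact: regular_fourier.
- move=> x; rewrite fE /inv_fourier (ift_sum mp); last first.
    by move=> i; apply: cintegrableZ; exact: regular_fourier.
  rewrite mulr_sumr; apply: eq_bigr => i _.
  rewrite (iftZ mp); last exact: regular_fourier.
  by have [_ ->] := ru i; rewrite /inv_fourier; ring.
Qed.

Lemma regularZ c u : regular u -> regular (fun x => c * u x).
Proof.
move=> ru; have := @regular_sum unit [:: tt] (fun=> c) (fun=> u) (fun=> ru).
rewrite (_ : (fun x => \sum_(i <- _) _) = (fun x => c * u x))//.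
by apply/funext => x; rewrite big_cons big_nil addr0.
Qed.

Lemma fourierZ c u k : cintegrable mu u -> fourier (fun x => c * u x) k = c * fourier u k.
Proof. by move=> iu; rewrite fourierE (ftZ mp). Qed.

Lemma cintegrable_shift v s : cintegrable mu v -> cintegrable mu (fun x => v (x + s)).
Proof.
move=> iv.
exact: ((cintegrable_mpres (mpres_rVD s) (cintegrable_cmeas iv)).1 iv).
Qed.

Lemma cintegral_shift v s : cintegrable mu v ->
  cintegral mu (fun x => v (x + s)) = cintegral mu v.
Proof. by move=> iv; rewrite (cintegral_mpres (mpres_rVD s) iv). Qed.

Lemma fourier_shift u s k : cintegrable mu u ->
  fourier (fun x => u (x + s)) k = expi (dot k s) * fourier u k.
Proof.
move=> iu; rewrite /fourier -cintegralZ; last exact: (cintegrable_ft mp).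
rewrite -[in RHS](cintegral_shift s) /=.
  congr cintegral; apply/funext => x; rewrite mulrA -expiD; congr (expi _ * _).
  by rewrite !dotE; ring.
by apply: cintegrableZ; exact: (cintegrable_ft mp).
Qed.

Lemma fourier_modulation u q k :
  fourier (fun x => expi (dot q x) * u x) k = fourier u (k - q).
Proof.
congr cintegral; apply/funext => x; rewrite mulrA -expiD; congr (expi _ * _).
by rewrite !dotE; ring.
Qed.

Lemma fourier_conj u k : cintegrable mu u ->
  fourier (fun x => (u x)^*%C) k = (fourier u (- k))^*%C.
Proof.
move=> iu; rewrite fourierE (ft_conj mp pC)//; congr (_^*%C).
by congr cintegral; apply/funext => x; rewrite dotNl opprK pC.
Qed.

Lemma measurable_dotl k : measurable_fun setT (dot k).
Proof. exact: (measurable_pairingl mp). Qed.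
Lemma measurable_dotr k : measurable_fun setT (fun x => dot x k).
Proof. exact: (measurable_pairingr mp). Qed.

Lemma regular_shift u s : regular u -> regular (fun x => u (x + s)).
Proof.
move=> ru; have iu := regular_cintegrable ru; have iv := regular_fourier ru.
have fE : fourier (fun x => u (x + s)) = fun k => expi (dot k s) * fourier u k.
  by apply/funext => k; exact: fourier_shift.
split; first split.
- exact: cintegrable_shift.
- by rewrite fE; apply: cintegrable_expi => //; exact: measurable_dotr.
- move=> x; have [_ ->] := ru; rewrite fE; congr (_ * _); congr cintegral.
  apply/funext => k; rewrite mulrA -expiD; congr (expi _ * _).
  by rewrite !dotE.
Qed.

Lemma regular_modulation u q : regular u -> regular (fun x => expi (dot q x) * u x).
Proof.
move=> ru; have iu := regular_cintegrable ru; have iv := regular_fourier ru.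
have fE : fourier (fun x => expi (dot q x) * u x) = fun k => fourier u (k - q).
  by apply/funext => k; exact: fourier_modulation.
split; first split.
- by apply: cintegrable_expi => //; exact: measurable_dotl.
- by rewrite fE; exact: cintegrable_shift.
- move=> x; have [_ {1}->] := ru; rewrite fE /inv_fourier mulrCA; congr (_ * _).
  rewrite /ift -[in RHS](cintegral_shift q); last first.
    apply: cintegrable_expi; [exact: measurable_dotr|exact: cintegrable_shift].
  rewrite -cintegralZ; last exact: (cintegrable_ift mp).
  congr cintegral; apply/funext => k; rewrite mulrA -expiD addrK; congr (expi _ * _).
  by rewrite !dotE addrC.
Qed.

Lemma regular_conj u : regular u -> regular (fun x => (u x)^*%C).
Proof.
move=> ru; have iu := regular_cintegrable ru; have iv := regular_fourier ru.
have fE : fourier (fun x => (u x)^*%C) = fun k => (fourier u (- k))^*%C.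
  by apply/funext => k; exact: fourier_conj.
have iN : cintegrable mu (fun k => fourier u (- k)).
  exact: ((cintegrable_mpres (mpres_rVN R n) (cintegrable_cmeas iv)).1 iv).
split; first split.
- exact: cintegrable_conj.
- by rewrite fE; exact: cintegrable_conj.
- move=> x; have [_ ->] := ru; rewrite fE /inv_fourier conjcM conj_fconst.
  have E : ft mu (@dot R n) (fun k => fourier u (- k)) x = ift (fourier u) x.
    rewrite [RHS](cintegral_mpres (mpres_rVN R n)); last exact: (cintegrable_ift mp).
    by congr cintegral; apply/funext => k; rewrite dotNl pC.
  by rewrite (ift_conj mp pC x iN) E.
Qed.

Lemma cintegrable_convolution (v w : V -> R[i]) :
  cintegrable mu v -> cintegrable mu w ->
  cintegrable (mu \x mu)%E (fun z => v z.2 * w (z.1 - z.2)).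
Proof.
move=> iv iw.
have msh : mpres (mu \x mu)%E (mu \x mu)%E (fun z : V * V => (z.1, z.2 - z.1)).
  apply: mpres_shear; first by mtac.
  by move=> x; exact: (mpres_rVD (- x)).
have := cintegrable_swap ((cintegrable_mpres msh _).1 (cintegrable_tensor iv iw)).
apply; apply: cmeas_tensor; [exact: cintegrable_cmeas iv|exact: cintegrable_cmeas iw].
Qed.

(** Inserting the Fourier integral of u into the transform of u v and exchanging integrals produces
    the convolution of the transforms. That is integrable, and after a translation its own Fourier
    integral factors into those of u and v. *)
Lemma regularM u v : regular u -> regular v -> regular (fun x => u x * v x) /\
  forall q, fourier (fun x => u x * v x) q =
    fconst * cintegral mu (fun k => fourier u k * fourier v (q - k)).
Proof.
move=> ru rv; have iu := regular_cintegrable ru; have iv := regular_cintegrable rv.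
have ifu := regular_fourier ru; have ifv := regular_fourier rv.
have [B uB] := regular_bounded ru.
have iuv : cintegrable mu (fun x => u x * v x).
  exact: (cintegrable_bmul (regular_cmeas ru) uB).
have fE q : fourier (fun x => u x * v x) q =
    fconst * cintegral mu (fun k => fourier u k * fourier v (q - k)).
  have iF : cintegrable (mu \x mu)%E
      (fun z : V * V => expi (dot z.2 z.1 - dot q z.1) * (v z.1 * fourier u z.2)).
    by apply: cintegrable_expi; [mtac|exact: cintegrable_tensor].
  transitivity (fconst * cintegral mu (fun x => cintegral mu (fun k =>
      expi (dot k x - dot q x) * (v x * fourier u k)))).
    rewrite /fourier -cintegralZ; last exact: (cintegrable_slice iF).
    congr cintegral; apply/funext => x; have [_ ->] := ru; rewrite /inv_fourier.
    have -> : cintegral mu (fun k => expi (dot k x - dot q x) * (v x * fourier u k)) =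
        (expi (- dot q x) * v x) * ift (fourier u) x.
      rewrite /ift -cintegralZ; last exact: (cintegrable_ift mp).
      by congr cintegral; apply/funext => k; rewrite expiD; ring.
    ring.
  rewrite (cintegral_swap iF) /=; congr (_ * _); congr cintegral; apply/funext => k.
  rewrite /fourier -cintegralZ; last exact: (cintegrable_ft mp).
  congr cintegral; apply/funext => x; rewrite (_ : - dot (q - k) x = dot k x - dot q x).
    by ring.
  by rewrite !dotE; ring.
have iconv := cintegrable_convolution ifu ifv.
have fE' : fourier (fun x => u x * v x) = fun q => fconst *
    cintegral mu (fun k => fourier u k * fourier v (q - k)) by exact/funext.
split; last exact: fE.
split; first split; first exact: iuv.
  rewrite fE'; apply: cintegrableZ; exact: (cintegrable_slice iconv).
move=> x; have [_ ->] := ru; have [_ ->] := rv; rewrite fE' /inv_fourier.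
rewrite (iftZ mp); last exact: (cintegrable_slice iconv).
have -> : ift (fun q => cintegral mu (fun k => fourier u k * fourier v (q - k))) x =
    cintegral (mu \x mu)%E (fun z => expi (dot z.1 x) * (fourier u z.2 * fourier v (z.1 - z.2))).
  exact/esym/(cintegral_fubini_expi1 iconv (measurable_dotr x)).
suff -> : cintegral (mu \x mu)%E (fun z => expi (dot z.1 x) *
    (fourier u z.2 * fourier v (z.1 - z.2))) = ift (fourier u) x * ift (fourier v) x.
  by move: (ift _ x) (ift _ x) => a b; ring.
have iexp : cintegrable (mu \x mu)%E (fun z : V * V =>
    expi (dot z.1 x) * (fourier u z.2 * fourier v (z.1 - z.2))).
  by apply: cintegrable_expi => //; mtac.
rewrite cintegral_fubini// (cintegral_swap iexp) /=.
rewrite /ift -cintegralZr; last exact: (cintegrable_ift mp).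
congr cintegral; apply/funext => k.
have iq : cintegrable mu (fun q => expi (dot q x) * (fourier u k * fourier v (q - k))).
  apply: cintegrable_expi; first exact: measurable_dotr.
  by apply: cintegrableZ; exact: (cintegrable_shift (- k) ifv).
rewrite -[LHS](cintegral_shift k iq) /= -cintegralZ; last exact: (cintegrable_ift mp).
by congr cintegral; apply/funext => q; rewrite addrK dotDl expiD; ring.
Qed.

(** The conjugate of [fourier v] is the inverse transform of the conjugate of v; the multiplication
    formula moves this inverse transform onto [fourier u], where inversion yields u. *)
Lemma plancherel u v : fourier_integrable u -> cintegrable mu v ->
  cintegral mu (fun k => fourier u k * (fourier v k)^*%C) =
  ((2 * pi) ^+ n)%:C * cintegral mu (fun x => u x * (v x)^*%C).
Proof.
move=> fu iv; have [iu ifu] := fu; have icv := cintegrable_conj iv.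
rewrite (_ : (fun k => _) = (fun k => fourier u k * ift (fun x => (v x)^*%C) k)); last first.
  by apply/funext => k; rewrite (ift_conj mp pC).
rewrite -(iftM mp pC)//.
have m1 : cmeas (ift (fourier u)) by apply: (cmeas_ift _ mp pC); exact: cintegrable_cmeas ifu.
have b1 x : cabs (ift (fourier u) x) <= 2 * \int[mu]_k cabs (fourier u k) by exact: cabs_ift.
have E : {ae mu, forall x, ift (fourier u) x = ((2 * pi) ^+ n)%:C * u x}.
  exact: rV_fourier_inversion.
have mu_ := cintegrable_cmeas iu; have mv := cintegrable_cmeas icv.
have mc : cmeas (fun _ : V => ((2 * pi) ^+ n)%:C : R[i]) by exact: cmeas_cst.
transitivity (cintegral mu (fun x => ((2 * pi) ^+ n)%:C * (u x * (v x)^*%C))).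
  apply: ae_eq_cintegral; [exact: cmeasM|by apply: cmeasM => //; exact: cmeasM|].
  by apply: filterS E => x ->; ring.
rewrite cintegralZ//.
(* The product of u with the conjugate of v agrees almost everywhere with this one, a bounded
   function times an integrable one. *)
have i1 : cintegrable mu (fun x => fconst * (ift (fourier u) x * (v x)^*%C)).
  by apply: cintegrableZ; exact: (cintegrable_bmul m1 b1).
apply: (ae_cintegrable _ _ i1); first exact: cmeasM.
by apply: filterS E => x ->; rewrite !mulrA fconstK mul1r.
Qed.

End regular_functions.

Lemma cintegral_tensor d1 d2 (T1 : measurableType d1) (T2 : measurableType d2)
    (R : realType) (m1 : {sigma_finite_measure set T1 -> \bar R})
    (m2 : {sigma_finite_measure set T2 -> \bar R}) (g : T1 -> R[i]) (h : T2 -> R[i]) :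
  cintegrable m1 g -> cintegrable m2 h ->
  cintegral (m1 \x m2)%E (fun z => g z.1 * h z.2) = cintegral m1 g * cintegral m2 h.
Proof.
move=> ig ih; rewrite (cintegral_fubini (cintegrable_tensor ig ih)) /=.
by rewrite -cintegralZr//; congr cintegral; apply/funext => x; rewrite cintegralZ.
Qed.

(** * A nowhere vanishing regular function *)

Section test_function.
Variable R : realType.
Local Notation leb := (@lebesgue_measure R).

Lemma cintegrable_cauchy : cintegrable leb (fun x => (2 * 1 / (1 ^+ 2 + x ^+ 2))%:C).
Proof.
have d0 (x : R) : 1 ^+ 2 + x ^+ 2 != 0 by rewrite gt_eqF// ltr_pwDl ?exprn_gt0 ?sqr_ge0.
have f0 (x : R) : 0 <= 2 * 1 / (1 ^+ 2 + x ^+ 2).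
  by rewrite divr_ge0// addr_ge0 ?sqr_ge0.
pose F (x : R) := 2 * atan x.
have dF x : is_derive x (1 : R) F (2 * 1 / (1 ^+ 2 + x ^+ 2)).
  have h3 := is_deriveM (is_derive_cst (2 : R) x (1 : R)) (is_derive1_atan x).
  apply: (is_derive_eq h3); rewrite /GRing.scale /= /cst mulr0 addr0.
  by rewrite mulr1 expr1n.
have cf : continuous (fun x : R => 2 * 1 / (1 ^+ 2 + x ^+ 2)).
  move=> x; apply: cvgM; first exact: cvg_cst.
  apply: cvgV => //; apply: cvgD; first exact: cvg_cst.
  exact: exprn_continuous.
split; last exact: integrable0.
apply/integrableP; split.
  by apply/measurable_EFinP; apply: continuous_measurable_fun.
under eq_integral do rewrite gee0_abs ?lee_fin//=.
rewrite ge0_symfun_integralT//; last by move=> x /=; rewrite sqrrN.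
rewrite (_ : [set x : R | 0 <= x] = `[0, +oo[%classic); last first.
  by apply/seteqP; split=> x; rewrite /= in_itv /= andbT.
rewrite (@ge0_continuous_FTC2y _ _ F _ pi).
- by rewrite -EFinB -EFinM ltry.
- by move=> x _; exact: f0.
- exact: continuous_subspaceT.
- rewrite (_ : pi = 2 * (pi / 2)); last by field.
  by apply: cvgM; [exact: cvg_cst|exact: cvgy_atan].
- by move=> x _; have [] := dF x.
- apply: cvg_at_right_filter; apply: differentiable_continuous; apply/derivable1_diffP.
  by have [] := dF 0.
- by move=> x _; rewrite derive1E; have [] := dF x.
Qed.

(** In each coordinate the pair is exp(-|k|) and its transform 2 / (1 + x^2), positive and
    integrable; products over the coordinates keep these properties. *)
Lemma positive_fourier_pair n : exists v : 'rV[R]_n -> R[i],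
  [/\ cintegrable (lebesgue_rV R n) v,
      cintegrable (lebesgue_rV R n) (ift (lebesgue_rV R n) (@dot R n) v) &
      forall x, ift (lebesgue_rV R n) (@dot R n) v x != 0].
Proof.
elim: n => [|n [v [iv iI I0]]].
  have e1 (F : 'rV[R]_0 -> R[i]) : cintegral (lebesgue_rV R 0) F = F 0.
    rewrite (_ : F = (fun=> F 0)); last first.
      by apply/funext => y; rewrite (rV0_eq y 0).
    rewrite /cintegral /Rintegral !integral_dirac// !diracE mem_set// !mul1e.
    by case: (F 0).
  have i1 : cintegrable (lebesgue_rV R 0) (fun=> 1 : R[i]).
    have h (c : R) : (\d_(0 : 'rV[R]_0)).-integrable setT (fun=> c%:E).
      apply/integrableP; split => //.
      by rewrite integral_dirac// diracE mem_set// mul1e ltry.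
    by split => /=; exact: h.
  have E : ift (lebesgue_rV R 0) (@dot R 0) (fun=> 1) = fun=> 1.
    by apply/funext => x; rewrite /ift e1 dot0l expi0 mul1r.
  by exists (fun=> 1); rewrite E; split=> //; move=> _; exact: oner_neq0.
pose g (x : measurableTypeR R) : R[i] := (2 * 1 / (1 ^+ 2 + x ^+ 2))%:C.
pose p (x : measurableTypeR R) : R[i] := (pk 1 x)%:C.
have ip : cintegrable leb p by exact: cintegrable_pk.
have ig : cintegrable leb g by exact: cintegrable_cauchy.
have mc (h : measurableTypeR R -> R[i]) (w : 'rV[R]_n -> R[i]) : cintegrable leb h ->
    cintegrable (lebesgue_rV R n) w ->
    cintegrable (lebesgue_rV R n.+1) (fun x => h (rV_uncons x).1 * w (rV_uncons x).2).
  move=> ih iw; have it := cintegrable_tensor ih iw.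
  exact: ((cintegrable_mpres (mpres_rV_uncons R n) (cintegrable_cmeas it)).1 it).
pose v' (x : 'rV[R]_n.+1) := p (rV_uncons x).1 * v (rV_uncons x).2.
have iv' : cintegrable (lebesgue_rV R n.+1) v' by exact: mc.
have E : ift (lebesgue_rV R n.+1) (@dot R n.+1) v' =
    fun x => g (rV_uncons x).1 * ift (lebesgue_rV R n) (@dot R n) v (rV_uncons x).2.
  apply/funext => x; rewrite -{1}(rV_unconsK x); case: (rV_uncons x) => a y /=.
  rewrite /ift (cintegral_mpres (mpres_rV_cons R n)); last first.
    by apply: cintegrable_expi => //; exact: measurable_dotr.
  have ma : measurable_fun [set: measurableTypeR R] (fun k : measurableTypeR R => a * k).
    by apply: measurable_funM => //; exact: measurable_id.
  have -> : g a = cintegral leb (fun k => expi (a * k) * p k).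
    by rewrite /g -(poisson_kernel a (@ltr01 R)).
  rewrite -cintegral_tensor.
  - congr cintegral; apply/funext => -[b w].
    rewrite dot_cons /v' rV_consK /= expiD (mulrC b a) /p.
    by ring.
  - exact: cintegrable_expi.
  - by apply: cintegrable_expi => //; exact: measurable_dotr.
exists v'; rewrite E; split=> //; first exact: mc.
move=> x; apply: mulf_neq0 => //.
apply/eqP => /(congr1 (@complex.Re R)) /= /eqP.
by rewrite gt_eqF// divr_gt0// ltr_pwDl ?exprn_gt0 ?sqr_ge0.
Qed.

(** Multiplying an unknown integrable function by [gam] keeps it integrable and hides none of its
    nonzero values; [gam] also witnesses that the whole space is not a null set. *)
Lemma regular_test_function n : exists gam : 'rV[R]_n -> R[i],
  regular gam /\ forall x, gam x != 0.
Proof.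
have [v [iv iI I0]] := positive_fourier_pair n.
exists (inv_fourier v); split.
  by apply: (regular_inv_fourier iv _ _).1 => //; exact: cintegrableZ.
by move=> x; rewrite mulf_neq0// fconst_neq0.
Qed.

End test_function.

(** * Weyl operators *)

Section weyl_operators.
Variables (R : realType) (n : nat) (theta : 'M[R]_n).
Hypothesis thetaA : trmx theta = - theta.
Local Notation V := 'rV[R]_n.
Local Notation mu := (lebesgue_rV R n).
Local Notation mu2 := (lebesgue_rV2 R n).
Local Notation fconst := (@fconst R n).
Implicit Types (u v : V -> R[i]) (x q : V) (z : V * V) (alpha : V * V -> R[i]).

Let mp := @measurable_dot_pairing R n.
Let pC := @dotC R n.

Definition zadd z z' : V * V := (z.1 + z'.1, z.2 + z'.2).
Definition zopp z : V * V := (- z.1, - z.2).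
Definition zsub z z' : V * V := (z.1 - z'.1, z.2 - z'.2).

(** Left star multiplication by e^(ik.x) translates the other factor by -k theta/2, as
    [star_theta_ift] shows; here this is joined to the translation by l. The phase k.l/2 in [wphase]
    is the symmetric ordering, under which W_z and W_(-z) are adjoint. *)
Definition wshift z : V := z.2 - 2^-1 *: (z.1 *m theta).
Definition wphase z x : R := dot z.1 z.2 / 2 + dot z.1 x.

(* The Weyl operators of the deformed phase space; [weyl_comp] is their
   projective composition law, with the cocycle of the star product. *)
Definition weyl z u x : R[i] := expi (wphase z x) * u (x + wshift z).

Definition cocycle z z' : R :=
  (dot z'.1 z.2 - dot z.1 z'.2) / 2 - form theta z.1 z'.1 / 2.

Lemma weyl_comp z z' u x :
  weyl z (weyl z' u) x = expi (cocycle z z') * weyl (zadd z z') u x.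
Proof.
rewrite /weyl /wphase /wshift /cocycle /zadd /= !mulrA -!expiD; congr (expi _ * u _).
  rewrite -dot_mulmx !dotE (dotC z'.1 (z.1 *m theta)).
  by field.
by rewrite mulmxDl scalerDr opprD -!addrA; congr (_ + (_ + _)); rewrite addrCA.
Qed.

Lemma measurable_cocycle d (T : measurableType d) (f g : T -> V * V) :
  measurable_fun setT f -> measurable_fun setT g ->
  measurable_fun setT (fun t => cocycle (f t) (g t)).
Proof.
move=> mf mg.
rewrite (_ : (fun t => _) = (fun t => (dot (g t).1 (f t).2 - dot (f t).1 (g t).2) / 2 -
    dot ((f t).1 *m theta) (g t).1 / 2)); first by mtac.
by apply/funext => t; rewrite /cocycle dot_mulmx.
Qed.

Lemma measurable_wshift : measurable_fun setT wshift.
Proof. by rewrite /wshift; mtac. Qed.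

(** By antisymmetry of theta, k is orthogonal to k theta. *)
Lemma dot_wshift z : dot z.1 (wshift z) = dot z.1 z.2.
Proof. by rewrite /wshift !dotE (dotC z.1 (_ *m _)) dot_mulmx0// mulr0 subr0. Qed.

Lemma mpres_wshear : mpres mu2 mu2 (fun z => (z.1, wshift z)).
Proof.
apply: (@mpres_shear _ _ _ _ _ _ _ mu mu mu wshift); first exact: measurable_wshift.
by move=> k; exact: (mpres_rVD (- (2^-1 *: (k *m theta)))).
Qed.

Lemma mpres_zopp : mpres mu2 mu2 zopp.
Proof. exact: (mpres_prod (mpres_rVN R n) (mpres_rVN R n)). Qed.

Lemma mpres_zsubr z : mpres mu2 mu2 (fun z' => zsub z' z).
Proof. exact: (mpres_prod (mpres_rVD (- z.1)) (mpres_rVD (- z.2))). Qed.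

Lemma cmeas_weyl u : cmeas u -> cmeas (fun w : (V * V) * V => weyl w.1 u w.2).
Proof.
move=> mu_; apply: cmeasM.
  by apply: cmeas_expi; rewrite /wphase; mtac.
by apply: (cmeas_comp _ mu_); rewrite /wshift; mtac.
Qed.

Lemma cmeas_weyl_comp d (T : measurableType d) (f : T -> V * V) u x :
  measurable_fun setT f -> cmeas u -> cmeas (fun t => weyl (f t) u x).
Proof.
move=> mf mu_; apply: (cmeas_comp (Phi := fun t => (f t, x)) _ (cmeas_weyl mu_)).
by apply: measurable_fun_pair => //; exact: measurable_cst.
Qed.

Lemma cintegrable_weyl alpha u : cintegrable mu2 alpha -> cintegrable mu u ->
  cintegrable (mu2 \x mu)%E (fun w => alpha w.1 * weyl w.1 u w.2).
Proof.
move=> ia iu.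
have msh : mpres (mu2 \x mu)%E (mu2 \x mu)%E (fun w : (V * V) * V => (w.1, w.2 + wshift w.1)).
  apply: mpres_shear; first by rewrite /wshift; mtac.
  by move=> z; exact: (mpres_rVD (wshift z)).
have it := cintegrable_tensor ia iu.
have := (cintegrable_mpres msh (cintegrable_cmeas it)).1 it.
move=> /= /(cintegrable_expi (f := fun w : (V * V) * V => wphase w.1 w.2)) h.
under eq_fun do rewrite /weyl mulrCA.
by apply: h; rewrite /wphase; mtac.
Qed.

Lemma fourier_weyl z u q : cintegrable mu u ->
  fourier (weyl z u) q =
  expi (dot z.1 z.2 / 2 + dot (q - z.1) (wshift z)) * fourier u (q - z.1).
Proof.
move=> iu; rewrite (_ : weyl z u = fun x => expi (dot z.1 z.2 / 2) *
    (expi (dot z.1 x) * u (x + wshift z))); last first.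
  by apply/funext => x; rewrite /weyl /wphase expiD mulrA.
rewrite fourierZ; last first.
  by apply: cintegrable_expi; [exact: measurable_dotl|exact: cintegrable_shift].
by rewrite fourier_modulation fourier_shift// mulrA -expiD.
Qed.

Lemma regular_weyl z u : regular u -> regular (weyl z u).
Proof.
move=> ru; rewrite (_ : weyl z u = fun x => expi (dot z.1 z.2 / 2) *
    (expi (dot z.1 x) * u (x + wshift z))); last first.
  by apply/funext => x; rewrite /weyl /wphase expiD mulrA.
by apply: regularZ; apply: regular_modulation; exact: regular_shift.
Qed.

Lemma cintegrable_fourier_weyl alpha u : cintegrable mu2 alpha -> regular u ->
  cintegrable (mu2 \x mu)%E (fun w => alpha w.1 * fourier (weyl w.1 u) w.2).
Proof.
move=> ia ru; have iv := regular_fourier ru; have iu := regular_cintegrable ru.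
have msh : mpres (mu2 \x mu)%E (mu2 \x mu)%E (fun w : (V * V) * V => (w.1, w.2 - w.1.1)).
  apply: mpres_shear; first by mtac.
  by move=> z; exact: (mpres_rVD (- z.1)).
have it := cintegrable_tensor ia iv.
have := (cintegrable_mpres msh (cintegrable_cmeas it)).1 it.
move=> /= /(cintegrable_expi (f := fun w : (V * V) * V => dot w.1.1 w.1.2 / 2 + dot (w.2 - w.1.1) (wshift w.1))) h.
under eq_fun do rewrite fourier_weyl// mulrCA.
by apply: h; rewrite /wshift; mtac.
Qed.

Definition wop alpha u x : R[i] := fconst * cintegral mu2 (fun z => alpha z * weyl z u x).

Lemma cintegrable_wop_at alpha u x : cintegrable mu2 alpha -> regular u ->
  cintegrable mu2 (fun z => alpha z * weyl z u x).
Proof.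
move=> ia ru; have [B uB] := regular_bounded ru.
under eq_fun do rewrite mulrC.
apply: (@cintegrable_bmul _ _ _ _ _ _ (2 * B)) => //.
  by apply: cmeas_weyl_comp; [exact: measurable_id|exact: regular_cmeas].
by move=> z; rewrite (le_trans (cabs_expiM _ _))// ler_wpM2l.
Qed.

(** On the Fourier side W_z is a translation times a phase, so alpha(z) times the transform of W_z u
    is jointly integrable. Fubini gives the transform of the average, and a second exchange gives
    its Fourier integral at every x because each W_z u is regular. *)
Lemma regular_wop alpha u : cintegrable mu2 alpha -> regular u -> regular (wop alpha u) /\
  forall q, fourier (wop alpha u) q =
    fconst * cintegral mu2 (fun z => alpha z * fourier (weyl z u) q).
Proof.
move=> ia ru; have iu := regular_cintegrable ru.
have iw := cintegrable_swap (cintegrable_weyl ia iu).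
have ifw := cintegrable_swap (cintegrable_fourier_weyl ia ru).
have iT : cintegrable mu (wop alpha u) by apply: cintegrableZ; exact: (cintegrable_slice iw).
have fE q : fourier (wop alpha u) q =
    fconst * cintegral mu2 (fun z => alpha z * fourier (weyl z u) q).
  rewrite fourierZ; last exact: (cintegrable_slice iw).
  congr (_ * _); have miq : measurable_fun setT (fun x => - dot q x).
    by apply: measurable_funN; exact: measurable_dotl.
  have iew : cintegrable (mu \x mu2)%E (fun w : V * (V * V) =>
      expi (- dot q w.1) * (alpha w.2 * weyl w.2 u w.1)).
    by apply: cintegrable_expi iw; mtac.
  rewrite /fourier -(cintegral_fubini_expi1 iw miq) (cintegral_fubini iew).
  rewrite (cintegral_swap iew) /=; congr cintegral; apply/funext => z.
  rewrite -cintegralZ.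
    by congr cintegral; apply/funext => x; rewrite mulrCA.
  by apply: cintegrable_expi => //; have /regular_cintegrable := regular_weyl z ru.
have ih : cintegrable mu (fun q => fconst * cintegral mu2 (fun z => alpha z * fourier (weyl z u) q)).
  by apply: cintegrableZ; exact: (cintegrable_slice ifw).
have fE' : fourier (wop alpha u) = fun q =>
    fconst * cintegral mu2 (fun z => alpha z * fourier (weyl z u) q) by exact/funext.
split; last exact: fE.
split; first by split; [exact: iT|rewrite fE'; exact: ih].
move=> x; rewrite /inv_fourier fE' (iftZ mp); last exact: (cintegrable_slice ifw).
rewrite /wop; congr (_ * _).
have iew : cintegrable (mu \x mu2)%E (fun w : V * (V * V) =>
    expi (dot w.1 x) * (alpha w.2 * fourier (weyl w.2 u) w.1)).
  by apply: cintegrable_expi ifw; mtac.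
have -> : ift mu (@dot R n) (fun q => cintegral mu2 (fun z => alpha z * fourier (weyl z u) q)) x =
    cintegral mu (fun q => cintegral mu2 (fun z => expi (dot q x) * (alpha z * fourier (weyl z u) q))).
  by rewrite -(cintegral_fubini iew) (cintegral_fubini_expi1 ifw (measurable_dotr x)).
rewrite (cintegral_swap iew) /= -cintegralZ.
  congr cintegral; apply/funext => z; have rz := regular_weyl z ru.
  have [_ ->] := rz; rewrite /inv_fourier mulrCA; congr (_ * _).
  rewrite /ift -cintegralZ; last by apply: (cintegrable_ift mp); exact: regular_fourier.
  by congr cintegral; apply/funext => q; rewrite mulrCA.
exact: (cintegrable_slice (cintegrable_swap iew)).
Qed.

(** The Weyl operators form a projective representation, so composing two averages is twisted
    convolution of their symbols. A shear gathers the double integral by the total displacement z,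
    where the hypothesis replaces the inner integral by K alpha(z). *)
Lemma wop_comp alpha (K : R[i]) u x : cintegrable mu2 alpha -> regular u ->
  {ae mu2, forall z, cintegral mu2 (fun z' =>
     alpha z' * alpha (zsub z z') * expi (cocycle z' (zsub z z'))) = K * alpha z} ->
  wop alpha (wop alpha u) x = fconst * K * wop alpha u x.
Proof.
move=> ia ru tw; have ma := cintegrable_cmeas ia.
have [B uB] := regular_bounded ru.
have mw := cmeas_weyl (regular_cmeas ru).
have B0 : 0 <= B by apply: le_trans (uB 0); exact: cabs_ge0.
pose F (w : (V * V) * (V * V)) :=
  expi (cocycle w.1 w.2) * weyl (zadd w.1 w.2) u x * (alpha w.1 * alpha w.2).
have mco : cmeas (fun w : (V * V) * (V * V) => expi (cocycle w.1 w.2) * weyl (zadd w.1 w.2) u x).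
  apply: cmeasM.
    by apply: cmeas_expi; apply: measurable_cocycle; mtac.
  apply: (cmeas_weyl_comp (f := fun w : (V * V) * (V * V) => zadd w.1 w.2)).
    by rewrite /zadd; mtac.
  exact: regular_cmeas.
have iF : cintegrable (mu2 \x mu2)%E F.
  apply: (@cintegrable_bmul _ _ _ _ _ _ (2 * (2 * B))) => //.
    move=> w; rewrite (le_trans (cabs_expiM _ _))// ler_wpM2l//.
    by rewrite (le_trans (cabs_expiM _ _))// ler_wpM2l.
  exact: (cintegrable_tensor ia ia).
have msh : mpres (mu2 \x mu2)%E (mu2 \x mu2)%E
    (fun w : (V * V) * (V * V) => (w.1, zsub w.2 w.1)).
  apply: mpres_shear; first by rewrite /zsub; mtac.
  by move=> z; exact: mpres_zsubr.
have iF' : cintegrable (mu2 \x mu2)%E (fun w => F (w.1, zsub w.2 w.1)).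
  exact: ((cintegrable_mpres msh (cintegrable_cmeas iF)).1 iF).
have E1 z : weyl z (wop alpha u) x =
    fconst * cintegral mu2 (fun z' => expi (cocycle z z') * weyl (zadd z z') u x * alpha z').
  rewrite -[LHS]/(expi (wphase z x) * wop alpha u (x + wshift z)).
  rewrite /wop mulrCA -(cintegralZ _ (cintegrable_wop_at (x + wshift z) ia ru)).
  congr (_ * _); congr cintegral; apply/funext => z'.
  rewrite -weyl_comp.
  rewrite -[weyl z _ x]/(expi (wphase z x) * weyl z' u (x + wshift z)).
  by ring.
have -> : wop alpha (wop alpha u) x = fconst * fconst * cintegral (mu2 \x mu2)%E F.
  rewrite cintegral_fubini// /wop -mulrA -(cintegralZ fconst (cintegrable_slice iF)).
  congr (_ * _); congr cintegral; apply/funext => z; rewrite E1 mulrCA; congr (_ * _).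
  rewrite -cintegralZ; last first.
    apply: (@cintegrable_bmul _ _ _ _ _ _ (2 * (2 * B))) => //.
      by apply: (cmeas_comp (F := fun w => expi (cocycle w.1 w.2) * weyl (zadd w.1 w.2) u x)
        (Phi := fun z' => (z, z'))) => //; mtac.
    move=> z'; rewrite (le_trans (cabs_expiM _ _))// ler_wpM2l//.
    by rewrite (le_trans (cabs_expiM _ _))// ler_wpM2l.
  by congr cintegral; apply/funext => z'; rewrite /F /=; ring.
rewrite (cintegral_mpres msh iF) cintegral_fubini// (cintegral_swap iF') /=.
(* Its slices, integrable for almost every total displacement, let the factor [weyl z u x] leave the
   inner integral. *)
have itw : cintegrable (mu2 \x mu2)%E (fun w : (V * V) * (V * V) =>
    expi (cocycle w.1 (zsub w.2 w.1)) * (alpha w.1 * alpha (zsub w.2 w.1))).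
  have it := cintegrable_tensor ia ia.
  have := (cintegrable_mpres msh (cintegrable_cmeas it)).1 it.
  apply: cintegrable_expi.
  apply: measurable_cocycle; first by mtac.
  by rewrite /zsub; mtac.
have zK z z' : zadd z (zsub z' z) = z'.
  by case: z z' => [a b] [c e]; rewrite /zadd /zsub /= addrC subrK addrC subrK.
have iT : cintegrable mu2 (fun z => alpha z * weyl z u x) by exact: cintegrable_wop_at.
suff -> : cintegral mu2 (fun y : V * V => cintegral mu2 (fun x0 : V * V => F (x0, zsub y x0))) =
    K * cintegral mu2 (fun z => alpha z * weyl z u x) by rewrite /wop; ring.
rewrite -cintegralZ//; apply: ae_eq_cintegral.
- exact: (cmeas_slice mu2 (cintegrable_cmeas (cintegrable_swap iF'))).
- by apply: cmeasM; [exact: cmeas_cst|exact: cintegrable_cmeas iT].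
apply: filterS2 tw (ae_cintegrable1 (cintegrable_swap itw)) => z tz iz.
rewrite mulrA -tz -cintegralZr.
  by congr cintegral; apply/funext => z'; rewrite /F /= zK; ring.
by move: iz; congr (cintegrable _ _); apply/funext => z' /=; ring.
Qed.

(** Translation by [wshift z] moves the operator to the other factor; the phases match by
    [dot_wshift]. *)
Lemma cintegral_weyl_adjoint z u v : cintegrable mu (fun x => u x * (weyl (zopp z) v x)^*%C) ->
  cintegral mu (fun x => weyl z u x * (v x)^*%C) =
  cintegral mu (fun x => u x * (weyl (zopp z) v x)^*%C).
Proof.
move=> iuv; rewrite -(cintegral_shift (wshift z) iuv).
congr cintegral; apply/funext => x.
rewrite /weyl conjcM conj_expi.
have -> : wshift (zopp z) = - wshift z.
  by rewrite /wshift /zopp /= mulNmx scalerN opprB opprK addrC.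
have -> : wphase z x = - wphase (zopp z) (x + wshift z).
  move: (dot_wshift z); rewrite /wphase /zopp /=.
  by generalize (wshift z) => s; rewrite !dotE => ->; field.
by rewrite addrK; ring.
Qed.

Lemma cintegrable_weyl_conj alpha u v : cintegrable mu2 alpha -> regular u -> regular v ->
  cintegrable (mu \x mu2)%E (fun w => (v w.1)^*%C * (alpha w.2 * weyl w.2 u w.1)).
Proof.
move=> ia ru rv; have iu := regular_cintegrable ru.
have rcv := regular_conj rv; have [B vB] := regular_bounded rcv.
apply: (@cintegrable_bmul _ _ _ _ _ _ B); last exact: (cintegrable_swap (cintegrable_weyl ia iu)).
  exact: (cmeas_comp measurable_fst (regular_cmeas rcv)).
by move=> w; exact: vB.
Qed.

Lemma cintegrable_weyl_ip alpha u v : cintegrable mu2 alpha -> regular u -> regular v ->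
  cintegrable mu2 (fun z => alpha z * cintegral mu (fun x => weyl z u x * (v x)^*%C)).
Proof.
move=> ia ru rv; have iT1 := cintegrable_weyl_conj ia ru rv.
rewrite (_ : (fun z => _) = (fun z => cintegral mu (fun x => (v x)^*%C * (alpha z * weyl z u x)))).
  exact: (cintegrable_slice (cintegrable_swap iT1)).
apply/funext => z; have [E wE] := regular_bounded (regular_weyl z ru).
rewrite -cintegralZ; first by congr cintegral; apply/funext => x; ring.
apply: (cintegrable_bmul _ wE); last by apply: cintegrable_conj; exact: regular_cintegrable.
by apply: regular_cmeas; exact: regular_weyl.
Qed.

Lemma cintegral_wop_conj alpha u v : cintegrable mu2 alpha -> regular u -> regular v ->
  cintegral mu (fun x => wop alpha u x * (v x)^*%C) =
  fconst * cintegral mu2 (fun z => alpha z * cintegral mu (fun x => weyl z u x * (v x)^*%C)).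
Proof.
move=> ia ru rv; have iT1 := cintegrable_weyl_conj ia ru rv.
have iwv z : cintegrable mu (fun x => weyl z u x * (v x)^*%C).
  have [E wE] := regular_bounded (regular_weyl z ru).
  apply: (cintegrable_bmul _ wE); last by apply: cintegrable_conj; exact: regular_cintegrable.
  by apply: regular_cmeas; exact: regular_weyl.
rewrite (_ : (fun x => wop alpha u x * _) = (fun x => fconst *
    cintegral mu2 (fun z => (v x)^*%C * (alpha z * weyl z u x)))).
  rewrite cintegralZ; last exact: (cintegrable_slice iT1).
  rewrite (cintegral_swap iT1); congr (_ * _); congr cintegral; apply/funext => z /=.
  by rewrite -cintegralZ//; congr cintegral; apply/funext => x; ring.
apply/funext => x; rewrite cintegralZ; last exact: cintegrable_wop_at.
by rewrite /wop; ring.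
Qed.

(** Since W_z and W_(-z) are adjoint, the adjoint of T has the conjugate of alpha(-z) as symbol,
    which the hypothesis identifies with alpha(z). *)
Lemma wop_symmetric alpha u v : cintegrable mu2 alpha -> regular u -> regular v ->
  (forall z, alpha (zopp z) = (alpha z)^*%C) ->
  cintegral mu (fun x => wop alpha u x * (v x)^*%C) =
  cintegral mu (fun x => u x * (wop alpha v x)^*%C).
Proof.
move=> ia ru rv ha.
have iu := regular_cintegrable ru; have iv := regular_cintegrable rv.
have [D uD] := regular_bounded ru.
have iT2 : cintegrable (mu2 \x mu)%E (fun w => u w.2 * (alpha w.1 * weyl w.1 v w.2)^*%C).
  apply: (@cintegrable_bmul _ _ _ _ _ _ D); last exact: (cintegrable_conj (cintegrable_weyl ia iv)).
    exact: (cmeas_comp measurable_snd (regular_cmeas ru)).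
  by move=> w; exact: uD.
have iuw z : cintegrable mu (fun x => u x * (weyl z v x)^*%C).
  apply: (@cintegrable_bmul _ _ _ _ _ _ D) => //; first exact: regular_cmeas.
  by apply: cintegrable_conj; have /regular_cintegrable := regular_weyl z rv.
rewrite cintegral_wop_conj//.
rewrite (_ : (fun z => _) = (fun z => alpha z *
    cintegral mu (fun x => u x * (weyl (zopp z) v x)^*%C))); last first.
  by apply/funext => z; rewrite cintegral_weyl_adjoint.
transitivity (fconst * cintegral mu2 (fun z => cintegral mu (fun x => u x * (alpha z * weyl z v x)^*%C))).
  congr (_ * _); rewrite [RHS](cintegral_mpres mpres_zopp); last exact: (cintegrable_slice iT2).
  congr cintegral; apply/funext => z; rewrite -cintegralZ//; congr cintegral.
  by apply/funext => x; rewrite conjcM ha conjcK; ring.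
rewrite (cintegral_swap iT2); cbn [fst snd].
rewrite -cintegralZ; last exact: (cintegrable_slice (cintegrable_swap iT2)).
congr cintegral; apply/funext => x; rewrite cintegralZ; last first.
  by apply: cintegrable_conj; exact: cintegrable_wop_at.
rewrite cintegral_conj; last exact: cintegrable_wop_at.
by rewrite /wop conjcM conj_fconst; ring.
Qed.

Lemma wop_sum alpha I (r : seq I) (c : I -> R[i]) (u : I -> V -> R[i]) x :
  cintegrable mu2 alpha -> (forall i, regular (u i)) ->
  wop alpha (fun y => \sum_(i <- r) c i * u i y) x = \sum_(i <- r) c i * wop alpha (u i) x.
Proof.
move=> ia ru; rewrite /wop.
rewrite (_ : (fun z => _) = (fun z => \sum_(i <- r) c i * (alpha z * weyl z (u i) x))).
  rewrite cintegral_sum; last by move=> i; apply: cintegrableZ; exact: cintegrable_wop_at.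
  rewrite mulr_sumr; apply: eq_bigr => i _.
  by rewrite cintegralZ; [ring|exact: cintegrable_wop_at].
apply/funext => z; rewrite /weyl !mulr_sumr; apply: eq_bigr => i _; ring.
Qed.

End weyl_operators.

(** * The spectrum of a twisted idempotent *)

Lemma mpres_shearD (R : realType) (n : nat) :
  mpres (lebesgue_rV R n \x lebesgue_rV R n)%E (lebesgue_rV R n \x lebesgue_rV R n)%E
    (fun w => (w.1, w.1 + w.2)).
Proof.
apply: mpres_shear; first by mtac.
move=> x; rewrite (_ : (fun y => _) = (fun y => y + x)); first exact: mpres_rVD.
by apply/funext => y; exact: addrC.
Qed.

(** * Integrals of squared moduli *)

Section normsq.
Variable R : realType.

Definition normsq (z : R[i]) : R := Re z ^+ 2 + Im z ^+ 2.

Lemma mulJ_normsq (z : R[i]) : z * z^*%C = (normsq z)%:C.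
Proof. by apply: complex_eqP; rewrite ReImE /normsq /= ?ReImE; ring. Qed.

Lemma normsq_ge0 z : 0 <= normsq z. Proof. by rewrite addr_ge0 ?sqr_ge0. Qed.

Lemma normsq_eq0 z : normsq z = 0 -> z = 0.
Proof.
move=> /eqP; rewrite paddr_eq0 ?sqr_ge0// !sqrf_eq0 => /andP[/eqP ? /eqP ?].
exact: complex_eqP.
Qed.

Lemma cabs_real (r : R) : 0 <= r -> cabs r%:C = r.
Proof. by move=> r0; rewrite /cabs /= normr0 addr0 ger0_norm. Qed.

Lemma conj_real (r : R) : (r%:C)^*%C = r%:C :> R[i].
Proof. by apply: complex_eqP; rewrite ?Re_conjc ?Im_conjc //= oppr0. Qed.

Context d (T : measurableType d) (mu : {measure set T -> \bar R}).

Lemma cintegral_normsq_ge0 (F : T -> R[i]) :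
  0 <= Re (cintegral mu (fun x => F x * (F x)^*%C)).
Proof. by apply: Rintegral_ge0 => x _; rewrite mulJ_normsq normsq_ge0. Qed.

Lemma cintegral_normsq_real (F : T -> R[i]) :
  Im (cintegral mu (fun x => F x * (F x)^*%C)) = 0.
Proof.
rewrite /cintegral /=; transitivity (\int[mu]_x (0 : R)).
  by apply: eq_Rintegral => x _; rewrite mulJ_normsq.
by rewrite /Rintegral integral0.
Qed.

Lemma cintegral_normsq_eq0 (F : T -> R[i]) : cmeas F ->
  cintegrable mu (fun x => F x * (F x)^*%C) ->
  cintegral mu (fun x => F x * (F x)^*%C) = 0 -> {ae mu, forall x, F x = 0}.
Proof.
move=> mF [iF _] /(congr1 (@complex.Re R)) /= F0.
have mFF := measurable_int _ iF.
have : (\int[mu]_x `|(Re (F x * (F x)^*%C))%:E| = 0)%E.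
  under eq_integral do rewrite gee0_abs ?lee_fin ?mulJ_normsq ?normsq_ge0// -mulJ_normsq.
  move: F0; rewrite /Rintegral => F0.
  by rewrite -[LHS]fineK ?F0// (integrable_fin_num _ iF).
move=> /(ae_eq_integral_abs _ measurableT mFF); apply: filterS => x /(_ I) [].
by rewrite mulJ_normsq => /normsq_eq0.
Qed.

End normsq.

(** * The symbol of the projection onto an orthonormal family *)

Section orthonormal_systems.
Variables (R : realType) (n : nat) (theta : 'M[R]_n).
Hypothesis thetaA : trmx theta = - theta.
Local Notation V := 'rV[R]_n.
Local Notation mu := (lebesgue_rV R n).
Local Notation mu2 := (lebesgue_rV2 R n).
Local Notation fconst := (@fconst R n).
Local Notation weyl := (weyl theta).
Local Notation wshift := (wshift theta).
Let mp := @measurable_dot_pairing R n.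
Let pC := @dotC R n.

Variables (r : nat) (phi : 'I_r -> V -> R[i]).
Hypothesis rphi : forall i, regular (phi i).

(* The reproducing kernel of the span of [phi], in the coordinates (y - x, x). *)
Definition rkernel s x : R[i] := \sum_(i < r) phi i x * (phi i (x + s))^*%C.

Lemma regular_rkernel s : regular (rkernel s).
Proof.
have := @regular_sum R n 'I_r (index_enum _) (fun=> 1) (fun i x => phi i x * (phi i (x + s))^*%C).
rewrite (_ : (fun x => \sum_(i <- _) 1 * _) = rkernel s); last first.
  by apply/funext => x; apply: eq_bigr => i _; rewrite mul1r.
apply=> i; have rsc := regular_conj (regular_shift s (rphi i)).
exact: (regularM (rphi i) rsc).1.
Qed.

Lemma cmeas_rkernel : cmeas (fun w : V * V => rkernel w.1 w.2).
Proof.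
apply: cmeas_sum => i; have mi := regular_cmeas (rphi i).
apply: cmeasM; first by apply: (cmeas_comp _ mi); mtac.
by apply: cmeas_conj; apply: (cmeas_comp (Phi := fun w : V * V => w.2 + w.1) _ mi); mtac.
Qed.

Lemma cintegrable_rkernel : cintegrable (mu \x mu)%E (fun w => rkernel w.1 w.2).
Proof.
apply: cintegrable_sum => i; have ii := regular_cintegrable (rphi i).
have msh := mpres_shearD R n.
have it := cintegrable_tensor ii (cintegrable_conj ii).
exact: (cintegrable_swap ((cintegrable_mpres msh (cintegrable_cmeas it)).1 it)).
Qed.

Lemma rkernel_bounded : exists B, forall s x, cabs (rkernel s x) <= B.
Proof.
have /choice[B phiB] : forall i, exists B, forall x, cabs (phi i x) <= B.
  by move=> i; exact: regular_bounded.
exists (\sum_(i < r) B i * B i) => s x; rewrite /rkernel.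
have le_sum (I : Type) (e : seq I) (F : I -> R[i]) (b : I -> R) :
    (forall i, cabs (F i) <= b i) -> cabs (\sum_(i <- e) F i) <= \sum_(i <- e) b i.
  move=> Fb; elim: e => [|i e IH]; first by rewrite !big_nil /cabs /= normr0 addr0.
  by rewrite !big_cons (le_trans (cabsD _ _))// lerD.
apply: le_sum => i; rewrite (le_trans (cabsM _ _))// cabs_conjc.
by rewrite ler_pM ?cabs_ge0.
Qed.

Definition rkernel_ft s k : R[i] := fourier (rkernel s) k.

Lemma cmeas_rkernel_ft : cmeas (fun w : V * V => rkernel_ft w.1 w.2).
Proof.
apply: (@cmeas_slice _ _ _ _ _ mu (fun w : (V * V) * V => expi (- dot w.1.2 w.2) * rkernel w.1.1 w.2)).
apply: cmeasM; first by apply: cmeas_expi; mtac.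
by apply: (cmeas_comp (Phi := fun w : (V * V) * V => (w.1.1, w.2)) _ cmeas_rkernel); mtac.
Qed.

Lemma fourier_self_cintegrable s :
  cintegrable mu (fun k => rkernel_ft s k * (rkernel_ft s k)^*%C).
Proof.
have rs := regular_rkernel s; have iH := regular_cintegrable rs; have ifH := regular_fourier rs.
have bH k : cabs (fourier (rkernel s) k) <= 2 * \int[mu]_x cabs (rkernel s x).
  exact: (@cabs_ft _ _ _ _ _ mp).
apply: (@cintegrable_bmul _ _ _ _ _ _ _ _ bH); last exact: cintegrable_conj.
exact: cintegrable_cmeas ifH.
Qed.

Lemma cintegrable_rkernel_sq : cintegrable (mu \x mu)%E
  (fun w => rkernel w.1 w.2 * (rkernel w.1 w.2)^*%C).
Proof.
have [B HB] := rkernel_bounded.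
apply: (@cintegrable_bmul _ _ _ _ _ _ B) => //; first exact: cmeas_rkernel.
exact: cintegrable_conj cintegrable_rkernel.
Qed.

Lemma rkernel_plancherel s :
  cintegral mu (fun k => rkernel_ft s k * (rkernel_ft s k)^*%C) =
  ((2 * pi) ^+ n)%:C * cintegral mu (fun x => rkernel s x * (rkernel s x)^*%C).
Proof.
have rs := regular_rkernel s.
by rewrite -plancherel//; [case: rs|exact: regular_cintegrable].
Qed.

(** Plancherel in k at each s turns the inner integral into that of the squared modulus of
    [rkernel s], whose integral over s is finite. *)
Lemma cintegrable_rkernel_ft_sq : cintegrable (mu \x mu)%E
  (fun w => rkernel_ft w.1 w.2 * (rkernel_ft w.1 w.2)^*%C).
Proof.
apply: cintegrable_fubiniP.
  by apply: cmeasM; [|apply: cmeas_conj]; exact: cmeas_rkernel_ft.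
have key (F : V -> R[i]) : cintegrable mu (fun k => F k * (F k)^*%C) ->
    (\int[mu]_y (cabs (F y * (F y)^*%C))%:E =
     (Re (cintegral mu (fun k => F k * (F k)^*%C)))%:E)%E.
  move=> [iF _]; rewrite /= /Rintegral fineK ?(integrable_fin_num _ iF)//.
  by apply: eq_integral => y _; rewrite mulJ_normsq cabs_real ?normsq_ge0.
under eq_integral => s _ do rewrite (key _ (fourier_self_cintegrable s)) rkernel_plancherel.
have iQ := cintegrable_slice cintegrable_rkernel_sq.
have [iQ1 _] := cintegrableZ ((2 * pi) ^+ n)%:C iQ.
have fin := integrable_fin_num measurableT iQ1.
by rewrite ltey_eq fin.
Qed.

Hypothesis ophi : Defs.orthonormal phi.

(** The squared Hilbert-Schmidt norm of a projection is its rank: expanded, the integral is the sum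
    of |<phi_i, phi_j>|^2 over i and j. *)
Lemma cintegral_rkernel_sq : cintegral (mu \x mu)%E
  (fun w => rkernel w.1 w.2 * (rkernel w.1 w.2)^*%C) = r%:R.
Proof.
pose F (i j : 'I_r) (w : V * V) := (phi i w.2 * (phi j w.2)^*%C) *
   (phi j (w.2 + w.1) * (phi i (w.2 + w.1))^*%C).
have ip i j : cintegrable mu (fun x => phi i x * (phi j x)^*%C).
  have [B iB] := regular_bounded (rphi i).
  apply: (cintegrable_bmul (regular_cmeas (rphi i)) iB).
  by apply: cintegrable_conj; exact: regular_cintegrable.
have msh := mpres_shearD R n.
have it i j := cintegrable_tensor (ip i j) (ip j i).
have iF i j : cintegrable (mu \x mu)%E (F i j).
  exact: (cintegrable_swap ((cintegrable_mpres msh (cintegrable_cmeas (it i j))).1 (it i j))).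
have FE i j : cintegral (mu \x mu)%E (F i j) = (i == j)%:R.
  rewrite (cintegral_mpres (mpres_swap mu mu) (iF i j)).
  have := cintegral_mpres msh (it i j); rewrite /= /F /= => <-.
  rewrite (cintegral_tensor (ip i j) (ip j i)) !ophi (eq_sym j).
  by case: eqP; rewrite ?mulr1 ?mulr0.
rewrite (_ : (fun w => _) = (fun w => \sum_(i < r) \sum_(j < r) F i j w)).
  rewrite cintegral_sum; last by move=> i; exact: cintegrable_sum.
  rewrite (eq_bigr (fun=> 1)); first by rewrite sumr_const card_ord.
  move=> i _; rewrite cintegral_sum// (bigD1 i)//= FE eqxx big1 ?addr0// => j ji.
  by rewrite FE eq_sym (negbTE ji).
apply/funext => w; rewrite /rkernel conjc_sum mulr_suml; apply: eq_bigr => i _.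
rewrite mulr_sumr; apply: eq_bigr => j _; rewrite /F !conjcM conjcK; ring.
Qed.

Lemma cintegral_rkernel_ft_sq : cintegral (mu \x mu)%E
  (fun w => rkernel_ft w.1 w.2 * (rkernel_ft w.1 w.2)^*%C) = ((2 * pi) ^+ n)%:C * r%:R.
Proof.
rewrite (cintegral_fubini cintegrable_rkernel_ft_sq) /=.
under eq_fun do rewrite rkernel_plancherel.
rewrite cintegralZ; last exact: (cintegrable_slice cintegrable_rkernel_sq).
by rewrite -(cintegral_fubini cintegrable_rkernel_sq) cintegral_rkernel_sq.
Qed.

(** The Weyl symbol of P = sum_i <., phi_i> phi_i. By [conj_rsymbol] its conjugate at z is sum_i
    <W_z phi_i, phi_i>, the trace of W_z P. *)
Definition rsymbol (z : V * V) : R[i] :=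
  expi (- (dot z.1 z.2 / 2)) * rkernel_ft (wshift z) z.1.

Let mpw : mpres mu2 (mu \x mu)%E (fun z => (wshift z, z.1)).
Proof. exact: (mpres_comp (mpres_wshear theta) (mpres_swap mu mu)). Qed.

Lemma rsymbol_sq z : rsymbol z * (rsymbol z)^*%C =
  rkernel_ft (wshift z) z.1 * (rkernel_ft (wshift z) z.1)^*%C.
Proof.
rewrite /rsymbol conjcM conj_expi mulrACA -expiD.
by rewrite (_ : _ + _ = 0) ?expi0 ?mul1r//; ring.
Qed.

Lemma cintegrable_rsymbol_sq : cintegrable mu2 (fun z => rsymbol z * (rsymbol z)^*%C).
Proof.
rewrite (_ : (fun z => _) = (fun z => rkernel_ft (wshift z) z.1 * (rkernel_ft (wshift z) z.1)^*%C)).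
  have i := cintegrable_rkernel_ft_sq.
  exact: ((cintegrable_mpres mpw (cintegrable_cmeas i)).1 i).
by apply/funext => z; rewrite rsymbol_sq.
Qed.

Lemma cintegral_rsymbol_sq :
  cintegral mu2 (fun z => rsymbol z * (rsymbol z)^*%C) = ((2 * pi) ^+ n)%:C * r%:R.
Proof.
rewrite -cintegral_rkernel_ft_sq (cintegral_mpres mpw cintegrable_rkernel_ft_sq).
by congr cintegral; apply/funext => z; rewrite rsymbol_sq.
Qed.

Lemma conj_rsymbol z : (rsymbol z)^*%C =
  \sum_(i < r) cintegral mu (fun x => weyl z (phi i) x * (phi i x)^*%C).
Proof.
have iw i : cintegrable mu (fun x => weyl z (phi i) x * (phi i x)^*%C).
  have [B iB] := regular_bounded (regular_weyl theta z (rphi i)).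
  apply: (cintegrable_bmul _ iB); last by apply: cintegrable_conj; exact: regular_cintegrable.
  by apply: regular_cmeas; exact: regular_weyl.
rewrite -cintegral_sum// /rsymbol conjcM conj_expi opprK /rkernel_ft.
rewrite fourierE -(ift_conj mp pC); last exact: regular_cintegrable (regular_rkernel _).
rewrite /ift -cintegralZ; last first.
  apply: (cintegrable_ift mp); apply: cintegrable_conj.
  exact: regular_cintegrable (regular_rkernel _).
congr cintegral; apply/funext => x; rewrite /rkernel conjc_sum !mulr_sumr.
apply: eq_bigr => i _; rewrite /weyl /wphase expiD conjcM conjcK (dotC x); ring.
Qed.

End orthonormal_systems.

(** * Counting orthonormal eigenfunctions *)

Section spectral.
Variables (R : realType) (n : nat) (theta : 'M[R]_n).
Hypothesis thetaA : trmx theta = - theta.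
Local Notation V := 'rV[R]_n.
Local Notation mu := (lebesgue_rV R n).
Local Notation mu2 := (lebesgue_rV2 R n).
Local Notation fconst := (@fconst R n).
Local Notation weyl := (weyl theta).
Local Notation wshift := (wshift theta).
Local Notation wop := (wop theta).
Let mp := @measurable_dot_pairing R n.
Let pC := @dotC R n.

Variables (alpha : V * V -> R[i]) (lam : R).
Hypotheses (lam_gt0 : 0 < lam) (ia : cintegrable mu2 alpha).
Hypothesis ha : forall z, alpha (zopp z) = (alpha z)^*%C.
Hypothesis twisted : {ae mu2, forall z, cintegral mu2 (fun z' =>
  alpha z' * alpha (zsub z z') * expi (cocycle theta z' (zsub z z'))) =
  ((2 * pi) ^+ n / lam)%:C * alpha z}.
Hypothesis isq : cintegrable mu2 (fun z => alpha z * (alpha z)^*%C).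
Hypothesis sqE : cintegral mu2 (fun z => alpha z * (alpha z)^*%C) = ((2 * pi) ^+ n / lam)%:C.

Definition inner u v : R[i] := cintegral mu (fun x => u x * (v x)^*%C).

Lemma cintegrable_inner u v : regular u -> cintegrable mu v ->
  cintegrable mu (fun x => u x * (v x)^*%C).
Proof.
move=> ru iv; have [B uB] := regular_bounded ru.
by apply: (cintegrable_bmul (regular_cmeas ru) uB); exact: cintegrable_conj.
Qed.

Definition eigenspace u := regular u /\ forall x, u x = lam%:C * wop alpha u x.

Let lam0 : lam%:C != 0 :> R[i].
Proof. by apply/eqP => /(congr1 (@complex.Re R)) /= /eqP; rewrite gt_eqF. Qed.

(** In [wop_comp] the constant (2 pi)^n / lam meets the normalization (2 pi)^-n of [wop], so T T u =
    T u / lam and lam T is idempotent. *)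
Lemma eigenspace_wop u : regular u -> eigenspace (fun x => lam%:C * wop alpha u x).
Proof.
move=> ru; have rT := (regular_wop theta ia ru).1.
split; first exact: regularZ.
(* A sum with one term expresses the homogeneity of [wop]. *)
move=> x; have := wop_sum theta [:: tt] (fun=> lam%:C) x ia (fun=> rT).
rewrite (_ : (fun y => \sum_(i <- _) _) = (fun y => lam%:C * wop alpha u y)); last first.
  by apply/funext => y; rewrite big_cons big_nil addr0.
move=> ->; rewrite big_cons big_nil addr0 (wop_comp x ia ru twisted).
rewrite (_ : fconst * _ = lam%:C^-1); first by rewrite mulVKf.
rewrite rmorphM /= mulrA fconstK mul1r.
by apply: (mulfI lam0); rewrite mulfV// -rmorphM /= mulfV// gt_eqF.
Qed.

Lemma eigenspace_sum I (s : seq I) (c : I -> R[i]) (u : I -> V -> R[i]) :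
  (forall i, eigenspace (u i)) -> eigenspace (fun x => \sum_(i <- s) c i * u i x).
Proof.
move=> Eu; have ru i : regular (u i) by case: (Eu i).
split; first exact: regular_sum.
move=> x; rewrite wop_sum// mulr_sumr; apply: eq_bigr => i _.
by have [_ ->] := Eu i; rewrite mulrCA.
Qed.

Lemma eigenspaceB u v c : eigenspace u -> eigenspace v -> eigenspace (fun x => u x - c * v x).
Proof.
move=> Eu Ev.
have := @eigenspace_sum bool [:: true; false] (fun b => if b then 1 else - c)
  (fun b => if b then u else v).
rewrite (_ : (fun x => \sum_(i <- _) _) = (fun x => u x - c * v x)); last first.
  by apply/funext => x; rewrite !big_cons big_nil /= mul1r addr0 mulNr.
by apply; case.
Qed.

Lemma eigenspaceZ u c : eigenspace u -> eigenspace (fun x => c * u x).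
Proof.
move=> Eu; have := @eigenspace_sum unit [:: tt] (fun=> c) (fun=> u) (fun=> Eu).
rewrite (_ : (fun x => \sum_(i <- _) _) = (fun x => c * u x))//.
by apply/funext => x; rewrite big_cons big_nil addr0.
Qed.

Section family.
Variables (r : nat) (phi : 'I_r -> V -> R[i]).
Hypotheses (Ephi : forall i, eigenspace (phi i)) (ophi : Defs.orthonormal phi).

Let rphi i : regular (phi i). Proof. by case: (Ephi i). Qed.

Local Notation rsymbol := (rsymbol theta phi).

Lemma cintegrable_cross : cintegrable mu2 (fun z => alpha z * (rsymbol z)^*%C).
Proof.
under eq_fun do rewrite conj_rsymbol// mulr_sumr.
by apply: cintegrable_sum => i; exact: cintegrable_weyl_ip.
Qed.

(** The conjugate symbol is a sum of matrix elements of W_z, so its integral against alpha is (2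
    pi)^n sum_i <T phi_i, phi_i>, and each term of the sum is 1/lam. *)
Lemma cintegral_cross :
  cintegral mu2 (fun z => alpha z * (rsymbol z)^*%C) = ((2 * pi) ^+ n * r%:R / lam)%:C.
Proof.
have E i : cintegral mu2 (fun z => alpha z *
    cintegral mu (fun x => weyl z (phi i) x * (phi i x)^*%C)) = ((2 * pi) ^+ n / lam)%:C.
  have rT := (regular_wop theta ia (rphi i)).1.
  have := ophi i i; rewrite eqxx.
  rewrite (_ : (fun x => phi i x * _) = (fun x => lam%:C * (wop alpha (phi i) x * (phi i x)^*%C))).
    rewrite (cintegralZ _ (cintegrable_inner rT (regular_cintegrable (rphi i)))).
    rewrite (cintegral_wop_conj theta ia (rphi i) (rphi i)) => /(congr1 (fun w => ((2 * pi) ^+ n / lam)%:C * w)).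
    rewrite mulr1 => <-; rewrite mulrA -rmorphM /= divfK ?gt_eqF//.
    by rewrite mulrA (mulrC _ fconst) fconstK mul1r.
  by apply/funext => x; rewrite mulrA; congr (_ * _); have [_ /(_ x)] := Ephi i.
under eq_fun do rewrite conj_rsymbol// mulr_sumr.
rewrite cintegral_sum; last by move=> i; exact: cintegrable_weyl_ip.
rewrite (eq_bigr (fun=> ((2 * pi) ^+ n / lam)%:C)); last by move=> i _; exact: E.
by rewrite sumr_const card_ord -[LHS]mulr_natr -(rmorph_nat (real_complex R)) -rmorphM /= mulrAC.
Qed.

(* The integral of |defect|^2 is (2 pi)^n (lam - r): it bounds the size r of an
   orthonormal family of eigenfunctions, and vanishes once r = lam. *)
Definition defect z : R[i] := lam%:C * alpha z - rsymbol z.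

Lemma defect_sqE z : defect z * (defect z)^*%C =
  (lam ^+ 2)%:C * (alpha z * (alpha z)^*%C) - (lam%:C * (alpha z * (rsymbol z)^*%C) +
   lam%:C * (alpha z * (rsymbol z)^*%C)^*%C) + rsymbol z * (rsymbol z)^*%C.
Proof.
have -> : (lam ^+ 2)%:C = lam%:C * lam%:C :> R[i] by rewrite expr2 rmorphM.
rewrite /defect conjcD conjcN (conjcM _ (alpha z)) (conjcM (alpha z)) conjcK conj_real.
move: (lam%:C) (alpha z) ((alpha z)^*%C) (rsymbol z) ((rsymbol z)^*%C) => a b c d e.
ring.
Qed.

Lemma cintegrable_defect_sq : cintegrable mu2 (fun z => defect z * (defect z)^*%C).
Proof.
under eq_fun do rewrite defect_sqE.
apply: cintegrableD; last exact: cintegrable_rsymbol_sq.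
apply: cintegrableD; first exact: cintegrableZ.
apply: cintegrableN; apply: cintegrableD; apply: cintegrableZ.
  exact: cintegrable_cross.
exact: cintegrable_conj cintegrable_cross.
Qed.

(** In units of (2 pi)^n the expanded square contributes lam from lam alpha, -2 r from the cross
    terms and r from the symbol of the projection. *)
Lemma cintegral_defect_sq :
  cintegral mu2 (fun z => defect z * (defect z)^*%C) = ((2 * pi) ^+ n * (lam - r%:R))%:C.
Proof.
have ic := cintegrable_cross; have icc := cintegrable_conj ic.
have irs := cintegrable_rsymbol_sq theta rphi.
have i1 := cintegrableZ lam%:C ic; have i2 := cintegrableZ lam%:C icc.
have i3 := cintegrableZ (lam ^+ 2)%:C isq.
under eq_fun do rewrite defect_sqE.
rewrite cintegralD; [|by apply: cintegrableD => //; apply: cintegrableN; exact: cintegrableD|by []].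
rewrite cintegralB//; last exact: cintegrableD.
rewrite cintegralD// !cintegralZ// cintegral_conj// cintegral_cross sqE.
rewrite cintegral_rsymbol_sq// conj_real -(rmorph_nat (real_complex R)) -!rmorphM /=.
apply: complex_eqP; rewrite !(ReD, ReN, ImD, ImN) /=; last by ring.
by field; rewrite gt_eqF.
Qed.

Lemma orthonormal_size_le : r%:R <= lam.
Proof.
have := cintegral_normsq_ge0 mu2 defect; rewrite cintegral_defect_sq /=.
by rewrite pmulr_rge0 ?exprn_gt0 ?twopi_gt0// subr_ge0.
Qed.

End family.

Lemma inner_conj u v : regular u -> regular v -> inner v u = (inner u v)^*%C.
Proof.
move=> ru rv; rewrite /inner -cintegral_conj; last first.
  exact: cintegrable_inner (regular_cintegrable rv).
by congr cintegral; apply/funext => x; rewrite conjcM conjcK mulrC.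
Qed.

Lemma innerZl c u v : regular u -> regular v -> inner (fun x => c * u x) v = c * inner u v.
Proof.
move=> ru rv; rewrite /inner -cintegralZ; last exact: cintegrable_inner (regular_cintegrable rv).
by congr cintegral; apply/funext => x; rewrite mulrA.
Qed.

Lemma innerB_proj r (phi : 'I_r -> V -> R[i]) u j : regular u ->
  (forall i, regular (phi i)) -> Defs.orthonormal phi ->
  inner (fun x => u x - \sum_(i < r) inner u (phi i) * phi i x) (phi j) = 0.
Proof.
move=> ru rphi ophi.
have ij i := cintegrable_inner (rphi i) (regular_cintegrable (rphi j)).
have iu := cintegrable_inner ru (regular_cintegrable (rphi j)).
rewrite /inner (_ : (fun x => _) = (fun x => u x * (phi j x)^*%C -
    \sum_(i < r) inner u (phi i) * (phi i x * (phi j x)^*%C))); last first.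
  by apply/funext => x; rewrite mulrBl mulr_suml; congr (_ - _); apply: eq_bigr => i _; rewrite mulrA.
have is_ := cintegrable_sum (index_enum 'I_r) (fun i => cintegrableZ (inner u (phi i)) (ij i)).
rewrite (cintegralB iu is_) cintegral_sum; last by move=> i; exact: cintegrableZ.
rewrite (bigD1 j)//= cintegralZ// ophi eqxx mulr1 big1 ?addr0 ?subrr// => i ne.
by rewrite cintegralZ// ophi (negbTE ne) mulr0.
Qed.

Definition eigenfamily r (phi : 'I_r -> V -> R[i]) :=
  (forall i, eigenspace (phi i)) /\ Defs.orthonormal phi.

(** A Gram-Schmidt step. The remainder of u has nonzero norm: otherwise it would vanish almost
    everywhere, hence everywhere by regularity, and u would have the excluded expansion. *)
Lemma eigenfamily_extend r (phi : 'I_r -> V -> R[i]) u : eigenfamily phi -> eigenspace u ->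
  ~ (forall x, u x = \sum_(i < r) inner u (phi i) * phi i x) ->
  exists psi : 'I_r.+1 -> V -> R[i], eigenfamily psi.
Proof.
move=> [Ephi ophi] Eu nu; have rphi i : regular (phi i) by case: (Ephi i).
have [ru _] := Eu.
pose u' x := u x - \sum_(i < r) inner u (phi i) * phi i x.
have Eu' : eigenspace u'.
  have := eigenspaceB 1 Eu (eigenspace_sum (index_enum 'I_r) (fun i => inner u (phi i)) Ephi).
  by rewrite (_ : (fun x => _ - 1 * _) = u')//; apply/funext => x; rewrite mul1r.
have [ru' _] := Eu'; have iu' := cintegrable_inner ru' (regular_cintegrable ru').
pose nu2 := Re (inner u' u').
have nuE : inner u' u' = nu2%:C.
  apply: complex_eqP => //=; exact: cintegral_normsq_real.
have nu_ge0 : 0 <= nu2 by exact: cintegral_normsq_ge0.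
have nu_neq0 : nu2 != 0.
  apply/eqP => nu0; apply: nu => x.
  have := cintegral_normsq_eq0 (regular_cmeas ru') iu' _.
  rewrite -[cintegral _ _]/(inner u' u') nuE nu0 => /(_ erefl) /(regular_eq0 ru') /(_ x) /eqP.
  by rewrite subr_eq0 => /eqP.
pose s := (Num.sqrt nu2)^-1.
pose w x := s%:C * u' x.
have Ew : eigenspace w by exact: eigenspaceZ.
have rw : regular w by case: Ew.
have wu' v : regular v -> inner w v = s%:C * inner u' v by move=> rv; exact: innerZl.
have ww : inner w w = 1.
  rewrite wu'// inner_conj// wu'// conjcM nuE !conj_real -!rmorphM /s.
  by rewrite mulrA -invfM -expr2 sqr_sqrtr// mulVf.
have wphi j : inner w (phi j) = 0.
  have E : inner u' (phi j) = 0 := innerB_proj j ru rphi ophi.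
  by rewrite (wu' _ (rphi j)) E mulr0.
(* The new vector takes the last index; [unlift] recovers the old ones. *)
pose psi (i : 'I_r.+1) := if unlift ord_max i is Some j then phi j else w.
exists psi; split=> [i|i j]; rewrite /psi.
  by case: (unliftP ord_max i).
rewrite -[cintegral _ _]/(inner (psi i) (psi j)) /psi.
case: (unliftP ord_max i) => [i' ->|->]; case: (unliftP ord_max j) => [j' ->|->].
- by rewrite (inj_eq lift_inj) -ophi.
- have -> : (lift ord_max i' == ord_max) = false by rewrite eq_sym; exact/negbTE/neq_lift.
  by rewrite (inner_conj rw (rphi i')) wphi (conj_real 0).
- have -> : (ord_max == lift ord_max j') = false by exact/negbTE/neq_lift.
  exact: wphi.
- by rewrite eqxx; exact: ww.
Qed.

(** The possible sizes include 0 and are bounded through [orthonormal_size_le], so there is a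
    largest; an eigenfunction without expansion in a largest family would enlarge it. *)
Lemma exists_eigenbasis : exists m (phi : 'I_m -> V -> R[i]), eigenfamily phi /\
  forall u, eigenspace u -> forall x, u x = \sum_(i < m) inner u (phi i) * phi i x.
Proof.
pose P r := `[< exists phi : 'I_r -> V -> R[i], eigenfamily phi >].
have P0 : exists r, P r.
  by exists 0%N; apply/asboolP; exists (fun=> fun=> 0); split=> [[]//|[]//].
have Pub r : P r -> (r <= Num.bound lam)%N.
  move=> /asboolP[phi [Ephi ophi]].
  rewrite -(ler_nat R) (le_trans (orthonormal_size_le Ephi ophi))// ltW//.
  by apply: archi_boundP; exact: ltW.
case: (ex_maxnP P0 Pub) => m /asboolP[phi fphi] maxm; exists m, phi; split=> // u Eu.
apply: contrapT => nu; have [psi fpsi] := eigenfamily_extend fphi Eu nu.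
have /maxm : P m.+1 by apply/asboolP; exists psi.
by rewrite ltnn.
Qed.

End spectral.

(** * Recovering the symbol from the operator *)

Section kernel_identity.
Variables (R : realType) (n : nat) (theta : 'M[R]_n).
Hypothesis thetaA : trmx theta = - theta.
Local Notation V := 'rV[R]_n.
Local Notation mu := (lebesgue_rV R n).
Local Notation mu2 := (lebesgue_rV2 R n).
Local Notation fconst := (@fconst R n).
Local Notation weyl := (weyl theta).
Local Notation wshift := (wshift theta).
Local Notation wop := (wop theta).
Local Notation ift := (ift mu (@dot R n)).
Let mp := @measurable_dot_pairing R n.
Let pC := @dotC R n.

Lemma ae_ift_inj (w : V -> R[i]) : cintegrable mu w ->
  {ae mu, forall x, ift w x = 0} -> {ae mu, forall k, w k = 0}.
Proof.
exact: (ift_inj mp pC (@twopin_neq0 R n) (@rV_fourier_inversion R n)).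
Qed.

Variables (alpha : V * V -> R[i]) (ia : cintegrable mu2 alpha).

Definition unshear (z : V * V) : V * V := (z.1, z.2 + 2^-1 *: (z.1 *m theta)).

Lemma mpres_unshear : mpres mu2 mu2 unshear.
Proof.
apply: (@mpres_shear _ _ _ _ _ _ _ mu mu mu
  (fun z : V * V => z.2 + 2^-1 *: (z.1 *m theta))); first by mtac.
by move=> k; exact: (mpres_rVD (2^-1 *: (k *m theta))).
Qed.

Lemma wshift_unshear z : wshift (unshear z) = z.2.
Proof. by rewrite /wshift /unshear /= addrK. Qed.

Lemma unshear_wshift z : unshear (z.1, wshift z) = z.
Proof. by case: z => k l; rewrite /wshift /unshear /= subrK. Qed.

(** The symbol in coordinates (k, b) in which b is the actual displacement of the Weyl operator,
    with the half phase absorbed. By [weyl_unshear] only u(x + b) and e^(ik.x) remain beside it, so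
    integrating over k produces an ordinary integral kernel, [wkernel]. *)
Definition sheared (z : V * V) : R[i] := expi (dot z.1 z.2 / 2) * alpha (unshear z).

Lemma cintegrable_sheared : cintegrable (mu \x mu)%E sheared.
Proof.
apply: cintegrable_expi; first by mtac.
exact: ((cintegrable_mpres mpres_unshear (cintegrable_cmeas ia)).1 ia).
Qed.

Lemma sheared_wshift z : sheared (z.1, wshift z) = expi (dot z.1 z.2 / 2) * alpha z.
Proof. by rewrite /sheared unshear_wshift /= dot_wshift. Qed.

Lemma weyl_unshear z u x : alpha (unshear z) * weyl (unshear z) u x =
  u (x + z.2) * (expi (dot z.1 x) * sheared z).
Proof.
rewrite /weyl wshift_unshear /wphase /sheared /unshear /= !dotE.
by rewrite (dotC z.1 (_ *m _)) dot_mulmx0// mulr0 addr0 expiD; ring.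
Qed.

Definition wkernel x b : R[i] := cintegral mu (fun k => expi (dot k x) * sheared (k, b)).

Let iexp x : cintegrable (mu \x mu)%E (fun w : V * V => expi (dot w.2 x) * sheared (w.2, w.1)).
Proof. by apply: cintegrable_expi (cintegrable_swap cintegrable_sheared); mtac. Qed.

Lemma cintegrable_wkernel x : cintegrable mu (wkernel x).
Proof. exact: (cintegrable_slice (iexp x)). Qed.

Lemma cmeas_wkernel : cmeas (fun w : V * V => wkernel w.1 w.2).
Proof.
apply: (@cmeas_slice _ _ _ _ _ mu
  (fun w : (V * V) * V => expi (dot w.2 w.1.1) * sheared (w.2, w.1.2))).
apply: cmeasM; first by apply: cmeas_expi; mtac.
apply: (cmeas_comp (Phi := fun w : (V * V) * V => (w.2, w.1.2))
  _ (cintegrable_cmeas cintegrable_sheared)).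
by mtac.
Qed.

Lemma wop_wkernel u x : regular u ->
  wop alpha u x = fconst * cintegral mu (fun b => u (x + b) * wkernel x b).
Proof.
move=> ru; have [B uB] := regular_bounded ru.
rewrite /wop (cintegral_mpres mpres_unshear); last exact: cintegrable_wop_at.
rewrite (_ : (fun z => alpha (unshear z) * _) =
    (fun z => u (x + z.2) * (expi (dot z.1 x) * sheared z))); last first.
  by apply/funext => z; exact: weyl_unshear.
congr (_ * _); have mux : cmeas (fun b : V => u (x + b)).
  apply: (cmeas_comp (Phi := fun b : V => x + b) _ (regular_cmeas ru)); mtac.
have iP : cintegrable (mu \x mu)%E
    (fun w : V * V => u (x + w.1) * (expi (dot w.2 x) * sheared (w.2, w.1))).
  apply: (@cintegrable_bmul _ _ _ _ _ _ B) => //.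
  exact: (cmeas_comp measurable_fst mux).
rewrite -(cintegral_fubini_phase1 (iexp x) mux iP).
rewrite (cintegral_mpres (mpres_swap mu mu) iP).
by congr cintegral; apply/funext => -[k b].
Qed.

Variables (r : nat) (phi : 'I_r -> V -> R[i]).
Hypothesis rphi : forall i, regular (phi i).
Local Notation rkernel := (rkernel phi).
Local Notation rkernel_ft := (rkernel_ft phi).

Lemma cintegrable_rkernel_at x : cintegrable mu (fun b => rkernel b x).
Proof.
apply: cintegrable_sum => i; apply: cintegrableZ; apply: cintegrable_conj.
under eq_fun do rewrite addrC.
by apply: cintegrable_shift; exact: regular_cintegrable.
Qed.

Lemma cintegral_rkernel u x : regular u ->
  cintegral mu (fun b => u (x + b) * rkernel b x) = \sum_(i < r) inner u (phi i) * phi i x.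
Proof.
move=> ru; have [B uB] := regular_bounded ru.
have ip i := cintegrable_inner ru (regular_cintegrable (rphi i)).
have ips i : cintegrable mu (fun b => u (x + b) * (phi i (x + b))^*%C).
  under eq_fun do rewrite (addrC x); exact: (cintegrable_shift x (ip i)).
rewrite (_ : (fun b => _) = (fun b => \sum_(i < r) phi i x * (u (x + b) * (phi i (x + b))^*%C))).
  rewrite cintegral_sum; last by move=> i; exact: cintegrableZ.
  apply: eq_bigr => i _; rewrite cintegralZ// mulrC; congr (_ * _).
  rewrite /inner -(cintegral_shift x (ip i)).
  by congr cintegral; apply/funext => b; rewrite (addrC x).
by apply/funext => b; rewrite /rkernel mulr_sumr; apply: eq_bigr => i _; ring.
Qed.

Variable lam : R.
Hypothesis expand : forall u, regular u -> forall x,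
  lam%:C * wop alpha u x = \sum_(i < r) inner u (phi i) * phi i x.

Let kdiff x b : R[i] := lam%:C * fconst * wkernel x b - rkernel b x.

(* Against every modulation of one nowhere vanishing regular function both kernels integrate
   to the same value, so the product of [kdiff] with that function has zero Fourier transform. *)
Lemma ae_wkernel x : {ae mu, forall b, kdiff x b = 0}.
Proof.
have [gam [rg g0]] := @regular_test_function R n.
have iK : cintegrable mu (kdiff x).
  apply: cintegrableD; first by apply: cintegrableZ; exact: cintegrable_wkernel.
  by apply: cintegrableN; exact: cintegrable_rkernel_at.
have key u : regular u -> cintegral mu (fun b => u (x + b) * kdiff x b) = 0.
  move=> ru; have [B uB] := regular_bounded ru.
  have mux : cmeas (fun b : V => u (x + b)).
    apply: (cmeas_comp (Phi := fun b : V => x + b) _ (regular_cmeas ru)); mtac.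
  have bux b : cabs (u (x + b)) <= B by [].
  have i1 := cintegrable_bmul mux bux (cintegrable_wkernel x).
  have i2 := cintegrable_bmul mux bux (cintegrable_rkernel_at x).
  rewrite (_ : (fun b => _) = (fun b => lam%:C * fconst * (u (x + b) * wkernel x b) -
      u (x + b) * rkernel b x)); last by apply/funext => b; rewrite /kdiff; ring.
  rewrite (cintegralB (cintegrableZ _ i1) i2) cintegralZ// -mulrA -wop_wkernel//.
  by rewrite cintegral_rkernel// expand// subrr.
have [B gB] := regular_bounded rg.
have ig : cintegrable mu (fun b => gam (x + b) * kdiff x b).
  apply: (@cintegrable_bmul _ _ _ _ _ _ B) => //.
  apply: (cmeas_comp (Phi := fun b : V => x + b) _ (regular_cmeas rg)); mtac.
have ft0 q : ft mu (@dot R n) (fun b => gam (x + b) * kdiff x b) q = 0.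
  have := key _ (regular_modulation (- q) rg).
  rewrite (_ : (fun b => _) = (fun b => expi (- dot q x) *
      (expi (- dot q b) * (gam (x + b) * kdiff x b)))); last first.
    by apply/funext => b; rewrite !dotE expiD; ring.
  rewrite cintegralZ; last exact: (cintegrable_ft mp).
  move=> /(congr1 (fun w => expi (dot q x) * w)); rewrite mulr0 mulrA -expiD subrr expi0 mul1r.
  by [].
have := ft_inj mp (@twopin_neq0 R n) (@rV_fourier_inversion R n) ig _.
move=> /(_ (aeW _ ft0)); apply: filterS => b /eqP.
by rewrite mulf_eq0 (negbTE (g0 _)) => /eqP.
Qed.

(** [ae_wkernel] concerns each x and almost every b. With the quantifiers exchanged it says, for
    almost every b, that the inverse transform in k of this difference vanishes at almost every x;
    injectivity concludes. *)
Lemma ae_sheared : {ae (mu \x mu)%E, forall w : V * V,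
  lam%:C * sheared (w.2, w.1) - rkernel_ft w.1 w.2 = 0}.
Proof.
have mS : cmeas (fun w : V * V => sheared (w.2, w.1)).
  exact: cintegrable_cmeas (cintegrable_swap cintegrable_sheared).
have mD : cmeas (fun w : V * V => kdiff w.1 w.2).
  apply: cmeasD; first by apply: cmeasM; [exact: cmeas_cst|exact: cmeas_wkernel].
  apply: cmeasN; apply: (cmeas_comp (Phi := fun w : V * V => (w.2, w.1))
    (F := fun w => rkernel w.1 w.2) _ (cmeas_rkernel rphi)); mtac.
apply/(ae_prodP _ _ (F := fun w => lam%:C * sheared (w.2, w.1) - rkernel_ft w.1 w.2)).
  apply: cmeasD; first by apply: cmeasM => //; exact: cmeas_cst.
  by apply: cmeasN; exact: cmeas_rkernel_ft.
have h := ae_swap mD (aeW mu ae_wkernel).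
apply: filterS2 h (ae_cintegrable1 (cintegrable_swap cintegrable_sheared)) => b hb /= ib.
have rH := regular_rkernel rphi b.
have iH := regular_fourier rH.
have iw : cintegrable mu (fun k => lam%:C * sheared (k, b) - rkernel_ft b k).
  by apply: cintegrableD; [exact: cintegrableZ|exact: cintegrableN].
apply: (ae_ift_inj iw); apply: filterS hb => x.
rewrite /kdiff; have [_ ->] := rH; rewrite /inv_fourier => E.
rewrite (_ : ift _ x = lam%:C * wkernel x b - ift (fourier (rkernel b)) x).
  apply: (mulfI (@fconst_neq0 R n)); rewrite mulr0 -[RHS]E; ring.
rewrite /wkernel -cintegralZ; last by apply: cintegrable_expi => //; exact: measurable_dotr.
rewrite -cintegralB.
- by congr cintegral; apply/funext => k; rewrite /rkernel_ft; ring.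
- by apply: cintegrableZ; apply: cintegrable_expi => //; exact: measurable_dotr.
- exact: (cintegrable_ift mp).
Qed.

Lemma ae_rsymbol : {ae mu2, forall z, lam%:C * alpha z - rsymbol theta phi z = 0}.
Proof.
have mpw : mpres mu2 (mu \x mu)%E (fun z => (wshift z, z.1)).
  exact: (mpres_comp (mpres_wshear theta) (mpres_swap mu mu)).
have := ae_mpres mpw ae_sheared; apply: filterS => z /=.
rewrite sheared_wshift /rsymbol => E.
have ee : expi (- (dot z.1 z.2 / 2)) * expi (dot z.1 z.2 / 2) = 1 :> R[i].
  by rewrite -expiD addNr expi0.
rewrite -[RHS](mulr0 (expi (- (dot z.1 z.2 / 2)))) -E mulrBr; congr (_ - _).
by rewrite -[LHS]mul1r -ee; ring.
Qed.

End kernel_identity.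

Section spectral_theorem.
Variables (R : realType) (n : nat) (theta : 'M[R]_n).
Hypothesis thetaA : trmx theta = - theta.
Local Notation V := 'rV[R]_n.
Local Notation mu := (lebesgue_rV R n).
Local Notation mu2 := (lebesgue_rV2 R n).
Local Notation wop := (wop theta).

(** lam T u lies in the eigenspace, and by symmetry its coefficients are <lam T u, phi_i> = <u, lam
    T phi_i> = <u, phi_i>. *)
Lemma cintegral_wop_expand (alpha : V * V -> R[i]) (lam : R) m (phi : 'I_m -> V -> R[i]) :
  0 < lam -> cintegrable mu2 alpha ->
  (forall z, alpha (zopp z) = (alpha z)^*%C) ->
  {ae mu2, forall z, cintegral mu2 (fun z' =>
    alpha z' * alpha (zsub z z') * expi (cocycle theta z' (zsub z z'))) =
    ((2 * pi) ^+ n / lam)%:C * alpha z} ->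
  (forall i, eigenspace theta alpha lam (phi i)) ->
  (forall u, eigenspace theta alpha lam u ->
    forall x, u x = \sum_(i < m) inner u (phi i) * phi i x) ->
  forall u, regular u -> forall x,
    lam%:C * wop alpha u x = \sum_(i < m) inner u (phi i) * phi i x.
Proof.
move=> lam_gt0 ia ha tw Ephi span u ru x.
have rT := (regular_wop theta ia ru).1.
rewrite (span _ (eigenspace_wop lam_gt0 ia tw ru)); apply: eq_bigr => i _; congr (_ * _).
have [ri Ei] := Ephi i; have rTi := (regular_wop theta ia ri).1.
rewrite (innerZl _ rT ri) /inner (wop_symmetric thetaA ia ru ri ha).
rewrite -cintegralZ; last exact: (cintegrable_inner ru (regular_cintegrable rTi)).
congr cintegral; apply/funext => y; rewrite [in RHS]Ei conjcM conj_real; ring.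
Qed.

Theorem twisted_idempotent_spectrum (alpha : V * V -> R[i]) (lam : R) :
  0 < lam -> cintegrable mu2 alpha ->
  (forall z, alpha (zopp z) = (alpha z)^*%C) ->
  {ae mu2, forall z, cintegral mu2 (fun z' =>
    alpha z' * alpha (zsub z z') * expi (cocycle theta z' (zsub z z'))) =
    ((2 * pi) ^+ n / lam)%:C * alpha z} ->
  cintegrable mu2 (fun z => alpha z * (alpha z)^*%C) ->
  cintegral mu2 (fun z => alpha z * (alpha z)^*%C) = ((2 * pi) ^+ n / lam)%:C ->
  exists m (phi : 'I_m -> V -> R[i]), [/\ eigenfamily theta alpha lam phi, m%:R = lam,
    (forall u, eigenspace theta alpha lam u ->
      forall x, u x = \sum_(i < m) inner u (phi i) * phi i x) &
    {ae mu2, forall z, lam%:C * alpha z - rsymbol theta phi z = 0}].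
Proof.
move=> lam_gt0 ia ha tw isq sqE.
have [m [phi [[Ephi ophi] span]]] := exists_eigenbasis theta lam_gt0 ia isq sqE.
have rphi i : regular (phi i) by case: (Ephi i).
have expand := cintegral_wop_expand lam_gt0 ia ha tw Ephi span.
have ae0 := ae_rsymbol thetaA ia rphi expand.
exists m, phi; split=> //.
have D := cintegral_defect_sq lam_gt0 ia isq sqE Ephi ophi.
have iD := cintegrable_defect_sq ia isq Ephi.
(* [D] gives the same integral as (2 pi)^n (lam - m), so lam = m. *)
have D0 : cintegral mu2 (fun z => defect theta alpha lam phi z * (defect theta alpha lam phi z)^*%C) = 0.
  rewrite -(cintegral0 mu2); apply: ae_eq_cintegral.
  - exact: cintegrable_cmeas iD.
  - exact: cmeas_cst.
  - by apply: filterS ae0 => z E; rewrite /defect E mul0r.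
move: D; rewrite D0 => /(congr1 (@complex.Re R)) /= /esym/eqP.
rewrite mulf_eq0 expf_eq0 (gt_eqF (@twopi_gt0 R)) andbF /= subr_eq0 => /eqP ->.
by [].
Qed.

End spectral_theorem.

(** * Distribution functions on phase space *)

Section measure_scaling.
Context d (T : measurableType d) (R : realType) (m : {measure set T -> \bar R}).
Variables (c : R) (c_gt0 : 0 < c).
Local Notation cm := (mscale (NngNum (ltW c_gt0)) m).

Lemma integrable_mscale (f : T -> \bar R) : cm.-integrable setT f <-> m.-integrable setT f.
Proof.
have E : measurable_fun setT f ->
    (\int[cm]_x `|f x| = c%:E * \int[m]_x `|f x|)%E.
  by move=> mf; rewrite ge0_integral_mscale//; exact: measurableT_comp.
split=> /integrableP[mf fi]; apply/integrableP; split=> //; last first.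
  by rewrite E// lte_mul_pinfty// lee_fin ltW.
move: fi; rewrite E//.
have := @integral_ge0 _ _ _ m setT _ (fun x (_ : setT x) => abse_ge0 (f x)).
(* An infinite integral would stay infinite after multiplication by c > 0, against the
   hypothesis. *)
move: (integral _ _ _) => [r _ _|_|//]; first exact: ltry.
by rewrite gt0_muley ?lte_fin// ltxx.
Qed.

Lemma Rintegral_mscale (f : T -> R) : m.-integrable setT (EFin \o f) ->
  \int[cm]_x f x = c * \int[m]_x f x.
Proof.
move=> fi; have mf := measurable_int _ fi.
rewrite /Rintegral integralE [in RHS]integralE.
have ip := integrable_pos_fin_num measurableT fi.
have iq := integrable_neg_fin_num measurableT fi.
rewrite !ge0_integral_mscale//=; last 2 first.
- exact: measurable_funeneg.
- exact: measurable_funepos.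
rewrite -muleBr//; last by rewrite fin_num_adde_defl// fin_numN.
by rewrite fineM// fin_numB; apply/andP.
Qed.

Lemma cintegrable_mscale (F : T -> R[i]) : cintegrable cm F <-> cintegrable m F.
Proof. by split=> -[/integrable_mscale ? /integrable_mscale ?]; split. Qed.

Lemma cintegral_mscale (F : T -> R[i]) : cintegrable m F ->
  cintegral cm F = c%:C * cintegral m F.
Proof.
move=> [i1 i2]; apply: complex_eqP; rewrite ReImE /= Rintegral_mscale//; ring.
Qed.

Lemma ae_mscale (P : T -> Prop) : {ae cm, forall x, P x} -> {ae m, forall x, P x}.
Proof.
move=> [N [mN N0 PN]]; exists N; split=> //.
move: N0; rewrite /mscale /= => /eqP; rewrite mule_eq0 => /orP[|/eqP//].
by rewrite eqe gt_eqF.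
Qed.

End measure_scaling.

Section mpres_mscale.
Context d1 d2 (T1 : measurableType d1) (T2 : measurableType d2) (R : realType).
Variables (m1 : {measure set T1 -> \bar R}) (m2 : {measure set T2 -> \bar R}).
Variables (c : R) (c_gt0 : 0 < c) (Phi : T1 -> T2).
Hypothesis mP : mpres (mscale (NngNum (ltW c_gt0)) m1) m2 Phi.

Lemma cintegrable_mpres_mscale (F : T2 -> R[i]) : cintegrable m2 F ->
  cintegrable m1 (fun x => F (Phi x)).
Proof.
move=> iF; apply/(cintegrable_mscale m1 c_gt0).
exact: ((cintegrable_mpres mP (cintegrable_cmeas iF)).1 iF).
Qed.

Lemma cintegral_mpres_mscale (F : T2 -> R[i]) : cintegrable m2 F ->
  cintegral m2 F = c%:C * cintegral m1 (fun x => F (Phi x)).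
Proof.
move=> iF; rewrite (cintegral_mpres mP iF); apply: cintegral_mscale.
exact: cintegrable_mpres_mscale.
Qed.

Lemma ae_mpres_mscale (P : T2 -> Prop) : {ae m2, forall y, P y} ->
  {ae m1, forall x, P (Phi x)}.
Proof. by move=> /(ae_mpres mP); exact: ae_mscale. Qed.

End mpres_mscale.

(** * Scaling of R^n and of the dual momentum *)

Section scaling.
Variables (R : realType) (n : nat) (h : R) (h_gt0 : 0 < h).
Local Notation V := 'rV[R]_n.
Local Notation mu := (lebesgue_rV R n).
Local Notation mu2 := (lebesgue_rV2 R n).

Lemma mpres_rVZ :
  mpres (mscale (NngNum (ltW (exprn_gt0 n h_gt0))) mu) mu (fun x : V => h *: x).
Proof.
split; first by mtac.
by move=> A mA; exact: lebesgue_rV_scale.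
Qed.

Definition scale2 (z : V * V) : V * V := (z.1, h *: z.2).

Lemma mpres_scale2 :
  mpres (mscale (NngNum (ltW (exprn_gt0 n h_gt0))) mu2) mu2 scale2.
Proof.
apply: mpres_rect; first by rewrite /scale2; mtac.
move=> A B mA mB.
have mB' : measurable ((fun x : V => h *: x) @^-1` B).
  by rewrite -[X in measurable X]setTI; exact: mpres_rVZ.1.
have -> : scale2 @^-1` (A `*` B) = A `*` ((fun x : V => h *: x) @^-1` B) by [].
rewrite -[LHS]/((h ^+ n)%:E * (mu \x mu)%E (A `*` ((fun x : V => h *: x) @^-1` B)))%E.
by rewrite product_measure1E// -(lebesgue_rV_scale h_gt0 mB) muleCA.
Qed.

End scaling.

(** * The symbol of a distribution function *)

Section phase_space_symbol.
Variables (R : realType) (n : nat) (hbar : R) (theta : 'M[R]_n).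
Variables (f : 'rV[R]_n -> 'rV[R]_n -> R).
Hypothesis hbar_gt0 : 0 < hbar.
Local Notation V := 'rV[R]_n.
Local Notation mu := (lebesgue_rV R n).
Local Notation mu2 := (lebesgue_rV2 R n).
Local Notation fC := (fun x p => (f x p)%:C).
Hypothesis f_int : cintegrable mu2 (fun z => (f z.1 z.2)%:C).
Hypothesis ft_int : cintegrable mu2 (fun z => fourier2 fC z.1 z.2).
Let mp2 := measurable_pairing_prod (@measurable_dot_pairing R n) (@measurable_dot_pairing R n).
Let pC2 := pairing_prodC (@dotC R n) (@dotC R n).

Definition phase_ft (z : V * V) : R[i] := fourier2 fC z.1 z.2.
Local Notation a := phase_ft.

(* Dividing the dual momentum by hbar turns the phase of [star] into [cocycle], which is free
   of hbar. *)
Definition wsymbol (z : V * V) : R[i] := a (scale2 hbar^-1 z).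
Local Notation alpha := wsymbol.

Let hV_gt0 : 0 < hbar^-1. Proof. by rewrite invr_gt0. Qed.

Lemma phase_ftE z : a z = ft mu2 (@dot2 R n) (fun z => (f z.1 z.2)%:C) z.
Proof. by congr cintegral; apply/funext => y; rewrite /dot2 opprD. Qed.

Lemma phase_ftE_fun : a = ft mu2 (@dot2 R n) (fun z => (f z.1 z.2)%:C).
Proof. by apply/funext => z; exact: phase_ftE. Qed.

Lemma scale2K z : scale2 hbar^-1 (scale2 hbar z) = z :> V * V.
Proof. by case: z => k l; rewrite /scale2 /= scalerA mulVf ?scale1r ?gt_eqF. Qed.

Lemma scale2VK z : scale2 hbar (scale2 hbar^-1 z) = z :> V * V.
Proof. by case: z => k l; rewrite /scale2 /= scalerA mulfV ?scale1r ?gt_eqF. Qed.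

Lemma cintegrable_wsymbol : cintegrable mu2 alpha.
Proof. exact: (cintegrable_mpres_mscale (mpres_scale2 n hV_gt0) ft_int). Qed.

(** Since f is real, the conjugate of its transform is its inverse transform, which is the transform
    at the opposite point. *)
Lemma wsymbol_opp z : alpha (zopp z) = (alpha z)^*%C.
Proof.
rewrite /alpha !phase_ftE -(ift_conj mp2 pC2)//.
congr cintegral; apply/funext => y; rewrite conj_real /dot2 /scale2 /zopp /=.
by congr (expi _ * _); rewrite /pairing_prod /= !dotE (dotC y.1) (dotC y.2); ring.
Qed.

Lemma wsymbol_bounded : exists B, forall z, cabs (alpha z) <= B.
Proof.
exists (2 * \int[mu2]_z cabs ((f z.1 z.2)%:C)) => z.
by rewrite /alpha phase_ftE; exact: (cabs_ft mp2).
Qed.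

Lemma cintegrable_wsymbol_sq : cintegrable mu2 (fun z => alpha z * (alpha z)^*%C).
Proof.
have [B aB] := wsymbol_bounded; have ia := cintegrable_wsymbol.
exact: (cintegrable_bmul (cintegrable_cmeas ia) aB (cintegrable_conj ia)).
Qed.

Definition scocycle (z z' : V * V) : R := cocycle theta (scale2 hbar z) (scale2 hbar z').

Lemma measurable_scocycle d (T : measurableType d) (g h : T -> V * V) :
  measurable_fun setT g -> measurable_fun setT h ->
  measurable_fun setT (fun t => scocycle (g t) (h t)).
Proof. by move=> mg mh; apply: measurable_cocycle; rewrite /scale2; mtac. Qed.

Let tconv_int : cintegrable (mu2 \x mu2)%E (fun w : (V * V) * (V * V) =>
  expi (scocycle w.2 (zsub w.1 w.2)) * (a w.2 * a (zsub w.1 w.2))).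
Proof.
have msh : mpres (mu2 \x mu2)%E (mu2 \x mu2)%E
    (fun w : (V * V) * (V * V) => (w.1, zsub w.2 w.1)).
  apply: mpres_shear; first by rewrite /zsub; mtac.
  by move=> z; exact: mpres_zsubr.
have it := cintegrable_tensor ft_int ft_int.
have h := (cintegrable_mpres msh (cintegrable_cmeas it)).1 it.
apply: cintegrable_expi (cintegrable_swap h).
by apply: measurable_scocycle; rewrite /zsub; mtac.
Qed.

(** The twisted convolution of the transform of f with itself: up to a constant, f * f is its
    inverse transform. *)
Definition tconv (z : V * V) : R[i] := cintegral mu2 (fun z' =>
  expi (scocycle z' (zsub z z')) * (a z' * a (zsub z z'))).

Lemma cintegrable_tconv : cintegrable mu2 tconv.
Proof. exact: (cintegrable_slice tconv_int). Qed.

(** The exponential in x and p depends only on the sum of the two dual points. With that sum as a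
    new variable, the cocycle and the two transforms form the inner integral [tconv]. *)
Lemma star_tconv x p : star hbar theta fC fC x p =
  (((2 * pi) ^+ (4 * n))^-1)%:C * ift mu2 (@dot2 R n) tconv (x, p).
Proof.
have msh : mpres (mu2 \x mu2)%E (mu2 \x mu2)%E
    (fun w : (V * V) * (V * V) => (w.1, zsub w.2 w.1)).
  apply: mpres_shear; first by rewrite /zsub; mtac.
  by move=> z; exact: mpres_zsubr.
congr (_ * _).
pose F (w : (V * V) * (V * V)) := expi (dot2 (zadd w.1 w.2) (x, p)) *
  (expi (scocycle w.1 w.2) * (a w.1 * a w.2)).
have iF : cintegrable (mu2 \x mu2)%E F.
  apply: cintegrable_expi; first by rewrite /dot2 /zadd; mtac.
  apply: cintegrable_expi; last exact: cintegrable_tensor.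
  by apply: measurable_scocycle; mtac.
transitivity (cintegral (mu2 \x mu2)%E F).
  congr cintegral; apply/funext => -[[k l] [k' l']]; rewrite /F /a /=.
  rewrite /scocycle /cocycle /scale2 /dot2 /zadd /=.
  rewrite [RHS]mulrA -expiD -!mulrA -!expiD mulrA [RHS]mulrC; congr (_ * expi _).
  by rewrite !dotE; field.
rewrite (cintegral_mpres msh iF).
have iF' := (cintegrable_mpres msh (cintegrable_cmeas iF)).1 iF.
rewrite cintegral_fubini// (cintegral_swap iF') /=.
have meas2 : measurable_fun setT (fun z => dot2 z (x, p)) by rewrite /dot2; mtac.
have meas21 : measurable_fun setT (fun w : (V * V) * (V * V) => dot2 w.1 (x, p)).
  by rewrite /dot2; mtac.
have E := cintegral_fubini_expi1 tconv_int meas2.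
rewrite (cintegral_fubini (cintegrable_expi meas21 tconv_int)) in E.
rewrite -[RHS]E.
congr cintegral; apply/funext => z; congr cintegral; apply/funext => z'.
rewrite /F /=; congr (expi (dot2 _ _) * _).
by case: z z' => [k l] [k' l']; rewrite /zadd /zsub /= !(addrC k') !(addrC l') !subrK.
Qed.

Variable kappa : R.
Hypothesis f_star : forall x p, star hbar theta fC fC x p = (kappa * f x p)%:C.

Let pi4 : ((2 * pi) ^+ (4 * n))^-1 = ((2 * pi) ^+ (2 * n))^-1 * ((2 * pi) ^+ (2 * n))^-1 :> R.
Proof. by rewrite -invfM -exprD -mulnDl. Qed.

Let p2n : (2 * pi) ^+ (2 * n) != 0 :> R.
Proof. by rewrite gt_eqF// exprn_gt0// twopi_gt0. Qed.

(** Up to a common constant, the inverse transform of the left side is f * f by [star_tconv] and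
    that of the right side is kappa f almost everywhere by inversion; the inverse transform is
    injective on integrable functions. *)
Lemma ae_tconv : {ae mu2, forall z, tconv z = ((2 * pi) ^+ (2 * n) * kappa)%:C * a z}.
Proof.
have it := cintegrable_tconv.
have iza : cintegrable mu2 (fun z => ((2 * pi) ^+ (2 * n) * kappa)%:C * a z).
  exact: cintegrableZ.
have ifa : cintegrable mu2 (ft mu2 (@dot2 R n) (fun z => (f z.1 z.2)%:C)).
  by rewrite -phase_ftE_fun.
have inv : {ae mu2, forall z, ift mu2 (@dot2 R n) a z =
    ((2 * pi) ^+ (2 * n))%:C * (f z.1 z.2)%:C}.
  by rewrite phase_ftE_fun; exact: (@rV2_fourier_inversion R n).
have iw : cintegrable mu2 (fun z => tconv z - ((2 * pi) ^+ (2 * n) * kappa)%:C * a z).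
  by apply: cintegrableD => //; exact: cintegrableN.
have := ift_inj mp2 pC2 p2n (@rV2_fourier_inversion R n) iw _.
move=> h; apply: filterS (h _) => [z /eqP|]; first by rewrite subr_eq0 => /eqP.
apply: filterS inv => -[x p] /= E.
rewrite (_ : ift _ _ _ (x, p) = ift mu2 (@dot2 R n) tconv (x, p) -
    ((2 * pi) ^+ (2 * n) * kappa)%:C * ift mu2 (@dot2 R n) a (x, p)).
  have := f_star x p; rewrite star_tconv => /(congr1 (fun w => ((2 * pi) ^+ (4 * n))%:C * w)).
  rewrite mulrA -rmorphM /= mulfV ?mul1r; last by rewrite gt_eqF// exprn_gt0// twopi_gt0.
  move=> ->; rewrite E -!rmorphM -rmorphB.
  rewrite (_ : (4 * n = 2 * n + 2 * n)%N) ?exprD; last by rewrite -mulnDl.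
  by rewrite (_ : _ - _ = 0)//; ring.
rewrite -(iftZ mp2)// /ift -cintegralB.
- by congr cintegral; apply/funext => z; rewrite mulrBr.
- exact: (cintegrable_ift mp2).
- exact: (cintegrable_ift mp2).
Qed.

(** Inversion alone would give this almost everywhere. But f * f is an inverse transform at every
    point, and replacing [tconv] by its almost everywhere value makes it kappa times the normalized
    inverse transform of [a]; since f * f = kappa f at every point, kappa cancels. *)
Lemma phase_inversion x p : kappa != 0 ->
  (f x p)%:C = (((2 * pi) ^+ (2 * n))^-1)%:C * ift mu2 (@dot2 R n) a (x, p).
Proof.
move=> k0; have iza : cintegrable mu2 (fun z => ((2 * pi) ^+ (2 * n) * kappa)%:C * a z).
  exact: cintegrableZ.
have := f_star x p; rewrite star_tconv.
rewrite (ae_eq_ift mp2 (x, p) (cintegrable_cmeas cintegrable_tconv) (cintegrable_cmeas iza) ae_tconv).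
rewrite (iftZ mp2)// mulrA -rmorphM pi4 /= => E.
have kC : kappa%:C != 0 :> R[i].
  by apply/eqP => /(congr1 (@complex.Re R)) /= /eqP; rewrite (negbTE k0).
apply: (mulfI kC); rewrite -rmorphM /= -E [RHS]mulrA -rmorphM /=; congr (_%:C * _).
by field.
Qed.

(** Rescaling the integration variable contributes hbar^n, and (2 pi)^(2n) kappa hbar^n is regrouped
    as (2 pi)^n times kappa (2 pi hbar)^n, which is 1/lam. *)
Lemma ae_twisted : {ae mu2, forall z, cintegral mu2 (fun z' =>
    alpha z' * alpha (zsub z z') * expi (cocycle theta z' (zsub z z'))) =
  ((2 * pi) ^+ n * (kappa * (2 * pi * hbar) ^+ n))%:C * alpha z}.
Proof.
have hn : 0 < hbar by [].
have it := cintegrable_tensor ft_int ft_int.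
(* The identity travels together with the integrability of its integrand, because the rescaling
   needs both at the same point. *)
have tw0 : {ae mu2, forall z, tconv z = ((2 * pi) ^+ (2 * n) * kappa)%:C * a z /\
    cintegrable mu2 (fun z' => expi (scocycle z' (zsub z z')) * (a z' * a (zsub z z')))}.
  by apply: filterS2 ae_tconv (ae_cintegrable1 tconv_int) => z.
have tw : {ae mu2, forall z, tconv (scale2 hbar^-1 z) =
    ((2 * pi) ^+ (2 * n) * kappa)%:C * a (scale2 hbar^-1 z) /\
    cintegrable mu2 (fun z' => expi (scocycle z' (zsub (scale2 hbar^-1 z) z')) *
      (a z' * a (zsub (scale2 hbar^-1 z) z')))}.
  exact: (ae_mpres_mscale (mpres_scale2 n hV_gt0) tw0).
apply: filterS tw => z [/= E ic].
have ic' : cintegrable mu2 (fun z' => alpha z' * alpha (zsub z z') *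
    expi (cocycle theta z' (zsub z z'))).
  have := cintegrable_mpres_mscale (mpres_scale2 n hV_gt0) ic.
  congr (cintegrable _ _); apply/funext => z' /=.
  have -> : zsub (scale2 hbar^-1 z) (scale2 hbar^-1 z') = scale2 hbar^-1 (zsub z z').
    by rewrite /zsub /scale2 /= scalerBr.
  by rewrite /scocycle !scale2VK mulrC.
rewrite (cintegral_mpres_mscale (mpres_scale2 n hn) ic').
rewrite (_ : (fun z' => _) = (fun z' => expi (scocycle z' (zsub (scale2 hbar^-1 z) z')) *
    (a z' * a (zsub (scale2 hbar^-1 z) z')))).
  rewrite -/(tconv (scale2 hbar^-1 z)) E mulrA -rmorphM /=; congr (_%:C * _).
  rewrite !exprMn (_ : (2 * n = n + n)%N) ?exprD; last by rewrite mul2n addnn.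
  ring.
apply/funext => z'; rewrite /alpha scale2K.
have -> : zsub z (scale2 hbar z') = scale2 hbar (zsub (scale2 hbar^-1 z) z').
  by rewrite -{1}(scale2VK z) /zsub /scale2 /= scalerBr.
by rewrite scale2K /scocycle mulrC.
Qed.

End phase_space_symbol.

(** * The kernel G and its normalization *)

Section kernel.
Variables (R : realType) (n : nat) (hbar : R) (theta : 'M[R]_n).
Variables (f : 'rV[R]_n -> 'rV[R]_n -> R).
Hypothesis hbar_gt0 : 0 < hbar.
Local Notation V := 'rV[R]_n.
Local Notation mu := (lebesgue_rV R n).
Local Notation mu2 := (lebesgue_rV2 R n).
Local Notation fC := (fun x p => (f x p)%:C).
Hypothesis f_int : cintegrable mu2 (fun z => (f z.1 z.2)%:C).
Hypothesis ft_int : cintegrable mu2 (fun z => fourier2 fC z.1 z.2).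
Local Notation alpha := (wsymbol hbar f).
Let mp := @measurable_dot_pairing R n.
Let pC := @dotC R n.
Let ia := cintegrable_wsymbol hbar_gt0 ft_int.

Variable G : V -> V -> R[i].
Hypothesis G_def : forall x w, G (x - (hbar / 2) *: w) (x + (hbar / 2) *: w)
  = cintegral mu (fun p => expi (- dot w p) * (f x p)%:C).

Definition kslice l y : R[i] := G y (l + y).

Definition momentum_ft (x w : V) : R[i] := fourier (fun p => (f x p)%:C) w.

(** The points y and l + y have midpoint y + l/2 and difference l = hbar w. *)
Lemma ksliceE l y : kslice l y = momentum_ft (y + 2^-1 *: l) (hbar^-1 *: l).
Proof.
rewrite /momentum_ft /fourier -G_def /kslice scalerA.
have -> : hbar / 2 * hbar^-1 = 2^-1 by field; rewrite gt_eqF.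
have E : 2^-1 *: l + 2^-1 *: l = l.
  by rewrite -scalerDl (_ : 2^-1 + 2^-1 = 1 :> R) ?scale1r//; field.
by rewrite addrK -addrA E addrC.
Qed.

Let iexpf w : cintegrable mu2 (fun z : V * V => expi (- dot w z.2) * (f z.1 z.2)%:C).
Proof. by apply: cintegrable_expi => //; mtac. Qed.

Lemma cintegrable_momentum_ft w : cintegrable mu (fun x => momentum_ft x w).
Proof. exact: (cintegrable_slice (iexpf w)). Qed.

Lemma fourier_momentum_ft k w : fourier (fun x => momentum_ft x w) k = phase_ft f (k, w).
Proof.
have mk : measurable_fun setT (fun x => - dot k x) by mtac.
rewrite [LHS]/fourier -[LHS](cintegral_fubini_expi1 (iexpf w) mk).
by congr cintegral; apply/funext => z; rewrite mulrA -expiD.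
Qed.

Lemma kslice_fun l : kslice l = fun y => momentum_ft (y + 2^-1 *: l) (hbar^-1 *: l).
Proof. by apply/funext => y; exact: ksliceE. Qed.

Lemma cintegrable_kslice l : cintegrable mu (kslice l).
Proof.
rewrite kslice_fun.
exact: (cintegrable_shift (2^-1 *: l) (cintegrable_momentum_ft (hbar^-1 *: l))).
Qed.

(** The link between kernel and symbol: transforming in position completes the momentum transform in
    the definition of G to the phase-space transform of f. The half phase comes from the midpoint y
    + l/2. *)
Lemma fourier_kslice l k : fourier (kslice l) k = expi (dot k l / 2) * alpha (k, l).
Proof.
rewrite kslice_fun (fourier_shift (2^-1 *: l) k (cintegrable_momentum_ft (hbar^-1 *: l))).
by rewrite fourier_momentum_ft dotZr (mulrC 2^-1).
Qed.

Lemma ae_wsymbol_slice : {ae mu, forall l, cintegrable mu (fun k => alpha (k, l))}.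
Proof. exact: (ae_cintegrable1 (cintegrable_swap ia)). Qed.

Lemma fourier_integrable_kslice l : cintegrable mu (fun k => alpha (k, l)) ->
  fourier_integrable (kslice l).
Proof.
move=> il; split; first exact: cintegrable_kslice.
rewrite (_ : fourier (kslice l) = fun k => expi (dot k l / 2) * alpha (k, l)).
  by apply: cintegrable_expi => //; mtac.
by apply/funext => k; exact: fourier_kslice.
Qed.

Variable kappa : R.
Hypothesis G_sqint : cintegrable mu2 (fun z => `|G z.1 z.2| ^+ 2).
Hypothesis G_norm : cintegral mu2 (fun z => `|G z.1 z.2| ^+ 2)
  = (kappa * (2 * pi * hbar) ^+ n)%:C.

Let shG : mpres (mu \x mu)%E mu2 (fun z : V * V => (z.2, z.1 + z.2)).
Proof.
have := mpres_comp (mpres_swap mu mu) (mpres_shearD R n).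
by rewrite (_ : _ \o _ = (fun z : V * V => (z.2, z.1 + z.2)))//; apply/funext => -[x y] /=; rewrite addrC.
Qed.

Let iG : cintegrable (mu \x mu)%E (fun z : V * V => kslice z.1 z.2 * (kslice z.1 z.2)^*%C).
Proof.
have := (cintegrable_mpres shG (cintegrable_cmeas G_sqint)).1 G_sqint.
by congr (cintegrable _ _); apply/funext => z; rewrite sqr_normc.
Qed.

(** Plancherel in y applies at almost every l, where alpha(., l) is integrable; the integral over l
    is then that of |G|^2 in sheared coordinates. *)
Lemma cintegral_wsymbol_sq : cintegral mu2 (fun z => alpha z * (alpha z)^*%C) =
  ((2 * pi) ^+ n * (kappa * (2 * pi * hbar) ^+ n))%:C.
Proof.
have isq := cintegrable_wsymbol_sq hbar_gt0 f_int ft_int.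
have E0 := cintegral_fubini isq.
have E1 := cintegral_swap isq.
have E2 : cintegral mu (fun l => cintegral mu (fun k => alpha (k, l) * (alpha (k, l))^*%C)) =
    ((2 * pi) ^+ n)%:C * cintegral mu (fun l => cintegral mu (fun y =>
      kslice l y * (kslice l y)^*%C)).
  rewrite -cintegralZ; last exact: (cintegrable_slice iG).
  apply: ae_eq_cintegral.
  - exact: (cmeas_slice mu (cintegrable_cmeas (cintegrable_swap isq))).
  - apply: cmeasM; first exact: cmeas_cst.
    exact: (cmeas_slice mu (cintegrable_cmeas iG)).
  apply: filterS ae_wsymbol_slice => l il.
  rewrite -(plancherel (fourier_integrable_kslice il) (cintegrable_kslice l)).
  congr cintegral; apply/funext => k; rewrite fourier_kslice conjcM conj_expi.
  transitivity (expi (dot k l / 2) * expi (- (dot k l / 2)) * (alpha (k, l) * (alpha (k, l))^*%C)).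
    by rewrite -expiD subrr expi0 mul1r.
  by move: (alpha (k, l)) => b; ring.
have E3 := cintegral_fubini iG.
have E4 := cintegral_mpres shG G_sqint.
rewrite E0 E1 E2 -E3 rmorphM; congr (_ * _); rewrite -[RHS]G_norm E4.
by congr cintegral; apply/funext => z; rewrite sqr_normc.
Qed.

Hypothesis f_total : cintegral mu2 (fun z => (f z.1 z.2)%:C) = 1.

(** [cintegral_wsymbol_sq] writes a positive multiple of kappa as the integral of |alpha|^2, so
    kappa >= 0. If kappa were 0, then alpha and by injectivity f would vanish almost everywhere,
    against the total integral 1. *)
Lemma kappa_gt0 : 0 < kappa.
Proof.
have hn : 0 < (2 * pi * hbar) ^+ n by rewrite exprn_gt0// mulr_gt0// twopi_gt0.
have pn : 0 < (2 * pi) ^+ n :> R by rewrite exprn_gt0// twopi_gt0.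
have isq := cintegrable_wsymbol_sq hbar_gt0 f_int ft_int.
rewrite lt_neqAle; apply/andP; split; last first.
  have := cintegral_normsq_ge0 mu2 alpha; rewrite cintegral_wsymbol_sq /=.
  by rewrite pmulr_rge0// pmulr_lge0.
apply/eqP => k0; have := cintegral_wsymbol_sq; rewrite -k0 mul0r mulr0 => a0.
have aa0 := cintegral_normsq_eq0 (cintegrable_cmeas ia) isq a0.
have a0' : {ae mu2, forall z, phase_ft f z = 0}.
  have := ae_mpres_mscale (mpres_scale2 n hbar_gt0) aa0.
  by apply: filterS => z; rewrite /wsymbol scale2K.
have f0 : {ae mu2, forall z, (f z.1 z.2)%:C = 0 :> R[i]}.
  have mp2 := measurable_pairing_prod mp mp.
  apply: (ft_inj mp2 _ (@rV2_fourier_inversion R n) f_int).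
    by rewrite gt_eqF// exprn_gt0// twopi_gt0.
  by rewrite -phase_ftE_fun.
have : cintegral mu2 (fun z => (f z.1 z.2)%:C) = 0 :> R[i].
  rewrite -(cintegral0 mu2); apply: ae_eq_cintegral.
  - exact: cintegrable_cmeas f_int.
  - exact: cmeas_cst.
  - exact: f0.
by rewrite f_total => /eqP; rewrite oner_eq0.
Qed.

End kernel.

(** * Eigenfunctions of the kernel *)

Section eigenfunctions.
Variables (R : realType) (n : nat) (hbar : R) (theta : 'M[R]_n).
Variables (f : 'rV[R]_n -> 'rV[R]_n -> R).
Hypothesis hbar_gt0 : 0 < hbar.
Local Notation V := 'rV[R]_n.
Local Notation mu := (lebesgue_rV R n).
Local Notation mu2 := (lebesgue_rV2 R n).
Local Notation fconst := (@fconst R n).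
Local Notation fC := (fun x p => (f x p)%:C).
Hypothesis f_int : cintegrable mu2 (fun z => (f z.1 z.2)%:C).
Hypothesis ft_int : cintegrable mu2 (fun z => fourier2 fC z.1 z.2).
Local Notation alpha := (wsymbol hbar f).
Let mp := @measurable_dot_pairing R n.
Let pC := @dotC R n.
Let ia := cintegrable_wsymbol hbar_gt0 ft_int.

Variable G : V -> V -> R[i].
Hypothesis G_def : forall x w, G (x - (hbar / 2) *: w) (x + (hbar / 2) *: w)
  = cintegral mu (fun p => expi (- dot w p) * (f x p)%:C).

Lemma star_thetaE (u v : V -> R[i]) x : star_theta theta u v x = fconst * fconst *
  cintegral mu2 (fun z => expi (dot (z.1 + z.2) x - form theta z.1 z.2 / 2) *
    (fourier u z.1 * fourier v z.2)).
Proof.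
rewrite /star_theta /fconst -rmorphM -invfM -exprD addnn -mul2n; congr (_ * _).
congr cintegral; apply/funext => z; rewrite expiD; ring.
Qed.

(** At fixed k the phase of theta(k, k') translates the argument of the second factor by -k theta/2,
    and the integral over k' is a Fourier integral. *)
Lemma star_theta_ift (u v : V -> R[i]) x :
  cintegrable mu (fourier u) -> cintegrable mu (fourier v) ->
  star_theta theta u v x = fconst * cintegral mu (fun k =>
    expi (dot k x) * fourier u k *
    inv_fourier (fourier v) (x - 2^-1 *: (k *m theta))).
Proof.
move=> iu iv; rewrite star_thetaE -mulrA; congr (_ * _).
have iF : cintegrable mu2 (fun z : V * V =>
    expi (dot (z.1 + z.2) x - dot (z.1 *m theta) z.2 / 2) * (fourier u z.1 * fourier v z.2)).
  by apply: cintegrable_expi; [mtac|exact: cintegrable_tensor].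
have eF : (fun z : V * V => expi (dot (z.1 + z.2) x - form theta z.1 z.2 / 2) *
    (fourier u z.1 * fourier v z.2)) = (fun z : V * V =>
    expi (dot (z.1 + z.2) x - dot (z.1 *m theta) z.2 / 2) * (fourier u z.1 * fourier v z.2)).
  by apply/funext => z; rewrite dot_mulmx.
rewrite eF; have E := cintegral_fubini iF.
rewrite [X in fconst * X = _]E -cintegralZ; last exact: (cintegrable_slice iF).
congr cintegral; apply/funext => k; rewrite /inv_fourier mulrCA; congr (_ * _).
rewrite /ift -cintegralZ; last exact: (cintegrable_ift mp).
congr cintegral; apply/funext => k' /=.
rewrite [RHS]mulrACA -expiD; congr (expi _ * _).
by rewrite !dotE (dotC k' (_ *m _)); field.
Qed.

(** The star product uses u only through its Fourier transform, so u enters as its regular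
    representative [inv_fourier (fourier u)]. The half phase of the slice and the translations by l
    and -k theta/2 assemble to the Weyl operator W_(k,l). *)
Lemma star_kslice u x l : cintegrable mu (fun k => alpha (k, l)) -> fourier_integrable u ->
  star_theta theta (kslice G l) (fun y => u (l + y)) x =
  fconst * cintegral mu (fun k => alpha (k, l) * weyl theta (k, l) (inv_fourier (fourier u)) x).
Proof.
move=> il [iu ifu].
have fuE k : fourier (fun y => u (l + y)) k = expi (dot k l) * fourier u k.
  rewrite -(fourier_shift l k iu); congr (fourier _ _).
  by apply/funext => y; rewrite addrC.
have ifl : cintegrable mu (fourier (fun y => u (l + y))).
  have -> : fourier (fun y => u (l + y)) = fun k => expi (dot k l) * fourier u k.
    by apply/funext => k; exact: fuE.
  by apply: cintegrable_expi => //; mtac.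
have [_ ig] := fourier_integrable_kslice hbar_gt0 f_int G_def il.
rewrite (star_theta_ift x ig ifl); congr (_ * _); congr cintegral; apply/funext => k.
rewrite (fourier_kslice hbar_gt0 f_int G_def) /weyl /wphase /=.
have -> : inv_fourier (fourier (fun y => u (l + y))) (x - 2^-1 *: (k *m theta)) =
    inv_fourier (fourier u) (x + wshift theta (k, l)).
  have -> : fourier (fun y => u (l + y)) = fun k => expi (dot k l) * fourier u k.
    by apply/funext => k'; exact: fuE.
  rewrite /inv_fourier; congr (_ * _); rewrite /ift.
  have -> // : (fun k' => expi (dot k' (x - 2^-1 *: (k *m theta))) *
      (expi (dot k' l) * fourier u k')) =
      (fun k' => expi (dot k' (x + wshift theta (k, l))) * fourier u k').
  apply/funext => k'; rewrite mulrA -expiD /wshift; congr (expi _ * _).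
  by rewrite !dotE; ring.
by rewrite expiD; ring.
Qed.

Lemma cintegral_star_kslice u x : fourier_integrable u ->
  cintegral mu (fun l => star_theta theta (kslice G l) (fun y => u (l + y)) x) =
  wop theta alpha (inv_fourier (fourier u)) x.
Proof.
move=> fu; have [iu ifu] := fu.
have mw : cmeas (fun z : V * V => alpha z * weyl theta z (inv_fourier (fourier u)) x).
  apply: cmeasM; first exact: cintegrable_cmeas ia.
  apply: (@cmeas_weyl_comp _ _ theta _ _ (fun z : V * V => z)); first exact: measurable_id.
  apply: cmeasM; first exact: cmeas_cst.
  by apply: (cmeas_ift _ mp pC); exact: cintegrable_cmeas ifu.
have iw : cintegrable mu2 (fun z => alpha z * weyl theta z (inv_fourier (fourier u)) x).
  under eq_fun do rewrite mulrC.
  apply: (@cintegrable_bmul _ _ _ _ _ _ (2 * (cabs fconst * (2 * \int[mu]_k cabs (fourier u k))))) => //.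
    apply: (@cmeas_weyl_comp _ _ theta _ _ (fun z : V * V => z)); first exact: measurable_id.
    apply: cmeasM; first exact: cmeas_cst.
    by apply: (cmeas_ift _ mp pC); exact: cintegrable_cmeas ifu.
  move=> z; rewrite (le_trans (cabs_expiM _ _))// ler_wpM2l//.
  rewrite (le_trans (cabsM _ _))// ler_wpM2l ?cabs_ge0//.
  exact: (cabs_ift mp).
have is_ := cintegrable_swap iw.
have E1 := cintegral_fubini iw.
have E2 := cintegral_swap iw.
rewrite /wop E1 E2.
rewrite -cintegralZ; last exact: (cintegrable_slice is_).
apply: ae_eq_cintegral; last first.
- apply: filterS (ae_wsymbol_slice hbar_gt0 ft_int) => l il.
  exact: star_kslice.
- apply: cmeasM; first exact: cmeas_cst.
  exact: (cmeas_slice mu (cintegrable_cmeas is_)).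
(* [star_kslice] covers almost every l only, so measurability in l needs an expression valid for
   every l. *)
have -> : (fun l => star_theta theta (kslice G l) (fun y => u (l + y)) x) = (fun l =>
    fconst * fconst * cintegral mu2 (fun z : V * V =>
      expi (dot (z.1 + z.2) x - dot (z.1 *m theta) z.2 / 2) *
      (expi (dot z.1 l / 2) * alpha (z.1, l) * (expi (dot z.2 l) * fourier u z.2)))).
  apply/funext => l; rewrite star_thetaE; congr (_ * _); congr cintegral; apply/funext => z.
  rewrite (fourier_kslice hbar_gt0 f_int G_def) dot_mulmx -(fourier_shift l z.2 iu).
  have -> : (fun y => u (y + l)) = (fun y => u (l + y)) by apply/funext => y; rewrite addrC.
  by [].
apply: cmeasM; first exact: cmeas_cst.
apply: (@cmeas_slice _ _ _ _ _ mu2 (fun t : V * (V * V) =>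
  expi (dot (t.2.1 + t.2.2) x - dot (t.2.1 *m theta) t.2.2 / 2) *
  (expi (dot t.2.1 t.1 / 2) * alpha (t.2.1, t.1) * (expi (dot t.2.2 t.1) * fourier u t.2.2)))).
apply: cmeasM; first by apply: cmeas_expi; mtac.
apply: cmeasM; apply: cmeasM.
- by apply: cmeas_expi; mtac.
- apply: (cmeas_comp (Phi := fun t : V * (V * V) => (t.2.1, t.1)) _ (cintegrable_cmeas ia)).
  by mtac.
- by apply: cmeas_expi; mtac.
- apply: (cmeas_comp (Phi := fun t : V * (V * V) => t.2.2) _ (cintegrable_cmeas ifu)).
  by mtac.
Qed.

Variable kappa : R.
Hypothesis f_star : forall x p, star hbar theta fC fC x p = (kappa * f x p)%:C.
Hypothesis kappa_gt0 : 0 < kappa.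
Local Notation lam := (kappa * (2 * pi * hbar) ^+ n)^-1.

Lemma regular_inv_fourierK (u : V -> R[i]) : regular u -> inv_fourier (fourier u) = u.
Proof. by move=> [_ uE]; apply/funext => x; rewrite -uE. Qed.

Lemma lam_gt0 : 0 < lam.
Proof. by rewrite invr_gt0 mulr_gt0// exprn_gt0// mulr_gt0// twopi_gt0. Qed.

Lemma fourier_integrable_regular (u : V -> R[i]) : fourier_integrable u -> regular (inv_fourier (fourier u)).
Proof.
move=> fu; have [iu ifu] := fu.
have mo : cmeas (inv_fourier (fourier u)).
  apply: cmeasM; first exact: cmeas_cst.
  by apply: (cmeas_ift _ mp pC); exact: cintegrable_cmeas ifu.
have io : cintegrable mu (inv_fourier (fourier u)).
  apply: (ae_cintegrable mo _ iu); apply: filterS (ae_inv_fourier fu) => x ->.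
  by [].
exact: (regular_inv_fourier ifu io (fun=> erefl)).1.
Qed.

(** The integral in the eigenvalue equation is T applied to the regular representative of u. Being
    lam' times a value of [wop], u is itself regular and coincides with that representative. *)
Lemma eigenfunctionP lam' u : eigenfunction theta G lam' u <->
  [/\ regular u, exists x, u x != 0 & forall x, u x = lam' * wop theta alpha u x].
Proof.
split=> [[fu u0 uE]|[ru u0 uE]].
  have ru : regular u.
    rewrite (_ : u = fun x => lam' * wop theta alpha (inv_fourier (fourier u)) x).
      apply: regularZ; apply: (regular_wop theta ia _).1.
      exact: fourier_integrable_regular.
    apply/funext => x; rewrite -cintegral_star_kslice//; exact: uE.
  by split=> // x; rewrite -{2}(regular_inv_fourierK ru) -cintegral_star_kslice//.
have fu : fourier_integrable u by case: ru.
by split=> // x; rewrite uE -[in LHS](regular_inv_fourierK ru) -cintegral_star_kslice//.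
Qed.

(** From u = lam' T u and T T = T / lam follows u = (lam' / lam) u, evaluated where u is nonzero. *)
Lemma eigenfunction_eigenvalue lam' u : eigenfunction theta G lam' u -> lam' = lam%:C.
Proof.
move=> /eigenfunctionP[ru [x0 ux0] uE].
have rT := (regular_wop theta ia ru).1.
have tw := ae_twisted hbar_gt0 f_int ft_int f_star.
have E x : u x = lam' * lam%:C^-1 * u x.
  have TT := wop_comp x ia ru tw.
  have := wop_sum theta [:: tt] (fun=> lam') x ia (fun=> rT).
  rewrite (_ : (fun y => \sum_(i <- _) _) = u); last first.
    by apply/funext => y; rewrite big_cons big_nil addr0 -uE.
  rewrite big_cons big_nil addr0 TT => TE.
  rewrite {1}uE TE [in RHS]uE !rmorphM /= mulrA (mulrA fconst) fconstK mul1r.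
  rewrite fmorphV invrK rmorphM /=; ring.
have := E x0; rewrite -{1}[u x0]mul1r => /(mulIf ux0) /esym e.
have lC : lam%:C != 0 :> R[i].
  by apply/eqP => /(congr1 (@complex.Re R)) /= /eqP; rewrite (gt_eqF lam_gt0).
by rewrite -[lam'](mulfVK lC) e mul1r.
Qed.

End eigenfunctions.

(** * The kernel and its eigenfunction expansion *)

Section phase_continuity.
Context d (T : measurableType d) (R : realType) (m : {measure set T -> \bar R}).

(** Dominated convergence with bound 2 [cabs J]. Convergence along a + b / (j + 1) is the form of
    continuity that [ae_eq_everywhere] consumes. *)
Lemma cintegral_phase_ccvg (a b : T -> R) (J : T -> R[i]) :
  measurable_fun setT a -> measurable_fun setT b -> cintegrable m J ->
  ccvg (fun j => cintegral m (fun t => expi (a t + j.+1%:R^-1 * b t) * J t))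
    (cintegral m (fun t => expi (a t) * J t)).
Proof.
move=> ma mb iJ; have mJ := cintegrable_cmeas iJ.
apply: (@cintegral_ccvg _ _ _ m _ _ J 2) => //.
- move=> j; apply: cmeasM => //; apply: cmeas_expi.
  by apply: measurable_funD => //; exact: measurable_funM.
- by apply: cmeasM => //; exact: cmeas_expi.
- apply: aeW => t.
  have cv : (fun j : nat => a t + j.+1%:R^-1 * b t) @ \oo --> a t.
    rewrite -[X in _ --> X]addr0 -[X in _ --> _ + X](mul0r (b t)).
    apply: cvgD; first exact: cvg_cst.
    by apply: cvgM; [exact: cvg_harmonic|exact: cvg_cst].
  have cc := cvg_comp _ _ cv (@continuous_cos R (a t)).
  have cs := cvg_comp _ _ cv (@continuous_sin R (a t)).
  split.
    under eq_fun do rewrite ReM; rewrite ReM /=.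
    by apply: cvgB; apply: cvgM => //; exact: cvg_cst.
  under eq_fun do rewrite ImM; rewrite ImM /=.
  by apply: cvgD; apply: cvgM => //; exact: cvg_cst.
- by move=> j t; exact: cabs_expiM.
Qed.

End phase_continuity.

Section ae_everywhere.
Variables (R : realType) (n : nat).
Local Notation V := 'rV[R]_n.
Local Notation mu := (lebesgue_rV R n).

(** The space is not a null set: otherwise the nowhere vanishing regular function would vanish
    almost everywhere, hence everywhere. *)
Lemma ae_witness (P : V -> Prop) : {ae mu, forall x, P x} -> exists x, P x.
Proof.
move=> aeP; apply: contrapT => nP.
have [gam [rg g0]] := @regular_test_function R n.
have : {ae mu, forall x, gam x = 0}.
  by apply: filterS aeP => x Px; exfalso; apply: nP; exists x.
by move=> /(regular_eq0 rg) /(_ 0) /eqP; rewrite (negbTE (g0 _)).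
Qed.

(* An almost everywhere identity holds along a whole sequence [w + v / (j + 1)] for some [v]. *)
Lemma ae_eq_everywhere (F H : V -> R[i]) : {ae mu, forall w, F w = H w} ->
  (forall w v, ccvg (fun j => F (w + j.+1%:R^-1 *: v)) (F w)) ->
  (forall w v, ccvg (fun j => H (w + j.+1%:R^-1 *: v)) (H w)) ->
  forall w, F w = H w.
Proof.
move=> FH cF cH w.
have aej : {ae mu, forall v, forall j : nat, F (w + j.+1%:R^-1 *: v) = H (w + j.+1%:R^-1 *: v)}.
  apply: ae_foralln => j.
  have j0 : 0 < j.+1%:R^-1 :> R by rewrite invr_gt0.
  have := ae_mpres (mpres_rVD w) FH.
  move=> /(ae_mpres_mscale (mpres_rVZ n j0)).
  by apply: filterS => v; rewrite addrC.
have [v vP] := ae_witness aej.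
apply: (ccvg_unique (cF w v)).
by rewrite (_ : (fun j => _) = (fun j => H (w + j.+1%:R^-1 *: v)))//; exact/funext.
Qed.

End ae_everywhere.

(** * The star product as a deformed pointwise product *)

Section star_theta_convolution.
Variables (R : realType) (n : nat) (theta : 'M[R]_n).
Hypothesis thetaA : trmx theta = - theta.
Local Notation V := 'rV[R]_n.
Local Notation mu := (lebesgue_rV R n).
Local Notation mu2 := (lebesgue_rV2 R n).
Local Notation fconst := (@fconst R n).
Let mp := @measurable_dot_pairing R n.
Let pC := @dotC R n.

Let tconv_int (u v : V -> R[i]) : cintegrable mu (fourier u) -> cintegrable mu (fourier v) ->
  cintegrable (mu \x mu)%E (fun z : V * V =>
    expi (dot (z.1 *m theta) z.2 / 2) * (fourier u z.2 * fourier v (z.1 - z.2))).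
Proof.
by move=> iu iv; apply: cintegrable_expi (cintegrable_convolution iu iv); mtac.
Qed.

(** The phase is the Fourier image of translating v by -q theta/2, since q is orthogonal to q theta;
    [regularM] then reads the convolution as the transform of a product. *)
Let inner_conv (u v : V -> R[i]) q : regular u -> regular v ->
  cintegral mu (fun k => expi (dot (q *m theta) k / 2) * (fourier u k * fourier v (q - k))) =
  ((2 * pi) ^+ n)%:C * fourier (fun y => u y * v (y - 2^-1 *: (q *m theta))) q.
Proof.
move=> ru rv; have [_ ->] := regularM ru (regular_shift (- (2^-1 *: (q *m theta))) rv).
rewrite mulrA (mulrC _ fconst) fconstK mul1r; congr cintegral; apply/funext => k.
rewrite (fourier_shift (- (2^-1 *: (q *m theta))) (q - k) (regular_cintegrable rv)) mulrCA.
congr (_ * _); congr (expi _ * _).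
by rewrite !dotE !(dotC _ (q *m theta)) dot_mulmx0//; field.
Qed.

Lemma cintegrable_deformed_product (u v : V -> R[i]) : regular u -> regular v ->
  cintegrable mu (fun q => fourier (fun y => u y * v (y - 2^-1 *: (q *m theta))) q).
Proof.
move=> ru rv.
have := cintegrableZ fconst (cintegrable_slice (tconv_int (regular_fourier ru) (regular_fourier rv))).
congr (cintegrable _ _); apply/funext => q /=.
by rewrite inner_conv// mulrA fconstK mul1r.
Qed.

(** With q = k + k', antisymmetry gives theta(k, k') = theta(k, q), and [inner_conv] evaluates the
    integral over k. *)
Lemma star_theta_convolution (u v : V -> R[i]) x : regular u -> regular v ->
  star_theta theta u v x = fconst * cintegral mu (fun q =>
    expi (dot q x) * fourier (fun y => u y * v (y - 2^-1 *: (q *m theta))) q).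
Proof.
move=> ru rv; have iu := regular_fourier ru; have iv := regular_fourier rv.
rewrite star_thetaE -mulrA; congr (_ * _).
have iF : cintegrable mu2 (fun z : V * V =>
    expi (dot (z.1 + z.2) x - dot (z.1 *m theta) z.2 / 2) * (fourier u z.1 * fourier v z.2)).
  by apply: cintegrable_expi; [mtac|exact: cintegrable_tensor].
have -> : (fun z : V * V => expi (dot (z.1 + z.2) x - form theta z.1 z.2 / 2) *
    (fourier u z.1 * fourier v z.2)) = (fun z : V * V =>
    expi (dot (z.1 + z.2) x - dot (z.1 *m theta) z.2 / 2) * (fourier u z.1 * fourier v z.2)).
  by apply/funext => z; rewrite dot_mulmx.
have msh : mpres (mu \x mu)%E mu2 (fun z : V * V => (z.2, z.1 - z.2)).
  have m1 : mpres mu2 mu2 (fun z : V * V => (z.1, z.2 - z.1)).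
    apply: (@mpres_shear _ _ _ _ _ _ _ mu mu mu (fun z : V * V => z.2 - z.1)); first by mtac.
    by move=> y; exact: (mpres_rVD (- y)).
  exact: (mpres_comp (mpres_swap mu mu) m1).
rewrite (cintegral_mpres msh iF).
have ic := tconv_int iu iv.
have mx : measurable_fun setT (fun q => dot q x) by mtac.
have ex : (fun z : V * V => expi (dot (z.2 + (z.1 - z.2)) x - dot (z.2 *m theta) (z.1 - z.2) / 2) *
     (fourier u z.2 * fourier v (z.1 - z.2))) = (fun z : V * V => expi (dot z.1 x) *
     (expi (dot (z.1 *m theta) z.2 / 2) * (fourier u z.2 * fourier v (z.1 - z.2)))).
  apply/funext => z; rewrite [RHS]mulrA -expiD (addrC z.2) subrK; congr (expi _ * _).
  rewrite dotDr dotNr dot_mulmx0// (dot_mulmxC z.1 z.2 thetaA); by field.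
rewrite ex; have E := cintegral_fubini_expi1 ic mx.
rewrite E.
have -> : (fun q => expi (dot q x) * cintegral mu (fun k =>
    expi (dot (q *m theta) k / 2) * (fourier u k * fourier v (q - k)))) = (fun q =>
    ((2 * pi) ^+ n)%:C * (expi (dot q x) *
      fourier (fun y => u y * v (y - 2^-1 *: (q *m theta))) q)).
  by apply/funext => q; rewrite inner_conv// mulrCA.
rewrite cintegralZ; last first.
  by apply: cintegrable_expi; [mtac|exact: cintegrable_deformed_product].
by move: (cintegral _ _) => I; rewrite mulrA fconstK mul1r.
Qed.

End star_theta_convolution.

(** * Expansion of the kernel in eigenfunctions *)

Section kernel_expansion.
Variables (R : realType) (n : nat) (hbar : R) (theta : 'M[R]_n).
Variables (f : 'rV[R]_n -> 'rV[R]_n -> R).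
Hypotheses (hbar_gt0 : 0 < hbar) (thetaA : trmx theta = - theta).
Local Notation V := 'rV[R]_n.
Local Notation mu := (lebesgue_rV R n).
Local Notation mu2 := (lebesgue_rV2 R n).
Local Notation fconst := (@fconst R n).
Local Notation fC := (fun x p => (f x p)%:C).
Hypothesis f_int : cintegrable mu2 (fun z => (f z.1 z.2)%:C).
Hypothesis ft_int : cintegrable mu2 (fun z => fourier2 fC z.1 z.2).
Hypothesis fx_int : forall x, cintegrable mu (fun p => (f x p)%:C).
Local Notation alpha := (wsymbol hbar f).
Let mp := @measurable_dot_pairing R n.
Let pC := @dotC R n.
Let ia := cintegrable_wsymbol hbar_gt0 ft_int.

Variables (r : nat) (phi : 'I_r -> V -> R[i]).
Hypothesis rphi : forall i, regular (phi i).

Definition star_kernel x l : R[i] :=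
  \sum_(i < r) star_theta theta (phi i) (fun y => (phi i (l + y))^*%C) x.

Let rshift i l : regular (fun y => (phi i (l + y))^*%C).
Proof.
rewrite (_ : (fun y => _) = (fun y => (phi i (y + l))^*%C)).
  exact: regular_conj (regular_shift l (rphi i)).
by apply/funext => y; rewrite addrC.
Qed.

(** At frequency q the deformed product pairs phi_i(y) with the conjugate of phi_i(y + l - q
    theta/2). This displacement is [wshift theta (q, l)], so the sum over i is the reproducing
    kernel. *)
Lemma star_kernel_rkernel_ft x l : star_kernel x l = fconst * cintegral mu (fun q =>
  expi (dot q x) * rkernel_ft phi (wshift theta (q, l)) q).
Proof.
pose F i q := fourier (fun y => phi i y * (phi i (l + (y - 2^-1 *: (q *m theta))))^*%C) q.
have iF i : cintegrable mu (fun q => expi (dot q x) * F i q).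
  apply: cintegrable_expi; first by mtac.
  exact: (cintegrable_deformed_product thetaA (rphi i) (rshift i l)).
have E i : star_theta theta (phi i) (fun y => (phi i (l + y))^*%C) x =
    fconst * cintegral mu (fun q => expi (dot q x) * F i q).
  exact: (star_theta_convolution thetaA x (rphi i) (rshift i l)).
rewrite /star_kernel (eq_bigr _ (fun i _ => E i)) -mulr_sumr -cintegral_sum//.
congr (_ * _); congr cintegral; apply/funext => q; rewrite -mulr_sumr; congr (_ * _).
rewrite /rkernel_ft fourierE /rkernel (ft_sum mp) => [|i].
  apply: eq_bigr => i _; rewrite /F fourierE.
  have -> : (fun y => phi i y * (phi i (l + (y - 2^-1 *: (q *m theta))))^*%C) =
      (fun y => phi i y * (phi i (y + wshift theta (q, l)))^*%C).
    by apply/funext => y; rewrite /wshift /= addrCA.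
  by [].
apply: (cintegrable_inner (rphi i)).
exact: (regular_cintegrable (regular_shift _ (rphi i))).
Qed.

Variable lam : R.
Hypothesis lam_gt0 : 0 < lam.
Hypothesis ae_sym : {ae mu2, forall z, lam%:C * alpha z - rsymbol theta phi z = 0}.

Let lamC : lam%:C != 0 :> R[i].
Proof. by apply/eqP => /(congr1 (@complex.Re R)) /= /eqP; rewrite gt_eqF. Qed.

(** At the point x - l/2 the exponential acquires the factor e^(-iq.l/2), which is the phase of
    [rsymbol]; for almost every l the identity of symbols then applies under the integral. *)
Lemma ae_star_kernel x : {ae mu, forall l, star_kernel (x - 2^-1 *: l) l =
  lam%:C * (fconst * cintegral mu (fun q => expi (dot q x) * alpha (q, l)))}.
Proof.
have mD : cmeas (fun z => lam%:C * alpha z - rsymbol theta phi z).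
  apply: cmeasD; first by apply: cmeasM; [exact: cmeas_cst|exact: cintegrable_cmeas ia].
  apply: cmeasN; apply: cmeasM; first by apply: cmeas_expi; mtac.
  apply: (cmeas_comp (Phi := fun z : V * V => (wshift theta z, z.1)) _ (cmeas_rkernel_ft rphi)).
  by rewrite /wshift; mtac.
have h := ae_swap mD ((ae_prodP mu mu mD).1 ae_sym).
apply: filterS2 h (ae_wsymbol_slice hbar_gt0 ft_int) => l hl il.
rewrite star_kernel_rkernel_ft mulrCA; congr (_ * _).
rewrite -cintegralZ; last by apply: cintegrable_expi => //; mtac.
apply: ae_eq_cintegral.
- apply: cmeasM; first by apply: cmeas_expi; mtac.
  apply: (cmeas_comp (Phi := fun q : V => (wshift theta (q, l), q)) _ (cmeas_rkernel_ft rphi)).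
  by rewrite /wshift /=; mtac.
- apply: cmeasM; first exact: cmeas_cst.
  apply: cmeasM; first by apply: cmeas_expi; mtac.
  exact: cintegrable_cmeas il.
apply: filterS hl => q /eqP; rewrite subr_eq0 => /eqP E.
rewrite mulrCA E /rsymbol /= mulrA -expiD; congr (expi _ * _).
by rewrite !dotE; field.
Qed.

Variable kappa : R.
Hypothesis f_star : forall x p, star hbar theta fC fC x p = (kappa * f x p)%:C.
Hypothesis kappa_gt0 : 0 < kappa.

(** The phase-space transform inverted in position only: an integrable function of w whose inversion
    integral is f(x, .) at every p, by [phase_inversion]. *)
Definition marginal_ft x w : R[i] :=
  fconst * cintegral mu (fun q => expi (dot q x) * phase_ft f (q, w)).

Let iexp x : cintegrable (mu \x mu)%E (fun z : V * V => expi (dot z.2 x) * phase_ft f (z.2, z.1)).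
Proof. by apply: cintegrable_expi (cintegrable_swap ft_int); mtac. Qed.

Lemma cintegrable_marginal_ft x : cintegrable mu (marginal_ft x).
Proof. by apply: cintegrableZ; exact: (cintegrable_slice (iexp x)). Qed.

Lemma inv_fourier_marginal_ft x p : (f x p)%:C = inv_fourier (marginal_ft x) p.
Proof.
rewrite (phase_inversion f_int ft_int f_star x p); last by rewrite gt_eqF.
have iS := cintegrable_slice (iexp x).
have Z := iftZ mp fconst p iS.
rewrite -[inv_fourier (marginal_ft x) p]/(fconst * ift mu (@dot R n)
  (fun w => fconst * cintegral mu (fun q => expi (dot q x) * phase_ft f (q, w))) p) Z.
rewrite mulrA mul2n -addnn exprD invfM rmorphM; congr (_ * _).
have mx : measurable_fun setT (fun w => dot w p) by mtac.
have := cintegral_fubini_expi1 (iexp x) mx; rewrite -[RHS]/(ift mu (@dot R n) _ p) => <-.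
have iE : cintegrable mu2 (fun z => expi (dot2 z (x, p)) * phase_ft f z).
  by apply: cintegrable_expi ft_int; rewrite /dot2; mtac.
rewrite -[LHS]/(cintegral mu2 (fun z => expi (dot2 z (x, p)) * phase_ft f z)).
rewrite (cintegral_mpres (mpres_swap mu mu) iE).
congr cintegral; apply/funext => z; rewrite mulrA -expiD; congr (expi _ * _).
by rewrite /dot2 addrC.
Qed.

(** The final formula of the theorem, f as an integral over w, is this regularity once the star
    product in it is identified with the momentum transform. *)
Lemma regular_marginal x : regular (fun p => (f x p)%:C) /\
  {ae mu, forall w, momentum_ft f x w = marginal_ft x w}.
Proof.
exact: (regular_inv_fourier (cintegrable_marginal_ft x) (fx_int x) (inv_fourier_marginal_ft x)).
Qed.

Lemma ae_momentum_ft x : {ae mu, forall w, momentum_ft f x w =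
  lam%:C^-1 * star_kernel (x - (hbar / 2) *: w) (hbar *: w)}.
Proof.
have [_ h1] := regular_marginal x.
have h2 := ae_mpres_mscale (mpres_rVZ n hbar_gt0) (ae_star_kernel x).
apply: filterS2 h1 h2 => w -> E.
rewrite scalerA (mulrC 2^-1) in E; rewrite E (mulKf lamC).
have -> : (fun q => expi (dot q x) * alpha (q, hbar *: w)) =
    (fun q => expi (dot q x) * phase_ft f (q, w)).
  apply/funext => q; rewrite /wsymbol (_ : scale2 hbar^-1 (q, hbar *: w) = (q, w))//.
  exact: (scale2K hbar_gt0 (q, w)).
by [].
Qed.

Lemma momentum_ft_ccvg x w v :
  ccvg (fun j => momentum_ft f x (w + j.+1%:R^-1 *: v)) (momentum_ft f x w).
Proof.
have ma : measurable_fun setT (fun p => - dot w p) by mtac.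
have mb : measurable_fun setT (fun p => - dot v p) by mtac.
have := cintegral_phase_ccvg ma mb (fx_int x).
congr ccvg; apply/funext => j; congr cintegral; apply/funext => p.
by congr (expi _ * _); rewrite !dotE; ring.
Qed.

Let J (z : V * V) : R[i] :=
  \sum_(i < r) fourier (phi i) z.1 * fourier (fun y => (phi i y)^*%C) z.2.

Let iJ : cintegrable mu2 J.
Proof.
apply: cintegrable_sum => i; apply: cintegrable_tensor; apply: regular_fourier => //.
exact: regular_conj.
Qed.

(** x and l move entirely into the phase, which is affine in them at fixed z, so that
    [cintegral_phase_ccvg] yields continuity. *)
Lemma star_kernel_phase x l : lam%:C^-1 * star_kernel x l = cintegral mu2 (fun z =>
  expi (dot (z.1 + z.2) x - dot (z.1 *m theta) z.2 / 2 + dot z.2 l) *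
    (lam%:C^-1 * (fconst * fconst) * J z)).
Proof.
have iP i : cintegrable mu2 (fun z => expi (dot (z.1 + z.2) x - dot (z.1 *m theta) z.2 / 2 + dot z.2 l) *
    (fourier (phi i) z.1 * fourier (fun y => (phi i y)^*%C) z.2)).
  apply: cintegrable_expi; first by mtac.
  by apply: cintegrable_tensor; apply: regular_fourier => //; exact: regular_conj.
have E i : star_theta theta (phi i) (fun y => (phi i (l + y))^*%C) x = fconst * fconst *
    cintegral mu2 (fun z => expi (dot (z.1 + z.2) x - dot (z.1 *m theta) z.2 / 2 + dot z.2 l) *
      (fourier (phi i) z.1 * fourier (fun y => (phi i y)^*%C) z.2)).
  have ic := regular_cintegrable (regular_conj (rphi i)).
  have -> : (fun y => (phi i (l + y))^*%C) = (fun y => (phi i (y + l))^*%C).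
    by apply/funext => y; rewrite addrC.
  rewrite star_thetaE.
  have -> // : (fun z : V * V => expi (dot (z.1 + z.2) x - form theta z.1 z.2 / 2) *
      (fourier (phi i) z.1 * fourier (fun y => (phi i (y + l))^*%C) z.2)) =
    (fun z => expi (dot (z.1 + z.2) x - dot (z.1 *m theta) z.2 / 2 + dot z.2 l) *
      (fourier (phi i) z.1 * fourier (fun y => (phi i y)^*%C) z.2)).
  apply/funext => z; rewrite -dot_mulmx [in RHS]expiD.
  rewrite (fourier_shift (u := fun y => (phi i y)^*%C) l z.2 ic).
  by move: (fourier _ _) (fourier _ _) => c d; ring.
rewrite /star_kernel (eq_bigr _ (fun i _ => E i)) -mulr_sumr -cintegral_sum// mulrA.
rewrite -cintegralZ; last exact: cintegrable_sum.
by congr cintegral; apply/funext => z; rewrite /J -mulr_sumr mulrCA.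
Qed.

Lemma star_kernel_ccvg x w v : ccvg
  (fun j => lam%:C^-1 * star_kernel (x - (hbar / 2) *: (w + j.+1%:R^-1 *: v)) (hbar *: (w + j.+1%:R^-1 *: v)))
  (lam%:C^-1 * star_kernel (x - (hbar / 2) *: w) (hbar *: w)).
Proof.
have ma : measurable_fun setT (fun z : V * V => dot (z.1 + z.2) (x - (hbar / 2) *: w)
  - dot (z.1 *m theta) z.2 / 2 + dot z.2 (hbar *: w)) by mtac.
have mb : measurable_fun setT (fun z : V * V => dot z.2 (hbar *: v) -
  dot (z.1 + z.2) ((hbar / 2) *: v)) by mtac.
pose L y := lam%:C^-1 * star_kernel (x - (hbar / 2) *: y) (hbar *: y).
pose K y := cintegral mu2 (fun z : V * V => expi (dot (z.1 + z.2) (x - (hbar / 2) *: y) -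
  dot (z.1 *m theta) z.2 / 2 + dot z.2 (hbar *: y)) * (lam%:C^-1 * (fconst * fconst) * J z)).
have LK : L = K by apply/funext => y; exact: star_kernel_phase.
suff : ccvg (fun j => L (w + j.+1%:R^-1 *: v)) (L w) by [].
rewrite LK.
have := cintegral_phase_ccvg ma mb (cintegrableZ (lam%:C^-1 * (fconst * fconst)) iJ).
congr ccvg; apply/funext => j; congr cintegral; apply/funext => z.
by congr (expi _ * _); rewrite !dotE; ring.
Qed.

Lemma momentum_ftE x w : momentum_ft f x w =
  lam%:C^-1 * star_kernel (x - (hbar / 2) *: w) (hbar *: w).
Proof.
exact: (ae_eq_everywhere (ae_momentum_ft x) (momentum_ft_ccvg x) (star_kernel_ccvg x)).
Qed.

Variable G : V -> V -> R[i].
Hypothesis G_def : forall x w, G (x - (hbar / 2) *: w) (x + (hbar / 2) *: w)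
  = cintegral mu (fun p => expi (- dot w p) * (f x p)%:C).

Lemma kernel_expansion x l : G x (l + x) = lam%:C^-1 * star_kernel x l.
Proof.
rewrite -[LHS]/(kslice G l x) (ksliceE hbar_gt0 G_def) momentum_ftE scalerA.
rewrite (_ : hbar / 2 * hbar^-1 = 2^-1); last by field; rewrite gt_eqF.
by rewrite addrK scalerA mulfV ?scale1r// gt_eqF.
Qed.

End kernel_expansion.

(** A common translation multiplies the two transforms by e^(ik.s) and e^(ik'.s), which
    e^(i(k+k').x) absorbs. *)
Lemma star_theta_shift (R : realType) (n : nat) (theta : 'M[R]_n) (u v : 'rV[R]_n -> R[i]) s x :
  cintegrable (lebesgue_rV R n) u -> cintegrable (lebesgue_rV R n) v ->
  star_theta theta (fun y => u (y + s)) (fun y => v (y + s)) x = star_theta theta u v (x + s).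
Proof.
move=> iu iv; rewrite !star_thetaE.
have -> // : (fun z => expi (dot (z.1 + z.2) x - form theta z.1 z.2 / 2) *
    (fourier (fun y => u (y + s)) z.1 * fourier (fun y => v (y + s)) z.2)) =
  (fun z => expi (dot (z.1 + z.2) (x + s) - form theta z.1 z.2 / 2) *
    (fourier u z.1 * fourier v z.2)).
apply/funext => z; rewrite (fourier_shift s z.1 iu) (fourier_shift s z.2 iv).
rewrite [X in _ * X = _]mulrACA -expiD [LHS]mulrA -expiD.
by congr (expi _ * _); rewrite !dotE; ring.
Qed.

Lemma orthonormal_neq0 (R : realType) (n m : nat) (phi : 'I_m -> 'rV[R]_n -> R[i]) i :
  Defs.orthonormal phi -> exists x, phi i x != 0.
Proof.
move=> ophi; apply: contrapT => nx; have := ophi i i; rewrite eqxx.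
rewrite (_ : (fun x => _) = fun=> 0); first by rewrite cintegral0 => /eqP; rewrite eq_sym oner_eq0.
apply/funext => x; have [->|nz] := eqVneq (phi i x) 0; first by rewrite mul0r.
by exfalso; apply: nx; exists x.
Qed.

Theorem mainTheorem5 (R : realType) (n : nat) (hbar : R) (theta : 'M[R]_n)
    (f : 'rV[R]_n -> 'rV[R]_n -> R) (kappa : R)
    (G : 'rV[R]_n -> 'rV[R]_n -> R[i])
    (n_ge1 : (1 <= n)%N) (hbar_gt0 : 0 < hbar) (theta_anti : theta^T = - theta)
    (* the Fourier representation of f and the integrals below are meaningful *)
    (f_int : cintegrable (lebesgue_rV2 R n) (fun z => (f z.1 z.2)%:C))
    (ft_int : cintegrable (lebesgue_rV2 R n)
       (fun z => fourier2 (fun x p => (f x p)%:C) z.1 z.2))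
    (fx_int : forall x, cintegrable (lebesgue_rV R n) (fun p => (f x p)%:C))
    (f_total : cintegral (lebesgue_rV2 R n) (fun z => (f z.1 z.2)%:C) = 1)
    (f_star : forall x p,
       star hbar theta (fun x p => (f x p)%:C) (fun x p => (f x p)%:C) x p
       = (kappa * f x p)%:C)
    (G_def : forall x w,
       G (x - (hbar / 2) *: w) (x + (hbar / 2) *: w)
       = cintegral (lebesgue_rV R n) (fun p => expi (- dot w p) * (f x p)%:C))
    (G_herm : forall x l, (G x l)^*%C = G l x)
    (G_sqint : cintegrable (lebesgue_rV2 R n) (fun z => `|G z.1 z.2| ^+ 2))
    (G_norm : cintegral (lebesgue_rV2 R n) (fun z => `|G z.1 z.2| ^+ 2)
       = (kappa * (2 * pi * hbar) ^+ n)%:C) :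
  let lam : R[i] := (1 / (kappa * (2 * pi * hbar) ^+ n))%:C in
  (forall lam' : R[i], eigenvalue_of theta G lam' <-> lam' = lam) /\
  exists (m : nat) (phi : 'I_m -> 'rV[R]_n -> R[i]),
    [/\ (1 <= m)%N,
        eigenbasis theta G lam phi,
        (forall x l, G x (l + x)
           = \sum_(i < m) lam^-1 *
               star_theta theta (phi i) (fun y => (phi i (l + y))^*%C) x),
        kappa = 1 / (m%:R * (2 * pi * hbar) ^+ n) &
        m = 1%N ->
        (forall x p,
           star hbar theta (fun x p => (f x p)%:C) (fun x p => (f x p)%:C) x p
           = (((2 * pi * hbar) ^+ n)^-1 * f x p)%:C) /\
        exists psi : 'rV[R]_n -> R[i],
          let W x w := star_theta theta
            (fun y => psi (y - (hbar / 2) *: w))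
            (fun y => (psi (y + (hbar / 2) *: w))^*%C) x in
          [/\ square_integrable psi /\ fourier_integrable psi,
              cintegral (lebesgue_rV R n) (fun x => `|psi x| ^+ 2) = 1,
              forall x w,
                G (x - (hbar / 2) *: w) (x + (hbar / 2) *: w) = W x w,
              forall x p, cintegrable (lebesgue_rV R n)
                (fun w => expi (dot p w) * W x w) &
              forall x p, (f x p)%:C = (((2 * pi) ^+ n)^-1)%:C *
                cintegral (lebesgue_rV R n)
                  (fun w => expi (dot p w) * W x w)]].
Proof.
move=> lam.
have kappa_gt0 := kappa_gt0 hbar_gt0 f_int ft_int G_def G_sqint G_norm f_total.
(* [K] is 1/lam; with [K^-1] as eigenvalue the twisted identity and the normalization take the form
   that [twisted_idempotent_spectrum] expects. *)
pose K := kappa * (2 * pi * hbar) ^+ n.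
have hn_gt0 : 0 < (2 * pi * hbar) ^+ n by rewrite exprn_gt0// mulr_gt0// twopi_gt0.
have K_gt0 : 0 < K by rewrite mulr_gt0.
have l_gt0 : 0 < K^-1 by rewrite invr_gt0.
have lamE : lam = (K^-1)%:C by rewrite /lam div1r.
have ia := cintegrable_wsymbol hbar_gt0 ft_int.
have tw := ae_twisted hbar_gt0 f_int ft_int f_star.
have sqE := cintegral_wsymbol_sq hbar_gt0 f_int ft_int G_def G_sqint G_norm.
have KE : (2 * pi) ^+ n * K = (2 * pi) ^+ n / K^-1 by rewrite invrK.
rewrite -/K KE in tw; rewrite -/K KE in sqE.
have [m [phi [[Ephi ophi] mE span ae0]]] := twisted_idempotent_spectrum theta_anti l_gt0 ia
  (wsymbol_opp hbar f_int) tw (cintegrable_wsymbol_sq hbar_gt0 f_int ft_int) sqE.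
have rphi i : regular (phi i) by case: (Ephi i).
have eigP := eigenfunctionP theta hbar_gt0 f_int ft_int G_def.
have eig i : eigenfunction theta G lam (phi i).
  apply/eigP; rewrite lamE; have [ri Ei] := Ephi i; split=> //.
  exact: orthonormal_neq0 ophi.
(* The multiplicity equals the positive number [K^-1], so it is not 0. *)
have m_ge1 : (1 <= m)%N by rewrite -(ltr_nat R) mE.
have expansion := kernel_expansion hbar_gt0 theta_anti f_int ft_int fx_int rphi l_gt0 ae0
  f_star kappa_gt0 G_def.
split=> [lam'|].
  split=> [[u /(eigenfunction_eigenvalue hbar_gt0 f_int ft_int G_def f_star kappa_gt0) ->]|->].
    by rewrite lamE.
  by exists (phi (Ordinal m_ge1)).
exists m, phi; split=> //.
- split=> // u /eigP[ru _ uE]; exists (fun i => inner u (phi i)); apply: span.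
  by split=> // x; rewrite -lamE.
- by move=> x l; rewrite expansion lamE -mulr_sumr.
- by rewrite mE /K; field; rewrite !gt_eqF.
(* For m = 1 the eigenvalue is 1, which fixes kappa and removes the factor [K] from the kernel. *)
move=> m1; have K1 : K = 1 by rewrite -[K]invrK -mE m1 invr1.
have kE : kappa = ((2 * pi * hbar) ^+ n)^-1.
  by apply: (mulIf (lt0r_neq0 hn_gt0)); rewrite mulVf ?gt_eqF// -K1.
split=> [x p|]; first by rewrite f_star kE.
pose i0 : 'I_m := Ordinal m_ge1.
pose psi := phi i0; have rpsi : regular psi := rphi i0.
exists psi => W.
have norm_psi : cintegral (lebesgue_rV R n) (fun x => `|psi x| ^+ 2) = 1.
  have := ophi i0 i0; rewrite eqxx => E; apply: (etrans _ E).
  by congr cintegral; apply/funext => x; rewrite sqr_normc.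
have momentumE := momentum_ftE hbar_gt0 theta_anti f_int ft_int fx_int rphi l_gt0 ae0
  f_star kappa_gt0.
have ipsi : cintegrable (lebesgue_rV R n) psi := regular_cintegrable rpsi.
(* With a single eigenfunction [star_kernel] is one star product; a common translation by -(hbar/2)
   w brings it to the symmetric arguments of [W]. *)
have WE x w : W x w = momentum_ft f x w.
  rewrite momentumE K1 invr1 invr1 mul1r /star_kernel (bigD1 i0)//= big1 ?addr0; last first.
    move=> i; have := ltn_ord i; rewrite {2}m1 ltnS leqn0 => /eqP i_0 /eqP[].
    exact: val_inj.
  have ic : cintegrable (lebesgue_rV R n) (fun y => (psi (hbar *: w + y))^*%C).
    apply: cintegrable_conj; have := cintegrable_shift (hbar *: w) ipsi.
    by congr cintegrable; apply/funext => y; rewrite addrC.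
  have S := star_theta_shift theta (- ((hbar / 2) *: w)) x ipsi ic.
  rewrite -[RHS]S /W.
  have -> // : (fun y => (psi (y + (hbar / 2) *: w))^*%C) =
      (fun y => (psi (hbar *: w + (y - (hbar / 2) *: w)))^*%C).
  apply/funext => y; rewrite addrCA -scalerBl.
  by have -> : hbar - hbar / 2 = hbar / 2 by field.
have Gm x w : G (x - (hbar / 2) *: w) (x + (hbar / 2) *: w) = momentum_ft f x w by exact: G_def.
have rf x := (regular_marginal f_int ft_int fx_int f_star kappa_gt0 x).1.
have WE' x : W x = fourier (fun p => (f x p)%:C) by apply/funext => w; exact: WE.
split.
- split; last by case: rpsi.
  have := cintegrable_inner rpsi ipsi.
  by congr cintegrable; apply/funext => x; rewrite sqr_normc.
- exact: norm_psi.
- by move=> x w; rewrite WE.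
- move=> x p; rewrite WE'.
  exact: (cintegrable_expi (measurable_dotl p) (regular_fourier (rf x))).
- move=> x p; have [_ {1}->] := rf x; rewrite WE' /inv_fourier; congr (_ * _).
  by congr cintegral; apply/funext => w; rewrite dotC.
Qed.
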